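(* Let $0<p<\infty$, $0<q,q_0\leq\infty$, $s\in\mathbb{R}$ and $\varphi\in\mathcal{G}_p$. If $q<\infty$, assume in addition that there exist $C,\varepsilon>0$ such that $\frac{t^\varepsilon}{\varphi(t)}\le\frac{Cr^\varepsilon}{\varphi(r)}$ for all $t\ge r>0$. (i) Then $\mathcal{N}_{\varphi,p,\min(p,q)}^s(\mathbb{R}^d)\hookrightarrow\mathcal{E}^{s}_{\varphi,p,q}(\mathbb{R}^d)$. (ii) Assume that $$\lim_{t\to0^+}t^{-\frac dp}\varphi(t)<\infty\quad\text{and}\quad\lim_{t\to+\infty}t^{-\frac dp}\varphi(t)>0.$$ Then $$\mathcal{E}^{s}_{\varphi,p,q}(\mathbb{R}^d)\hookrightarrow\mathcal{N}_{\varphi,p,q_0}^s(\mathbb{R}^d)$$ if, and only if, $q_0\ge\max(p,q)$. (iii) Otherwise, i.e. if it is not the case that both $\lim_{t\to0^+}t^{-\frac dp}\varphi(t)<\infty$ and $\lim_{t\to+\infty}t^{-\frac dp}\varphi(t)>0$, the embedding $\mathcal{E}^{s}_{\varphi,p,q}(\mathbb{R}^d)\hookrightarrow\mathcal{N}_{\varphi,p,q_0}^s(\mathbb{R}^d)$ holds if, and only if, $q_0=\infty$.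
   Context: Notation: $d\in\mathbb{N}$; $\mathcal{Q}=\{2^{-j}([0,1)^d+k): j\in\mathbb{Z},k\in\mathbb{Z}^d\}$ is the set of dyadic cubes; $\ell(P)$ and $|P|$ are side length and volume of $P$. $Q(r)$ is the compact cube centred at $0$ with side length $r$ and sides parallel to the axes. $X\hookrightarrow Y$ means $X\subset Y$ with continuous natural embedding. Class $\mathcal{G}_p$ ($0<p<\infty$): all non-decreasing $\varphi:(0,\infty)\to(0,\infty)$ with $t^{-d/p}\varphi(t)\ge s^{-d/p}\varphi(s)$ for all $0<t\le s<\infty$. Generalised Morrey space: $\|f\mid\mathcal{M}_{\varphi,p}(\mathbb{R}^d)\|=\sup_{P\in\mathcal{Q}}\varphi(\ell(P))\left(\frac1{|P|}\int_P|f(y)|^p\,dy\right)^{1/p}$. Let $\eta_0,\eta\in\mathcal{S}(\mathbb{R}^d)$ be non-negative compactly supported with $\eta_0(x)>0$ if $x\in Q(2)$, $0\notin\operatorname{supp}\eta$ and $\eta(x)>0$ if $x\in Q(2)\setminus Q(1)$; $\eta_j(x)=\eta(2^{-j}x)$, $j\in\mathbb{N}$. The generalised Besov-Morrey space $\mathcal{N}^{s}_{\varphi,p,q}(\mathbb{R}^d)$ and the generalised Triebel-Lizorkin-Morrey space $\mathcal{E}^{s}_{\varphi,p,q}(\mathbb{R}^d)$ consist of all $f\in\mathcal{S}'(\mathbb{R}^d)$ for which, respectively, $$\|f\mid\mathcal{N}^{s}_{\varphi,p,q}\|=\left(\sum_{j=0}^\infty2^{jsq}\|(\eta_j\widehat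 f)^\vee\mid\mathcal{M}_{\varphi,p}(\mathbb{R}^d)\|^q\right)^{1/q},\qquad \|f\mid\mathcal{E}^{s}_{\varphi,p,q}\|=\left\|\left(\sum_{j=0}^\infty2^{jsq}|(\eta_j\widehat f)^\vee(\cdot)|^q\right)^{1/q}\Big|\ \mathcal{M}_{\varphi,p}(\mathbb{R}^d)\right\|$$ is finite (usual modification for $q=\infty$). *)

(* Defs.v *)
From HB Require Import structures.
From mathcomp Require Import all_boot all_order all_algebra.
From mathcomp Require Import complex.
From mathcomp Require Import all_classical all_reals all_analysis.

Set Implicit Arguments.
Unset Strict Implicit.
Unset Printing Implicit Defensive.

Import Order.TTheory GRing.Theory Num.Theory.
Import numFieldNormedType.Exports.

Local Open Scope classical_set_scope.
Local Open Scope ring_scope.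
Local Open Scope complex_scope.

(* R^d is 'rV[R]_d, with the sup norm of the library. Its sigma-algebra is
   generated by the coordinates, i.e. it is the Borel sigma-algebra. *)

Definition rV_display : measure_display.
Proof. exact: default_measure_display. Qed.

Section rV_measurable.
Context (R : realType) (n : nat).

Definition rV_coord (i : 'I_n) (x : 'rV[R]_n) : measurableTypeR R := x ord0 i.

Let rV_set0 : g_sigma_preimage rV_coord set0.
Proof. exact: sigma_algebra0. Qed.

Let rV_setC A : g_sigma_preimage rV_coord A -> g_sigma_preimage rV_coord (~` A).
Proof. exact: sigma_algebraC. Qed.

Let rV_bigcup (F : (set 'rV[R]_n)^nat) :
  (forall i, g_sigma_preimage rV_coord (F i)) ->
  g_sigma_preimage rV_coord (\bigcup_i (F i)).
Proof. exact: sigma_algebra_bigcup. Qed.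

HB.instance Definition _ := @isMeasurable.Build rV_display
  'rV[R]_n (g_sigma_preimage rV_coord) rV_set0 rV_setC rV_bigcup.

End rV_measurable.

Definition cons_rV (R : realType) (n : nat)
    (xv : measurableTypeR R * 'rV[R]_n) : 'rV[R]_n.+1 :=
  \row_i (if unlift ord0 i is Some j then xv.2 ord0 j else xv.1).

Section lebesgue_rV.
Context (R : realType).

Lemma measurable_rV_coord n (i : 'I_n) :
  measurable_fun [set: 'rV[R]_n] (@rV_coord R n i).
Proof.
move=> _ Y mY; rewrite setTI; apply: sub_sigma_algebra => /=.
rewrite -bigcup_seq/=; exists i => /=; first by rewrite mem_index_enum.
by exists Y => //; rewrite setTI.
Qed.

Lemma measurable_fun_rV n d (T : measurableType d) (f : T -> 'rV[R]_n) :
  (forall i, measurable_fun [set: T] (rV_coord i \o f)) ->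
  measurable_fun [set: T] f.
Proof.
move=> mf.
apply: (@measurability _ _ _ _ _ _
  (\big[setU/set0]_(i < n) preimage_set_system setT (@rV_coord R n i) measurable)).
  by [].
move=> _ [B + <-]; rewrite -bigcup_seq/= => -[i _ [A mA <-]].
by have := mf i measurableT _ mA; rewrite !setTI.
Qed.

Lemma measurable_cons_rV n : measurable_fun setT (@cons_rV R n).
Proof.
apply: measurable_fun_rV => i; rewrite /comp /rV_coord /cons_rV.
under eq_fun do rewrite mxE.
case: (unlift ord0 i) => [j|]; last exact: measurable_fst.
apply: (measurableT_comp (measurable_rV_coord j)).
exact: (@measurable_snd _ _ (measurableTypeR R) 'rV[R]_n).
Qed.

Section cons_measure.
Local Open Scope ereal_scope.
Context (n : nat) (mu : {sigma_finite_measure set 'rV[R]_n -> \bar R}).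

Definition cons_measure : set 'rV[R]_n.+1 -> \bar R :=
  pushforward (lebesgue_measure \x mu) (@cons_rV R n).

Let measurable_preim A : measurable A -> measurable (@cons_rV R n @^-1` A).
Proof. by move=> mA; rewrite -[X in measurable X]setTI; exact: measurable_cons_rV. Qed.

Let cons_measure0 : cons_measure set0 = 0.
Proof. by rewrite /cons_measure /pushforward preimage_set0 measure0. Qed.

Let cons_measure_ge0 A : 0 <= cons_measure A.
Proof. by rewrite /cons_measure /pushforward measure_ge0. Qed.

Let cons_measure_sigma_additive : semi_sigma_additive cons_measure.
Proof.
move=> F mF tF mUF; rewrite /cons_measure /pushforward preimage_bigcup.
apply: measure_semi_sigma_additive.
- by move=> k; exact: measurable_preim.
- apply/trivIsetP => /= i j _ _ ij; rewrite -preimage_setI.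
  by move/trivIsetP : tF => /(_ _ _ _ _ ij) ->//; rewrite preimage_set0.
- by rewrite -preimage_bigcup; exact: measurable_preim.
Qed.

HB.instance Definition _ := isMeasure.Build _ _ _ cons_measure
  cons_measure0 cons_measure_ge0 cons_measure_sigma_additive.

Let cons_measure_sigma_finite : sigma_finite setT cons_measure.
Proof.
have [G TG Goo] : sigma_finite setT (lebesgue_measure \x mu).
  have /sigma_finiteP[A [TA ndA Aoo]] := sigma_finiteT (@lebesgue_measure R).
  have /sigma_finiteP[B [TB ndB Boo]] := sigma_finiteT mu.
  exists (fun k => A k `*` B k).
    rewrite -setXTT TA TB; apply/seteqP; split => -[x y] /=.
      move=> [[k _ Akx] [l _ Bly]]; exists (maxn k l) => //; split.
      - by move: x Akx; exact/subsetPset/ndA/leq_maxl.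
      - by move: y Bly; exact/subsetPset/ndB/leq_maxr.
    by move=> [k _ []/= ? ?]; split; exists k.
  move=> k; have [? ?] := Aoo k; have [? ?] := Boo k.
  split; first exact: measurableX.
  by rewrite product_measure1E// lte_mul_pinfty// ge0_fin_numE.
exists (fun k => [set x : 'rV[R]_n.+1 |
    G k (x ord0 ord0, \row_j x ord0 (lift ord0 j))]).
  apply/seteqP; split => // x _.
  have : setT (x ord0 ord0 : measurableTypeR R, \row_j x ord0 (lift ord0 j)).
    by [].
  by rewrite TG => -[k _ Gk]; exists k.
move=> k; have [mG Gk] := Goo k; split.
  rewrite -[X in measurable X]setTI.
  apply: (_ : measurable_fun setT (fun x : 'rV[R]_n.+1 =>
    (x ord0 ord0 : measurableTypeR R, \row_j x ord0 (lift ord0 j)))) => //.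
  apply/measurable_fun_pairP; split; first exact: (measurable_rV_coord ord0).
  apply: measurable_fun_rV => j; rewrite /comp/= /rV_coord.
  under eq_fun do rewrite mxE.
  exact: (measurable_rV_coord (lift ord0 j)).
rewrite /cons_measure /pushforward (_ : _ @^-1` _ = G k)//.
apply/seteqP; split => -[a v]; rewrite /preimage/= /cons_rV !mxE unlift_none/=;
  by congr (G k (_, _)); apply/rowP => j; rewrite !mxE liftK.
Qed.

HB.instance Definition _ := Measure_isSigmaFinite.Build _ _ _ cons_measure
  cons_measure_sigma_finite.

End cons_measure.

Fixpoint lebesgue_rV (n : nat) : {sigma_finite_measure set 'rV[R]_n -> \bar R} :=
  match n with
  | 0 => \d_(0 : 'rV[R]_0)
  | m.+1 => cons_measure (lebesgue_rV m)
  end.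
End lebesgue_rV.

Section schwartz.
Context (R : realType) (d : nat).
Implicit Types (phi psi : 'rV[R]_d -> R[i]) (x xi : 'rV[R]_d).

(* pderiv [:: i1; ...; im] f is the iterated partial derivative
   D_i1 (... (D_im f)), for real-valued f. *)
Fixpoint pderiv (l : seq 'I_d) (f : 'rV[R]_d -> R) : 'rV[R]_d -> R :=
  if l is i :: l' then 'D_(delta_mx ord0 i) (pderiv l' f) else f.

(* C^oo: partial derivatives of all orders exist and are continuous. *)
Definition smooth (f : 'rV[R]_d -> R) : Prop :=
  forall l : seq 'I_d, continuous (pderiv l f) /\
    forall i x, derivable (pderiv l f) x (delta_mx ord0 i).

Definition Re_fun phi : 'rV[R]_d -> R := fun x => complex.Re (phi x).
Definition Im_fun phi : 'rV[R]_d -> R := fun x => complex.Im (phi x).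

(* Complex modulus, as a real number. *)
Definition cmod (z : R[i]) : R := complex.Re `|z|.

Definition cpderiv (l : seq 'I_d) phi : 'rV[R]_d -> R[i] :=
  fun x => pderiv l (Re_fun phi) x +i* pderiv l (Im_fun phi) x.

(* The N-th of the usual increasing family of seminorms defining the topology
   of the Schwartz space. *)
Definition schwartz_seminorm (N : nat) phi : \bar R :=
  ereal_sup [set ((1 + `|x|) ^+ N * cmod (cpderiv l phi x))%:E
            | l in [set l : seq 'I_d | (size l <= N)%N] & x in [set: 'rV[R]_d]].

Definition schwartz : set ('rV[R]_d -> R[i]) :=
  [set phi | [/\ smooth (Re_fun phi), smooth (Im_fun phi) &
                 forall N, (schwartz_seminorm N phi < +oo)%E]].

(* A distribution is a functional on all functions R^d -> C, of which only the
   restriction to the Schwartz space is meaningful: everything below applies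
   functionals to Schwartz functions only. *)
Definition functional : Type := ('rV[R]_d -> R[i]) -> R[i].

(* S'(R^d): linear functionals, continuous for the topology generated by the
   (increasing) family of Schwartz seminorms. *)
Definition tempered : set functional :=
  [set T | (forall (a : R[i]) phi psi, schwartz phi -> schwartz psi ->
              T (fun x => a * phi x + psi x) = a * T phi + T psi) /\
           (forall phi, schwartz phi -> forall eps : R, 0 < eps ->
              exists (N : nat) (delta : R), 0 < delta /\
                forall psi, schwartz psi ->
                  (schwartz_seminorm N (psi \- phi)%R < delta%:E)%E ->
                  cmod (T psi - T phi) < eps)].

Definition cintegrable phi : Prop :=
  (lebesgue_rV R d).-integrable setT (EFin \o Re_fun phi) /\
  (lebesgue_rV R d).-integrable setT (EFin \o Im_fun phi).

Definition cintegral phi : R[i] :=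
  (\int[lebesgue_rV R d]_x Re_fun phi x) +i*
  (\int[lebesgue_rV R d]_x Im_fun phi x).

Definition dotr x xi : R := \sum_(i < d) x ord0 i * xi ord0 i.

Definition expi (t : R) : R[i] := cos t +i* sin t.

(* Unitary normalisation (2 pi)^(-d/2) of the Fourier transform. *)
Definition fourier phi : 'rV[R]_d -> R[i] := fun xi =>
  ((2 * pi) `^ (- (d%:R / 2)))%:C *
  cintegral (fun x => expi (- dotr x xi) * phi x).

Definition inv_fourier phi : 'rV[R]_d -> R[i] := fun x =>
  ((2 * pi) `^ (- (d%:R / 2)))%:C *
  cintegral (fun xi => expi (dotr x xi) * phi xi).

Definition dist_fourier (T : functional) : functional :=
  fun phi => T (fourier phi).

Definition dist_inv_fourier (T : functional) : functional :=
  fun phi => T (inv_fourier phi).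

Definition dist_mul (eta : 'rV[R]_d -> R) (T : functional) : functional :=
  fun phi => T (fun x => (eta x)%:C * phi x).

(* h is a continuous function whose regular distribution is T. *)
Definition represents (h : 'rV[R]_d -> R[i]) (T : functional) : Prop :=
  [/\ continuous (Re_fun h), continuous (Im_fun h) &
      forall phi, schwartz phi -> cintegrable (fun x => h x * phi x) /\
        T phi = cintegral (fun x => h x * phi x)].

(* The (unique) continuous function identified with T, when there is one. By
   the Paley-Wiener-Schwartz theorem there is one for every distribution to
   which this is applied below (it has a compactly supported Fourier
   transform); the default value 0 is never used. *)
Definition fun_of_dist (T : functional) : 'rV[R]_d -> R[i] :=
  xget (fun=> 0) [set h | represents h T].

End schwartz.

Arguments schwartz {R d} _.
Arguments tempered {R d} _.

Section spaces.
Context (R : realType) (d : nat).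
Implicit Types (s p : R) (q : \bar R) (phi : R -> R) (F : 'rV[R]_d -> \bar R).
Implicit Types f : functional R d.

Definition side (j : int) : R := 2 ^ (- j).

(* The dyadic cube 2^-j ([0,1)^d + k), of side length [side j]. *)
Definition dyadic_cube (j : int) (k : 'rV[int]_d) : set 'rV[R]_d :=
  [set side j *: (y + map_mx intr k) |
     y in [set y : 'rV[R]_d | forall i, 0 <= y ord0 i < 1]].

Definition volume (P : set 'rV[R]_d) : R := fine (lebesgue_rV R d P).

Local Open Scope ereal_scope.

(* Morrey quasi-norm; F : R^d -> [0, +oo] is the modulus of the function. *)
Definition morrey_norm phi p F : \bar R :=
  ereal_sup [set (phi (side j))%:E *
      ((volume (dyadic_cube j k))^-1%:E *
        \int[lebesgue_rV R d]_(y in dyadic_cube j k) (F y `^ p)) `^ p^-1%R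
    | j in [set: int] & k in [set: 'rV[int]_d]].

(* (sum_j 2^(j s q) a_j^q)^(1/q), resp. sup_j 2^(j s) a_j if q = +oo *)
Definition weighted_lq s q (a : nat -> \bar R) : \bar R :=
  if q is r%:E
  then (\sum_(0 <= j <oo) (2 `^ (j%:R * s * r))%:E * a j `^ r) `^ r^-1%R
  else ereal_sup [set (2 `^ (j%:R * s))%:E * a j | j in [set: nat]].

Definition eta_ (eta0 eta : 'rV[R]_d -> R) (j : nat) : 'rV[R]_d -> R :=
  if j is 0%N then eta0 else fun x => eta ((2 ^- j)%R *: x).

(* x |-> (eta_j f^)^v (x) *)
Definition lp_block (eta0 eta : 'rV[R]_d -> R) f (j : nat) : 'rV[R]_d -> R[i] :=
  fun_of_dist (dist_inv_fourier (dist_mul (eta_ eta0 eta j) (dist_fourier f))).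

Definition N_norm (eta0 eta : 'rV[R]_d -> R) s phi p q f : \bar R :=
  weighted_lq s q (fun j =>
    morrey_norm phi p (fun x => (cmod (lp_block eta0 eta f j x))%:E)).

Definition E_norm (eta0 eta : 'rV[R]_d -> R) s phi p q f : \bar R :=
  morrey_norm phi p (fun x =>
    weighted_lq s q (fun j => (cmod (lp_block eta0 eta f j x))%:E)).

Definition space (norm : functional R d -> \bar R) : set (functional R d) :=
  [set f | tempered f /\ norm f < +oo].

(* X c Y, and the inclusion is continuous, for the spaces X and Y of tempered
   distributions with finite quasi-norm normX, resp. normY. *)
Definition embeds (normX normY : functional R d -> \bar R) : Prop :=
  space normX `<=` space normY /\
  forall f, space normX f -> forall eps : R, (0 < eps)%R ->
    exists2 delta : R, (0 < delta)%R &
      forall g, space normX g -> normX (g \- f)%R < delta%:E ->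
        normY (g \- f)%R < eps%:E.

Local Open Scope ring_scope.

Definition class_G p phi : Prop :=
  [/\ forall t, 0 < t -> 0 < phi t,
      forall t u, 0 < t -> t <= u -> phi t <= phi u &
      forall t u, 0 < t -> t <= u ->
        u `^ (- (d%:R / p)) * phi u <= t `^ (- (d%:R / p)) * phi t].

(* Closed cube centred at 0 with side length r. *)
Definition cube0 (r : R) : set 'rV[R]_d :=
  [set x | forall i, `|x ord0 i| <= r / 2].

Definition supp (h : 'rV[R]_d -> R) : set 'rV[R]_d :=
  closure [set x | h x != 0].

Definition test_fun (h : 'rV[R]_d -> R) : Prop :=
  [/\ schwartz (fun x => (h x)%:C), forall x, 0 <= h x & compact (supp h)].

Definition admissible_eta (eta0 eta : 'rV[R]_d -> R) : Prop :=
  [/\ test_fun eta0, test_fun eta,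
      forall x, cube0 2 x -> 0 < eta0 x,
      ~ supp eta 0 &
      forall x, (cube0 2 `\` cube0 1) x -> 0 < eta x].

(* Both limits exist in [0, +oo] when class_G p phi holds, since the function
   is then nonincreasing on (0, +oo). *)
Definition limit_condition p phi : Prop :=
  (lim ((t `^ (- (d%:R / p)) * phi t)%:E @[t --> 0^'+]) < +oo)%E /\
  (0 < lim ((t `^ (- (d%:R / p)) * phi t)%:E @[t --> +oo%R]))%E.

End spaces.

(* Main.v *)
(* With the weights [2^(js)] absorbed into the Littlewood-Paley blocks, the positive
   results compare [L_p(l_q)] with [l_r(L_p)] norms. On a single dyadic cube,
   Minkowski's inequality bounds the former by the case [r = min(p, q)], which gives
   (i). On the whole space it bounds the latter, for [r = max(p, q)], by the former;
   this gives (ii), because the limit condition says that [t^(-d/p) phi(t)] is bounded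
   above and below, i.e. that the Morrey norm is equivalent to the [L_p] norm. The
   case [q0 = +oo] is the trivial bound of one block by the [l_q] norm.

   The negative results test an embedding on sums of [n] wave packets of equal size
   with lacunary frequencies, so that every block sees at most one packet and the
   [N] norm is at least [n^(1/q0)]. If the packets sit at the same place, the [E] norm
   is of order [n^(1/q)]. If they are far apart, it is at most of order [n^(1/p)]; and
   if [t^(-d/p) phi(t)] is not bounded above and below, the width [r] and the distance
   [D] of the packets can be chosen so that large cubes do not count and the [E] norm
   is bounded independently of [n].

   The envelope of a packet is a product of powers of [(1 - cos x) / x^2], whose
   Fourier transform is seen to be compactly supported without Fourier inversion. *)

Require Import Defs.
From mathcomp Require Import all_boot all_order all_algebra.
From mathcomp Require Import complex.
From mathcomp Require Import all_classical all_reals all_analysis.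
From mathcomp Require Import measurable_realfun zify ring lra.
Set Implicit Arguments.
Unset Strict Implicit.
Unset Printing Implicit Defensive.
Import Order.TTheory GRing.Theory Num.Theory.
Import numFieldNormedType.Exports.
Local Open Scope classical_set_scope.
Local Open Scope ring_scope.

(** * Lebesgue measure on R^d *)

(** The definition of the blocks turns a distribution into a function by a choice ([fun_of_dist]),
    and this shapes both halves. The positive results need only that a block is measurable, which
    holds even for the default value of the choice. The negative results need to know every block of
    the test distributions; these are therefore given by integrable functions, so that each block is
    an explicit convolution, found with Fubini's theorem alone, and the choice is settled by
    uniqueness of the continuous representative.

    Packets are band-limited so that all but finitely many blocks vanish identically and no sum over
    far frequencies has to be estimated. The price is a merely polynomial decay in space; its order
    [M] is fixed after the exponents, so that the powers of the envelope stay integrable.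

    An embedding is a continuous inclusion, not an inequality. It is contradicted at the origin by
    packets of free amplitude [l], which replaces homogeneity of the norms. When the limit condition
    fails, width and distance of the packets depend on [n]; hence the constants must be uniform in
    width, position and amplitude, and only the lowest frequency may depend on the width. *)

Section affine_change_1d.
Context (R : realType).
Local Notation mu := (@lebesgue_measure R).
Local Open Scope ereal_scope.

Lemma measurable_affine (l a : R) :
  measurable_fun setT (fun x : R => (l * x + a)%R : measurableTypeR R).
Proof. by apply: measurable_funD => //; exact: measurable_funM. Qed.

(** The image of Lebesgue measure under [x |-> l * x + a], multiplied by [l], gives half-open
    intervals their length, and these values determine the measure. *)
Lemma ge0_integral_affine_1d (l a : R) (f : R -> \bar R) : (0 < l)%R ->
  measurable_fun setT f -> (forall x, 0 <= f x) ->
  \int[mu]_x f x = l%:E * \int[mu]_x f (l * x + a)%R.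
Proof.
move=> l0 mf f0.
pose g := (fun x : measurableTypeR R => (l * x + a)%R : measurableTypeR R).
have mg : measurable_fun setT g by exact: measurable_affine.
pose nu0 := measure_function_pushforward__canonical__measure_function_Measure mu mg.
pose nu : {measure set (measurableTypeR R) -> \bar R} :=
  mscale (NngNum (ltW l0)) nu0.
have Hnu A : measurable A -> mu A = nu A.
  apply: lebesgue_measure_unique => _ [[b c]] _ <- /=.
  rewrite /nu /mscale/= /nu0/= /pushforward.
  rewrite (_ : g @^-1` _ = `]((b - a) / l)%R, ((c - a) / l)%R]%classic); last first.
    apply/seteqP; split => x; rewrite /= !in_itv/= /g.
      by rewrite ltr_pdivrMr// ler_pdivlMr// (mulrC x) ltrBlDr lerBrDr.
    by rewrite ltr_pdivrMr// ler_pdivlMr// (mulrC x) ltrBlDr lerBrDr.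
  rewrite !lebesgue_measure_itv/= !lte_fin.
  rewrite ltr_pM2r ?invr_gt0// ltrD2r; case: ifPn => bc; last by rewrite mule0.
  by rewrite -EFinM; congr EFin; field; rewrite gt_eqF.
rewrite (eq_measure_integral nu); last by move=> A mA _; exact: Hnu.
rewrite ge0_integral_mscale//=; congr (_ * _).
by rewrite ge0_integral_pushforward.
Qed.

End affine_change_1d.

Section rV_integral.
Context (R : realType).
Local Notation mu := (@lebesgue_measure R).
Local Notation lam := (lebesgue_rV R).
Local Open Scope ereal_scope.

Lemma ge0_integral_cons_rV n (f : 'rV[R]_n.+1 -> \bar R) :
  measurable_fun setT f -> (forall x, 0 <= f x) ->
  \int[lam n.+1]_x f x = \int[mu]_x \int[lam n]_v f (cons_rV (x, v)).
Proof.
move=> mf f0.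
have -> : \int[lam n.+1]_x f x =
          \int[pushforward (mu \x lam n) (@cons_rV R n)]_x f x by [].
rewrite ge0_integral_pushforward//; last exact: measurable_cons_rV.
rewrite preimage_setT fubini_tonelli1//; last by move=> x; exact: f0.
by apply: measurableT_comp => //; exact: measurable_cons_rV.
Qed.

Lemma integrable_cons_rV n (f : 'rV[R]_n.+1 -> \bar R) :
  (lam n.+1).-integrable setT f ->
  (mu \x lam n).-integrable setT (f \o @cons_rV R n).
Proof.
move=> /integrableP[mf fi]; apply/integrableP; split.
  by apply: measurableT_comp => //; exact: measurable_cons_rV.
move: fi; have -> : \int[lam n.+1]_x `|f x| =
          \int[pushforward (mu \x lam n) (@cons_rV R n)]_x `|f x| by [].
rewrite ge0_integral_pushforward//; [exact: measurable_cons_rV|].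
exact: measurableT_comp.
Qed.

Lemma integral_cons_rV n (f : 'rV[R]_n.+1 -> \bar R) :
  (lam n.+1).-integrable setT f ->
  \int[lam n.+1]_x f x = \int[mu]_x \int[lam n]_v f (cons_rV (x, v)).
Proof.
move=> fi; have /integrableP[mf _] := fi.
have -> : \int[lam n.+1]_x f x =
          \int[pushforward (mu \x lam n) (@cons_rV R n)]_x f x by [].
rewrite integral_pushforward//; last 2 first.
- exact: measurable_cons_rV.
- exact: integrable_cons_rV.
by rewrite preimage_setT -integral12_prod_meas1//; exact: integrable_cons_rV.
Qed.

Lemma measurable_affine_rV n (l : R) (a : 'rV[R]_n) :
  measurable_fun setT (fun x : 'rV[R]_n => (l *: x + a)%R).
Proof.
apply: measurable_fun_rV => i; rewrite /comp /rV_coord.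
under eq_fun do rewrite !mxE.
apply: measurable_funD => //; apply: measurable_funM => //.
exact: measurable_rV_coord.
Qed.

Lemma cons_rV_affine n (l : R) (a : 'rV[R]_n.+1) x v :
  (l *: cons_rV (x, v) + a)%R =
  cons_rV ((l * x + a ord0 ord0)%R, (l *: v + \row_j a ord0 (lift ord0 j))%R).
Proof.
apply/rowP => i; rewrite !mxE/=; case: (unliftP ord0 i) => [j ->|->]/=.
  by rewrite ?liftK ?unlift_none !mxE.
by rewrite ?unlift_none.
Qed.

(** Induction on the dimension: the map acts on each coordinate separately, so Tonelli's theorem
    peels off the first one. *)
Lemma ge0_integral_affine n (l : R) (a : 'rV[R]_n) (f : 'rV[R]_n -> \bar R) :
  (0 < l)%R -> measurable_fun setT f -> (forall x, 0 <= f x) ->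
  \int[lam n]_x f x = (l ^+ n)%:E * \int[lam n]_x f (l *: x + a)%R.
Proof.
move=> l0; elim: n a f => [|n IH] a f mf f0.
  rewrite expr0 mul1e; apply: eq_integral => x _; congr f.
  by apply/rowP => -[].
have mfc : measurable_fun setT (f \o @cons_rV R n).
  by apply: measurableT_comp => //; exact: measurable_cons_rV.
rewrite !ge0_integral_cons_rV//; last first.
  by apply: measurableT_comp => //; exact: measurable_affine_rV.
pose a' := (\row_j a ord0 (lift ord0 j))%R.
transitivity (\int[mu]_x ((l ^+ n)%:E *
    \int[lam n]_v f (cons_rV (x, (l *: v + a')%R)))).
  apply: eq_integral => x _; rewrite (IH a')//.
  have mx : measurable_fun setT (fun v : 'rV[R]_n => (x : measurableTypeR R, v)).
    by apply: measurable_fun_pair.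
  exact: (measurableT_comp mfc mx).
have mfa : measurable_fun setT (fun z : measurableTypeR R * 'rV[R]_n =>
    f (cons_rV (z.1, (l *: z.2 + a')%R))).
  apply: measurableT_comp => //; apply: measurableT_comp.
    exact: measurable_cons_rV.
  apply: measurable_fun_pair => /=; first exact: measurable_fst.
  exact: (measurableT_comp (measurable_affine_rV l a') measurable_snd).
have mfF := @measurable_fun_fubini_tonelli_F _ _ _ _ _ (lam n) _ mfa
  (fun z => f0 _).
rewrite ge0_integralZl//; last 2 first.
- by move=> x _; exact: integral_ge0.
- by rewrite lee_fin exprn_ge0// ltW.
rewrite exprSr EFinM -muleA; congr (_ * _).
have F0 x : 0 <= fubini_F (lam n) (fun z : measurableTypeR R * 'rV[R]_n =>
    f (cons_rV (z.1, (l *: z.2 + a')%R))) x by exact: integral_ge0.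
rewrite [LHS](ge0_integral_affine_1d (a ord0 ord0) l0 mfF F0); congr (_ * _).
apply: eq_integral => x _; apply: eq_integral => v _.
by rewrite cons_rV_affine.
Qed.

Lemma integrable_affine n (l : R) (a : 'rV[R]_n) (f : 'rV[R]_n -> \bar R) :
  (0 < l)%R -> (lam n).-integrable setT f ->
  (lam n).-integrable setT (fun x => f (l *: x + a)%R).
Proof.
move=> l0 /integrableP[mf]; rewrite (@ge0_integral_affine n l a)//; last first.
  exact: measurableT_comp.
move=> fi; apply/integrableP; split.
  by apply: measurableT_comp => //; exact: measurable_affine_rV.
move: fi; case: (\int[_]__ _) => [r||]; rewrite ?ltry// .
by rewrite mulry gtr0_sg ?exprn_gt0// mul1e.
Qed.

Lemma integral_affine n (l : R) (a : 'rV[R]_n) (f : 'rV[R]_n -> \bar R) :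
  (0 < l)%R -> (lam n).-integrable setT f ->
  \int[lam n]_x f x = (l ^+ n)%:E * \int[lam n]_x f (l *: x + a)%R.
Proof.
move=> l0 fi; have /integrableP[mf _] := fi.
rewrite integralE [in RHS]integralE.
rewrite (@ge0_integral_affine n l a f^\+)//; last exact: measurable_funepos.
rewrite (@ge0_integral_affine n l a f^\-)//; last exact: measurable_funeneg.
have ia := integrable_affine a l0 fi.
rewrite -muleBr//; last first.
  apply: fin_num_adde_defr.
  rewrite (_ : (fun x => _) = (fun x => f (l *: x + a)%R)^\+).
    exact: (integrable_pos_fin_num _ ia).
  by apply/funext => x; rewrite !funeposE.
congr (_ * (_ - _)); apply: eq_integral => x _.
  by rewrite !funeposE.
by rewrite !funenegE.
Qed.

End rV_integral.

Section rV_norm.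
Context (R : realType).

Lemma le_rV_norm n (x : 'rV[R]_n) i : `|x ord0 i| <= `|x|.
Proof.
rewrite [leRHS](mx_normrE x).
exact: (le_bigmax _ (fun ij : 'I_1 * 'I_n => `|x ij.1 ij.2|) (ord0, i)).
Qed.

Lemma rV_norm_le n (x : 'rV[R]_n) (e : R) : 0 <= e ->
  (forall i, `|x ord0 i| <= e) -> `|x| <= e.
Proof.
move=> e0 H; rewrite [leLHS](mx_normrE x).
by apply: bigmax_le => // -[i j] _ /=; rewrite ord1.
Qed.

Lemma rV_norm_lt n (x : 'rV[R]_n) (e : R) : 0 < e ->
  (forall i, `|x ord0 i| < e) -> `|x| < e.
Proof.
move=> e0 H; rewrite [ltLHS](mx_normrE x).
by apply: bigmax_lt => // -[i j] _ /=; rewrite ord1.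
Qed.

Lemma exists_rV_norm n (x : 'rV[R]_n) : (0 < n)%N -> exists i, `|x| = `|x ord0 i|.
Proof.
move=> n0; have [x0|x0] := eqVneq (`|x|) 0.
  exists (Ordinal n0); apply/eqP; rewrite eq_le le_rV_norm andbT x0.
  exact: normr_ge0.
have [[i j] /= xE] := mx_norm_neq0 (x0 : mx_norm x != 0).
by exists j; rewrite -[LHS]/(mx_norm x) xE ord1.
Qed.

Lemma continuous_rV_norm n : continuous (fun x : 'rV[R]_n => `|x|).
Proof. exact: norm_continuous. Qed.

End rV_norm.

Section rV_borel.
Context (R : realType) (n : nat).

Let box (q : 'rV[rat]_n) (k : nat) : set 'rV[R]_n :=
  [set x | forall i, `|x ord0 i - ratr (q ord0 i)| < k.+1%:R^-1].

Let measurable_box q k : measurable (box q k).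
Proof.
have -> : box q k = \big[setI/setT]_(i < n)
    ((@rV_coord R n i) @^-1` [set y | `|y - ratr (q ord0 i)| < k.+1%:R^-1]).
  rewrite -bigcap_seq; apply/seteqP; split => x /=.
    by move=> Hx i _; exact: Hx.
  by move=> Hx i; apply: Hx; rewrite /= mem_index_enum.
apply: bigsetI_measurable => i _.
rewrite -[X in measurable X]setTI; apply: measurable_rV_coord => //.
rewrite (_ : [set y | _] = ball (ratr (q ord0 i) : R) k.+1%:R^-1).
  exact: measurable_ball.
by apply/seteqP; split => y; rewrite /ball/= distrC.
Qed.

(** The sigma-algebra is generated by the coordinates, so an open set has to be written as a
    countable union of boxes: those with rational centre that it contains, enumerated by [unpickle].
    Numbers that encode no such box contribute the empty set. *)
Lemma open_measurable_rV (A : set 'rV[R]_n) : open A -> measurable A.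
Proof.
move=> oA.
have -> : A = \bigcup_(m : nat) (if @unpickle ('rV[rat]_n * nat)%type m is Some qk
   then if `[< box qk.1 qk.2 `<=` A >] then box qk.1 qk.2 else set0 else set0).
  apply/seteqP; split => x /=; last first.
    move=> [m _]; case: unpickle => [[q k]|//] /=.
    by case: asboolP => //= bA; exact: bA.
  move=> Ax; have /nbhs_ballP[e /= e0 eA] := open_nbhs_nbhs (conj oA Ax).
  (* Half of [e], because a point of the box is compared with [x] through the rational centre. *)
  have [k ke] : exists k : nat, k.+1%:R^-1 < e / 2.
    exists (Num.trunc (e / 2)^-1); rewrite invf_plt ?posrE ?divr_gt0//.
    exact: truncnS_gt.
  have k0 : 0 < k.+1%:R^-1 :> R by rewrite invr_gt0.
  have H i : {q : rat | `|x ord0 i - ratr q| < k.+1%:R^-1}.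
    have /rat_in_itvoo/cid[q] : x ord0 i - k.+1%:R^-1 < x ord0 i + k.+1%:R^-1.
      by rewrite ltrD2l gtrN.
    rewrite in_itv/= => /andP[q1 q2]; exists q.
    by rewrite ltr_distlC q1 q2.
  pose q := \row_i sval (H i).
  exists (pickle (q, k)) => //; rewrite pickleK/= asboolT.
    by move=> i; rewrite mxE; exact: svalP (H i).
  move=> y yq; apply: eA; rewrite mx_norm_ball /ball_/=.
  apply: rV_norm_lt => // i; rewrite !mxE.
  have := yq i; have := svalP (H i); rewrite mxE => h1 h2.
  rewrite (_ : _ - _ = (x ord0 i - ratr (sval (H i))) - (y ord0 i - ratr (sval (H i)))); last by ring.
  apply: (le_lt_trans (ler_normB _ _)).
  apply: (lt_trans (ltrD h1 h2)); rewrite (splitr e); exact: ltrD.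
apply: bigcupT_measurable => m; case: unpickle => [[q k]|]; last by [].
by case: asboolP.
Qed.

Lemma continuous_measurable_rV (f : 'rV[R]_n -> R) :
  continuous f -> measurable_fun setT f.
Proof.
move=> /continuousP cf; apply: (measurability _ (RGenOpens.measurableE R)).
move=> _ [_ [a [b ->] <-]]; rewrite setTI; apply: open_measurable_rV.
exact/cf/interval_open.
Qed.

Lemma measurable_dotr : measurable_fun setT
  (fun z : 'rV[R]_n * 'rV[R]_n => dotr z.1 z.2).
Proof.
apply: measurable_sum => i; apply: measurable_funM.
  exact: (measurableT_comp (measurable_rV_coord i) measurable_fst).
exact: (measurableT_comp (measurable_rV_coord i) measurable_snd).
Qed.

Lemma measurable_dotrl (x : 'rV[R]_n) : measurable_fun setT (dotr x).
Proof.
apply: measurable_sum => i; apply: measurable_funM => //.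
exact: measurable_rV_coord.
Qed.

Lemma measurable_subrV : measurable_fun setT
  (fun z : 'rV[R]_n * 'rV[R]_n => (z.1 - z.2 : 'rV[R]_n)).
Proof.
apply: measurable_fun_rV => i; rewrite /comp /rV_coord.
under eq_fun do rewrite !mxE.
apply: measurable_funB.
  exact: (measurableT_comp (measurable_rV_coord i) measurable_fst).
exact: (measurableT_comp (measurable_rV_coord i) measurable_snd).
Qed.

Lemma le_dotr (x y : 'rV[R]_n) : `|dotr x y| <= n%:R * (`|x| * `|y|).
Proof.
rewrite /dotr; apply: (le_trans (ler_norm_sum _ _ _)).
apply: (@le_trans _ _ (\sum_(i < n) (`|x| * `|y|))).
  by apply: ler_sum => i _; rewrite normrM ler_pM// le_rV_norm.
by rewrite sumr_const card_ord mulr_natl.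
Qed.

Lemma dotrDl (x y z : 'rV[R]_n) : dotr (x + y) z = dotr x z + dotr y z.
Proof. by rewrite /dotr -big_split/=; apply: eq_bigr => i _; rewrite mxE mulrDl. Qed.

Lemma dotrDr (x y z : 'rV[R]_n) : dotr x (y + z) = dotr x y + dotr x z.
Proof. by rewrite /dotr -big_split/=; apply: eq_bigr => i _; rewrite mxE mulrDr. Qed.

Lemma dotrZl a (x y : 'rV[R]_n) : dotr (a *: x) y = a * dotr x y.
Proof. by rewrite /dotr mulr_sumr; apply: eq_bigr => i _; rewrite mxE mulrA. Qed.

Lemma dotrZr a (x y : 'rV[R]_n) : dotr x (a *: y) = a * dotr x y.
Proof. by rewrite /dotr mulr_sumr; apply: eq_bigr => i _; rewrite mxE mulrCA. Qed.

Lemma dotrNl (x y : 'rV[R]_n) : dotr (- x) y = - dotr x y.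
Proof. by rewrite -scaleN1r dotrZl mulN1r. Qed.

Lemma dotrNr (x y : 'rV[R]_n) : dotr x (- y) = - dotr x y.
Proof. by rewrite -scaleN1r dotrZr mulN1r. Qed.

Lemma dotrBl (x y z : 'rV[R]_n) : dotr (x - y) z = dotr x z - dotr y z.
Proof. by rewrite dotrDl dotrNl. Qed.

Lemma dotrBr (x y z : 'rV[R]_n) : dotr x (y - z) = dotr x y - dotr x z.
Proof. by rewrite dotrDr dotrNr. Qed.

End rV_borel.

Section rV_products.
Context (R : realType).
Local Notation mu := (@lebesgue_measure R).
Local Notation lam := (lebesgue_rV R).

Lemma dotr_cons_rV n x (v : 'rV[R]_n) (xi : 'rV[R]_n.+1) :
  dotr (cons_rV (x, v)) xi =
  x * xi ord0 ord0 + dotr v (\row_j xi ord0 (lift ord0 j)).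
Proof.
rewrite /dotr big_ord_recl /cons_rV !mxE unlift_none/=; congr (_ + _).
by apply: eq_bigr => i _; rewrite !mxE liftK.
Qed.

Lemma prod_cons_rV n x (v : 'rV[R]_n) (g : R -> R) :
  \prod_(i < n.+1) g (cons_rV (x, v) ord0 i) = g x * \prod_(i < n) g (v ord0 i).
Proof.
rewrite big_ord_recl /cons_rV !mxE unlift_none/=; congr (_ * _).
by apply: eq_bigr => i _; rewrite !mxE liftK.
Qed.

Lemma measurable_prod_rV n (g : R -> R) : measurable_fun setT g ->
  measurable_fun setT (fun x : 'rV[R]_n => \prod_(i < n) g (x ord0 i)).
Proof.
move=> mg; apply: measurable_prod => i _.
exact: (measurableT_comp mg (measurable_rV_coord i)).
Qed.

Lemma ge0_integral_prod_rV n (g : R -> R) (I : R) : measurable_fun setT g ->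
  (forall x, 0 <= g x) -> (\int[mu]_x (g x)%:E = I%:E)%E ->
  (\int[lam n]_x (\prod_(i < n) g (x ord0 i))%:E = (I ^+ n)%:E)%E.
Proof.
move=> mg g0 gI; elim: n => [|n IH].
  rewrite [LHS]integral_dirac//.
    by rewrite big_ord0 expr0 mule1; exact: diracT.
  by apply/measurable_EFinP; exact: measurable_prod_rV.
rewrite ge0_integral_cons_rV; last 2 first.
- by apply/measurable_EFinP; exact: measurable_prod_rV.
- by move=> x; rewrite lee_fin prodr_ge0.
transitivity (\int[mu]_x ((I ^+ n)%:E * (g x)%:E))%E.
  apply: eq_integral => x _; under eq_integral do rewrite prod_cons_rV EFinM.
  rewrite ge0_integralZl//.
  - by rewrite IH muleC.
  - by apply/measurable_EFinP; exact: measurable_prod_rV.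
  - by move=> v _; rewrite lee_fin prodr_ge0.
  - by rewrite lee_fin.
rewrite ge0_integralZl//.
- by rewrite gI -EFinM -exprSr.
- exact/measurable_EFinP.
- by move=> x _; rewrite lee_fin.
- by rewrite lee_fin exprn_ge0// -lee_fin -gI integral_ge0// => x _; rewrite lee_fin.
Qed.

End rV_products.

(** * Polynomially decaying weights *)

Section weights.
Context (R : realType).
Local Notation mu := (@lebesgue_measure R).
Local Notation lam := (lebesgue_rV R).

Lemma continuous_weight1 M : continuous (fun t : R => (1 + `|t|) ^- M).
Proof.
move=> x; apply: cvgV; first by rewrite expf_neq0// gt_eqF// ltr_pwDl.
apply: (@cvg_comp _ _ _ (fun x : R => 1 + `|x|) (fun y => y ^+ M)).
  by apply: cvgD; [exact: cvg_cst|exact: norm_continuous].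
exact: exprn_continuous.
Qed.

Lemma integral_weight1 : (\int[mu]_x (((1 + `|x|) ^- 2)%:E) = 2%:E)%E.
Proof.
have p (x : R) : 0 < 1 + `|x| by rewrite ltr_pwDl.
rewrite ge0_symfun_integralT; last 3 first.
- by move=> x; rewrite invr_ge0 exprn_ge0// ltW.
- exact: continuous_weight1.
- by move=> x /=; rewrite normrN.
rewrite (_ : [set x | _] = `[0, +oo[%classic); last first.
  by apply/seteqP; split => x /=; rewrite in_itv/= andbT.
suff -> : (\int[mu]_(x in `[0%R, +oo[) (((1 + `|x|) ^- 2)%:E) = 1%:E)%E.
  by rewrite mule1.
(* The range [x > -1] contains a neighbourhood of the endpoint 0, where continuity of the primitive
   is also needed. *)
have Hd (x : R) : -1 < x -> is_derive x 1 (fun x => - (1 + x)^-1) ((1 + x) ^- 2).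
  move=> x1; have x10 : 1 + x != 0 by rewrite gt_eqF//; lra.
  have H : is_derive x 1 (fun y : R => 1 + y) 1.
    have := is_deriveD (is_derive_cst (1:R) x 1) (is_derive_id x 1).
    by rewrite add0r.
  have /= H1 := is_deriveV x10 H.
  by apply: (is_derive_eq (is_deriveN H1)); rewrite scaleNr opprK; exact: mulr1.
have H := @ge0_continuous_FTC2y R (fun x => (1 + `|x|) ^- 2) (fun x => - (1 + x)^-1) 0 0.
rewrite H.
- by rewrite addr0 invr1 -EFinB opprK add0r.
- by move=> x _; rewrite invr_ge0 exprn_ge0// ltW.
- by apply: continuous_subspaceT; exact: continuous_weight1.
- rewrite -oppr0; apply: cvgN.
  apply/gtr0_cvgV0; last first.
    apply: cvg_trans (cvg_addrl _).
    by apply: cvg_id.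
  by near=> x; have : 0 < x by []; move=> ?; lra.
- move=> x x0; have x1 : -1 < x by lra.
  by case: (Hd x x1).
- apply: cvg_at_right_filter.
  have x1 : -1 < 0 :> R by lra.
  have c : {for (0 : R), continuous (fun x : R => - (1 + x)^-1)}.
    apply: differentiable_continuous; apply/derivable1_diffP.
    by case: (Hd 0 x1).
  exact: c.
- move=> x; rewrite in_itv/= andbT => x0; have x1 : -1 < x by lra.
  rewrite derive1E (@derive_val _ _ _ _ _ _ _ (Hd x x1)).
  by rewrite ger0_norm// ltW.
Unshelve. all: by end_near. Qed.

Definition weight n (M : nat) (x : 'rV[R]_n) : R := (1 + `|x|) ^- M.

Lemma weight_gt0 n M (x : 'rV[R]_n) : 0 < weight M x.
Proof. by rewrite invr_gt0 exprn_gt0// ltr_pwDl. Qed.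

Lemma weight_ge0 n M (x : 'rV[R]_n) : 0 <= weight M x.
Proof. exact/ltW/weight_gt0. Qed.

Lemma weight_le1 n M (x : 'rV[R]_n) : weight M x <= 1.
Proof. by rewrite invf_le1 ?exprn_gt0 ?ltr_pwDl// exprn_ege1// lerDl. Qed.

Lemma continuous_weight n M : continuous (@weight n M).
Proof.
have -> : @weight n M = (fun t : R => (1 + `|t|) ^- M) \o (fun x : 'rV[R]_n => `|x|).
  by apply/funext => x; rewrite /weight /= normr_id.
move=> x; apply: continuous_comp; first exact: norm_continuous.
exact: continuous_weight1.
Qed.

Lemma measurable_weight n M : measurable_fun setT (@weight n M).
Proof. by apply: continuous_measurable_rV; exact: continuous_weight. Qed.

Lemma le_weight n M N (x : 'rV[R]_n) : (M <= N)%N -> weight N x <= weight M x.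
Proof.
move=> MN; rewrite lef_pV2 ?posrE ?exprn_gt0 ?ltr_pwDl//.
by rewrite ler_weXn2l// lerDl.
Qed.

Lemma weightD n M N (x : 'rV[R]_n) : weight (M + N) x = weight M x * weight N x.
Proof. by rewrite /weight exprD invfM. Qed.

(** Each [1 + |x_i|] is at most [1 + |x|], so the weight of order [2 * n] is dominated by the
    product of [n] one-dimensional weights of order 2, each of integral 2. Hence [2 * n] is the
    order of decay that is set aside for integrability below. *)
Lemma integral_weight_le n :
  (\int[lam n]_x (weight (2 * n) x)%:E <= (2 ^+ n)%:E)%E.
Proof.
have m2 : measurable_fun setT (fun x : R => (1 + `|x|) ^- 2).
  by apply: continuous_measurable_fun; exact: continuous_weight1.
rewrite -(ge0_integral_prod_rV n m2 _ integral_weight1); last first.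
  by move=> x; rewrite invr_ge0 exprn_ge0// addr_ge0.
apply: ge0_le_integral => //=.
- by move=> x _; rewrite lee_fin weight_ge0.
- by apply/measurable_EFinP; exact: measurable_weight.
- apply/measurable_EFinP.
  exact: (@measurable_prod_rV _ n (fun y => (1 + `|y|) ^- 2) m2).
- move=> x _; rewrite lee_fin /weight prodfV prodrXl mulnC exprM.
  rewrite -exprVn -[leRHS]exprVn lerXn2r ?nnegrE ?invr_ge0 ?exprn_ge0 ?addr_ge0//.
    by rewrite prodr_ge0// => i _; rewrite addr_ge0.
  rewrite lef_pV2 ?posrE ?exprn_gt0 ?ltr_pwDl//; last first.
    by rewrite prodr_gt0// => i _; rewrite ltr_pwDl.
  rewrite -[X in _ <= _ ^+ X]card_ord -prodr_const ler_prod// => i _.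
  by rewrite addr_ge0//= lerD2l le_rV_norm.
Qed.

Lemma ge0_integral_weight_scaled n (r : R) (a : 'rV[R]_n) : 0 < r ->
  (\int[lam n]_x (weight (2 * n) (r^-1 *: (x - a)))%:E <= (r ^+ n * 2 ^+ n)%:E)%E.
Proof.
move=> r0; rewrite (@ge0_integral_affine _ _ r a)//; last 2 first.
- apply/measurable_EFinP; apply: (measurableT_comp (@measurable_weight n (2 * n))).
  under eq_fun do rewrite scalerBr -scalerN.
  exact: measurable_affine_rV.
- by move=> x; rewrite lee_fin weight_ge0.
rewrite EFinM lee_wpmul2l ?lee_fin ?exprn_ge0 ?(ltW r0)//.
apply: le_trans (integral_weight_le n).
rewrite le_eqVlt; apply/orP; left; apply/eqP; apply: eq_integral => x _.
by rewrite addrK scalerA mulVf ?scale1r// gt_eqF.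
Qed.

Lemma integrable_weight n M : (2 * n <= M)%N ->
  (lam n).-integrable setT (fun x => (weight M x)%:E).
Proof.
move=> nM; apply/integrableP; split; first by apply/measurable_EFinP; exact: measurable_weight.
apply: le_lt_trans (ltry (2 ^+ n)); apply: le_trans (integral_weight_le n).
apply: ge0_le_integral => //=.
- by do 2 apply: measurableT_comp => //; exact: measurable_weight.
- by apply/measurable_EFinP; exact: measurable_weight.
- by move=> x _; rewrite lee_fin ger0_norm ?weight_ge0// le_weight.
Qed.

End weights.

(** * Complex-valued integrals *)

Local Open Scope complex_scope.

Section cmod_theory.
Context (R : realType).
Implicit Types z w : R[i].

Lemma cmodE z : cmod z = Num.sqrt (complex.Re z ^+ 2 + complex.Im z ^+ 2).
Proof. by rewrite /cmod normc_def. Qed.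

Lemma cmod_ge0 z : 0 <= cmod z.
Proof. by rewrite cmodE sqrtr_ge0. Qed.

Lemma cmod_norm z : (cmod z)%:C = `|z|.
Proof. by rewrite cmodE normc_def. Qed.

Lemma cmodM z w : cmod (z * w) = cmod z * cmod w.
Proof. by apply: (@complexI R); rewrite rmorphM/= !cmod_norm normrM. Qed.

Lemma ler_cmodD z w : cmod (z + w) <= cmod z + cmod w.
Proof. by rewrite -lecR rmorphD/= !cmod_norm ler_normD. Qed.

Lemma cmod0 : cmod (0 : R[i]) = 0.
Proof. by rewrite cmodE/= expr0n/= addr0 sqrtr0. Qed.

Lemma le_Re_cmod z : `|complex.Re z| <= cmod z.
Proof. by rewrite cmodE -sqrtr_sqr ler_wsqrtr// lerDl sqr_ge0. Qed.

Lemma le_Im_cmod z : `|complex.Im z| <= cmod z.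
Proof. by rewrite cmodE -sqrtr_sqr ler_wsqrtr// lerDr sqr_ge0. Qed.

Lemma cmod_le z : cmod z <= `|complex.Re z| + `|complex.Im z|.
Proof.
rewrite cmodE -[leRHS]ger0_norm ?addr_ge0// -sqrtr_sqr ler_wsqrtr//.
rewrite sqrrD !real_normK ?num_real//; have : 0 <= `|complex.Re z| * `|complex.Im z| by rewrite mulr_ge0.
by move=> h; rewrite mulr2n; lra.
Qed.

Lemma cmod_real (a : R) : cmod a%:C = `|a|.
Proof. by rewrite cmodE/= expr0n/= addr0 sqrtr_sqr. Qed.

Lemma ler_cmod_sum I (r : seq I) (P : pred I) (F : I -> R[i]) :
  cmod (\sum_(i <- r | P i) F i) <= \sum_(i <- r | P i) cmod (F i).
Proof.
elim/big_ind2 : _ => //; first by rewrite cmod0.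
by move=> x1 x2 y1 y2 h1 h2; apply: le_trans (ler_cmodD _ _) (lerD h1 h2).
Qed.

Lemma expiD (s t : R) : expi (s + t) = expi s * expi t.
Proof.
apply/eqP; rewrite eq_complex/= cosD sinD; apply/andP; split; apply/eqP => //.
by rewrite addrC.
Qed.

Lemma cmod_expi (t : R) : cmod (expi t) = 1.
Proof. by rewrite cmodE/= cos2Dsin2 sqrtr1. Qed.

End cmod_theory.

Section Rfubini.
Context d1 d2 (T1 : measurableType d1) (T2 : measurableType d2) (R : realType).
Variables (m1 : {sigma_finite_measure set T1 -> \bar R}).
Variables (m2 : {sigma_finite_measure set T2 -> \bar R}).
Variable f : T1 * T2 -> R.
Hypothesis fi : (m1 \x m2)%E.-integrable setT (EFin \o f).
Hypothesis f1 : forall x, m2.-integrable setT (EFin \o (fun y => f (x, y))).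
Hypothesis f2 : forall y, m1.-integrable setT (EFin \o (fun x => f (x, y))).

(** Integrability of every section, and not just of almost every one, makes the real-valued inner
    integral agree with the extended one at all points. *)
Lemma EFin_Rintegral1 : (EFin \o (fun x => \int[m2]_y f (x, y))) = fubini_F m2 (EFin \o f).
Proof.
apply/funext => x /=; rewrite /Rintegral fineK//.
exact: integrable_fin_num (f1 x).
Qed.

Lemma EFin_Rintegral2 : (EFin \o (fun y => \int[m1]_x f (x, y))) = fubini_G m1 (EFin \o f).
Proof.
apply/funext => x /=; rewrite /Rintegral fineK//.
exact: integrable_fin_num (f2 x).
Qed.

Lemma integrable_Rintegral1 : m1.-integrable setT (EFin \o (fun x => \int[m2]_y f (x, y))).
Proof. by rewrite EFin_Rintegral1; exact: integrable_fubini_F. Qed.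

Lemma Rfubini :
  \int[m1]_x \int[m2]_y f (x, y) = \int[m2]_y \int[m1]_x f (x, y).
Proof.
rewrite /Rintegral; congr fine.
transitivity (\int[m1]_x fubini_F m2 (EFin \o f) x)%E.
  by apply: eq_integral => x _; rewrite -EFin_Rintegral1.
transitivity (\int[m2]_x fubini_G m1 (EFin \o f) x)%E; last first.
  by apply: eq_integral => x _; rewrite -EFin_Rintegral2.
by rewrite integral12_prod_meas1 ?integral21_prod_meas1.
Qed.

End Rfubini.

Section cmeasurable_theory.
Context (R : realType) (d0 : measure_display) (T : measurableType d0).
Implicit Types f g : T -> R[i].

Definition cmeasurable f := measurable_fun setT (fun x => complex.Re (f x)) /\
  measurable_fun setT (fun x => complex.Im (f x)).

Lemma cmeasurableM f g : cmeasurable f -> cmeasurable g ->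
  cmeasurable (fun x => f x * g x).
Proof.
move=> [f1 f2] [g1 g2]; split.
  rewrite (_ : (fun x => _) = (fun x => complex.Re (f x) * complex.Re (g x) -
      complex.Im (f x) * complex.Im (g x))).
    by apply: measurable_funB; exact: measurable_funM.
  by apply/funext => x; case: (f x) => a b; case: (g x).
rewrite (_ : (fun x => _) = (fun x => complex.Re (f x) * complex.Im (g x) +
    complex.Im (f x) * complex.Re (g x))).
  by apply: measurable_funD; exact: measurable_funM.
by apply/funext => x; case: (f x) => a b; case: (g x).
Qed.

Lemma measurable_cmod f : cmeasurable f -> measurable_fun setT (fun x => cmod (f x)).
Proof.
move=> [f1 f2]; under eq_fun do rewrite cmodE.
apply: (@measurableT_comp _ _ _ _ _ _ (@Num.sqrt R)).
  by apply: continuous_measurable_fun; exact: sqrt_continuous.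
by apply: measurable_funD; exact: measurable_funX.
Qed.

Lemma cmeasurable_real (h : T -> R) : measurable_fun setT h -> cmeasurable (fun x => (h x)%:C).
Proof. by move=> mh; split. Qed.

Lemma cmeasurable_expi (h : T -> R) : measurable_fun setT h -> cmeasurable (fun x => expi (h x)).
Proof.
move=> mh; split => /=.
  apply: measurableT_comp => //.
  by apply: continuous_measurable_fun; exact: continuous_cos.
apply: measurableT_comp => //.
by apply: continuous_measurable_fun; exact: continuous_sin.
Qed.

Lemma integrableZlR (mu : {measure set T -> \bar R}) (c : R) (h : T -> R) :
  mu.-integrable setT (EFin \o h) -> mu.-integrable setT (EFin \o (fun x => c * h x)).
Proof. by move=> hi; exact: (integrableZl measurableT c hi). Qed.

End cmeasurable_theory.

Lemma cmeasurable_comp (R : realType) d1 d2 (T1 : measurableType d1)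
    (T2 : measurableType d2) (g : T1 -> T2) (f : T2 -> R[i]) :
  cmeasurable f -> measurable_fun setT g -> cmeasurable (f \o g).
Proof.
move=> [f1 f2] mg; split; first exact: (measurableT_comp f1 mg).
exact: (measurableT_comp f2 mg).
Qed.

Lemma integrable_prod_le (R : realType) d1 d2 (T1 : measurableType d1)
    (T2 : measurableType d2) (m1 : {sigma_finite_measure set T1 -> \bar R})
    (m2 : {sigma_finite_measure set T2 -> \bar R}) (f : T1 * T2 -> R)
    (a : T1 -> R) (b : T2 -> R) :
  measurable_fun setT f ->
  m1.-integrable setT (EFin \o a) -> m2.-integrable setT (EFin \o b) ->
  (forall x y, `|f (x, y)| <= a x * b y) ->
  (m1 \x m2)%E.-integrable setT (EFin \o f).
Proof.
move=> mf ai bi fab; apply/integrable12ltyP; first exact/measurable_EFinP.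
have bfin := integral_fune_fin_num measurableT bi.
have /measurable_int ma := ai; have /measurable_int mb := bi.
apply: (@le_lt_trans _ _ (\int[m1]_x (`|\int[m2]_y (b y)%:E| * `|(a x)%:E|))%E); last first.
  rewrite ge0_integralZl//; last exact: measurableT_comp.
  rewrite lte_mul_pinfty//; first by rewrite abse_fin_num.
  by case/integrableP : ai.
apply: ge0_le_integral => //.
- by move=> x _; exact: integral_ge0.
- apply: (@measurable_fun_fubini_tonelli_F _ _ _ _ _ m2 (fun z => `|(f z)%:E|)%E) => //.
  by apply: measurableT_comp => //; exact/measurable_EFinP.
- by apply: measurable_funeM; exact: measurableT_comp.
- move=> x _.
  apply: (@le_trans _ _ (\int[m2]_y ((a x)%:E * (b y)%:E))%E).
    apply: ge0_le_integral => //.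
    + apply: measurableT_comp => //; apply/measurable_EFinP.
      by apply: (measurableT_comp mf); exact: measurable_pair1.
    + by apply: measurable_funeM.
    + by move=> y _; rewrite lee_fin fab.
  rewrite integralZl// -abseM muleC; exact: lee_abs.
Qed.

Section cintegral_theory.
Context (R : realType) (d : nat).
Local Notation lam := (lebesgue_rV R d).
Local Notation V := 'rV[R]_d.
Implicit Types f g : V -> R[i].

Lemma cintegrable_cmeasurable f : cintegrable f -> cmeasurable f.
Proof.
by move=> [/integrableP[/measurable_EFinP ? _] /integrableP[/measurable_EFinP ? _]].
Qed.

Lemma cintegrable_le f (g : V -> R) : cmeasurable f ->
  lam.-integrable setT (EFin \o g) -> (forall x, cmod (f x) <= g x) ->
  cintegrable f.
Proof.
move=> [f1 f2] gi fg; split.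
  apply: le_integrable gi => //; first exact/measurable_EFinP.
  move=> x _ /=; rewrite lee_fin.
  exact: le_trans (le_Re_cmod _) (le_trans (fg x) (ler_norm _)).
apply: le_integrable gi => //; first exact/measurable_EFinP.
move=> x _ /=; rewrite lee_fin.
exact: le_trans (le_Im_cmod _) (le_trans (fg x) (ler_norm _)).
Qed.

Lemma cintegrable_cmod f : cintegrable f ->
  lam.-integrable setT (EFin \o (fun x => cmod (f x))).
Proof.
move=> fi; have mf := cintegrable_cmeasurable fi; case: fi => f1 f2.
have := integrableD measurableT (integrable_abse f1) (integrable_abse f2).
apply: le_integrable => //; first by apply/measurable_EFinP; exact: measurable_cmod.
move=> x _ /=; rewrite lee_fin (ger0_norm (cmod_ge0 _)).
exact: le_trans (cmod_le _) (ler_norm _).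
Qed.

Lemma cintegrableM f (k : V -> R[i]) (K : R) : cintegrable f ->
  cmeasurable k -> (forall x, cmod (k x) <= K) -> cintegrable (fun x => f x * k x).
Proof.
move=> fi mk kK; have mf := cintegrable_cmeasurable fi.
apply: (@cintegrable_le _ (fun x => K * cmod (f x))).
- exact: cmeasurableM.
- exact: (integrableZl measurableT K (cintegrable_cmod fi)).
- by move=> x; rewrite cmodM mulrC ler_wpM2r// cmod_ge0.
Qed.

Lemma cintegralZl (c : R[i]) f : cintegrable f ->
  cintegral (fun x => c * f x) = c * cintegral f.
Proof.
move=> [f1 f2]; rewrite /cintegral; case: c => c1 c2.
pose c := Complex c1 c2.
have E1 : \int[lam]_x Re_fun (fun x => c * f x) x =
    c1 * \int[lam]_x Re_fun f x - c2 * \int[lam]_x Im_fun f x.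
  rewrite -!RintegralZl// -RintegralB//.
  - by apply: eq_Rintegral => x _; rewrite /Re_fun /Im_fun/= /c; case: (f x).
  - exact: integrableZlR.
  - exact: integrableZlR.
have E2 : \int[lam]_x Im_fun (fun x => c * f x) x =
    c1 * \int[lam]_x Im_fun f x + c2 * \int[lam]_x Re_fun f x.
  rewrite -!RintegralZl// -RintegralD//.
  - by apply: eq_Rintegral => x _; rewrite /Re_fun /Im_fun/= /c; case: (f x).
  - exact: integrableZlR.
  - exact: integrableZlR.
by rewrite E1 E2.
Qed.

Lemma cintegrableD f g : cintegrable f -> cintegrable g ->
  cintegrable (fun x => f x + g x).
Proof.
move=> [f1 f2] [g1 g2]; split.
  rewrite (_ : _ \o _ = (EFin \o Re_fun f) \+ (EFin \o Re_fun g))%E; first exact: integrableD.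
  by apply/funext => x; rewrite /Re_fun/=; case: (f x); case: (g x).
rewrite (_ : _ \o _ = (EFin \o Im_fun f) \+ (EFin \o Im_fun g))%E; first exact: integrableD.
by apply/funext => x; rewrite /Im_fun/=; case: (f x); case: (g x).
Qed.

Lemma cintegralD f g : cintegrable f -> cintegrable g ->
  cintegral (fun x => f x + g x) = cintegral f + cintegral g.
Proof.
move=> [f1 f2] [g1 g2]; rewrite /cintegral.
have -> : \int[lam]_x Re_fun (fun x => f x + g x) x = \int[lam]_x Re_fun f x + \int[lam]_x Re_fun g x.
  by rewrite -RintegralD//; apply: eq_Rintegral => x _; rewrite /Re_fun; case: (f x); case: (g x).
have -> : \int[lam]_x Im_fun (fun x => f x + g x) x = \int[lam]_x Im_fun f x + \int[lam]_x Im_fun g x.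
  by rewrite -RintegralD//; apply: eq_Rintegral => x _; rewrite /Im_fun; case: (f x); case: (g x).
by [].
Qed.

Lemma cintegral0 : cintegral (fun _ : V => 0) = 0.
Proof.
by rewrite /cintegral /Re_fun /Im_fun/= /Rintegral integral0.
Qed.

Lemma cintegrable0 : cintegrable (fun _ : V => 0).
Proof. by split; apply: (eq_integrable measurableT (cst 0%E)) => //; exact: integrable0. Qed.

Lemma cintegrable_sum n (F : 'I_n -> V -> R[i]) : (forall i, cintegrable (F i)) ->
  cintegrable (fun x => \sum_(i < n) F i x).
Proof.
elim: n F => [|n IH] F Fi.
  by under eq_fun do rewrite big_ord0; exact: cintegrable0.
under eq_fun do rewrite big_ord_recl.
by apply: cintegrableD => //; exact: IH.
Qed.

Lemma cintegral_sum n (F : 'I_n -> V -> R[i]) : (forall i, cintegrable (F i)) ->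
  cintegral (fun x => \sum_(i < n) F i x) = \sum_(i < n) cintegral (F i).
Proof.
elim: n F => [|n IH] F Fi.
  by rewrite big_ord0; under eq_fun do rewrite big_ord0; exact: cintegral0.
under eq_fun do rewrite big_ord_recl.
rewrite cintegralD//; last by apply: cintegrable_sum.
by rewrite IH// big_ord_recl.
Qed.

(* The factor 2 comes from bounding the real and imaginary parts separately. *)
Lemma cmod_cintegral_le f (g : V -> R) : cmeasurable f ->
  lam.-integrable setT (EFin \o g) -> (forall x, cmod (f x) <= g x) ->
  cmod (cintegral f) <= 2 * \int[lam]_x g x.
Proof.
move=> mf gi fg; have [f1 f2] := cintegrable_le mf gi fg.
have H (h : V -> R) : lam.-integrable setT (EFin \o h) ->
    (forall x, `|h x| <= cmod (f x)) -> `|\int[lam]_x h x| <= \int[lam]_x g x.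
  move=> hi hf; apply: (le_trans (le_normr_Rintegral measurableT hi)).
  apply: le_Rintegral => //.
    exact: integrable_norm.
  by move=> x _; exact: le_trans (hf x) (fg x).
apply: (le_trans (cmod_le _)); rewrite mulr_natl mulr2n lerD//=.
  by apply: H => // x; exact: le_Re_cmod.
by apply: H => // x; exact: le_Im_cmod.
Qed.

Lemma cintegral_affine (l : R) (a : V) f : 0 < l -> cintegrable f ->
  cintegral f = (l ^+ d)%:C * cintegral (fun x => f (l *: x + a)).
Proof.
move=> l0 [f1 f2].
have H (h : V -> R) : lam.-integrable setT (EFin \o h) ->
    \int[lam]_x h x = l ^+ d * \int[lam]_x h (l *: x + a).
  move=> hi; rewrite /Rintegral (integral_affine a l0 hi) fineM//.
  apply: integrable_fin_num => //.
  exact: (@integrable_affine R d l a (EFin \o h) l0 hi).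
rewrite /cintegral (H _ f1) (H _ f2); apply/eqP; rewrite eq_complex/=.
by rewrite !mul0r subr0 addr0 !eqxx.
Qed.

Lemma cintegrable_affine (l : R) (a : V) f : 0 < l -> cintegrable f ->
  cintegrable (fun x => f (l *: x + a)).
Proof.
move=> l0 [f1 f2]; split.
  exact: (@integrable_affine R d l a (EFin \o Re_fun f) l0 f1).
exact: (@integrable_affine R d l a (EFin \o Im_fun f) l0 f2).
Qed.

(** Every interchange of integrals over [V] below has this shape: two integrable factors, one in
    each variable, and a bounded kernel that is an exponential or a convolution kernel. The product
    [K * cmod (A x) * cmod (B y)] is the integrable majorant. *)
Lemma cfubini (A B : V -> R[i]) (k : V * V -> R[i]) (K : R) :
  cintegrable A -> cintegrable B -> cmeasurable k -> (forall z, cmod (k z) <= K) ->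
  cintegral (fun x => A x * cintegral (fun y => B y * k (x, y))) =
  cintegral (fun y => B y * cintegral (fun x => A x * k (x, y))).
Proof.
move=> Ai Bi mk kK.
have mA := cintegrable_cmeasurable Ai; have mB := cintegrable_cmeasurable Bi.
pose F (z : V * V) := A z.1 * (B z.2 * k z).
have mF : cmeasurable F.
  apply: cmeasurableM; first exact: (cmeasurable_comp mA measurable_fst).
  by apply: cmeasurableM => //; exact: (cmeasurable_comp mB measurable_snd).
have mk1 x : cmeasurable (fun y => k (x, y)).
  exact: (cmeasurable_comp mk (measurable_pair1 x)).
have mk2 y : cmeasurable (fun x => k (x, y)).
  exact: (cmeasurable_comp mk (measurable_pair2 y)).
have K0 : 0 <= K by apply: le_trans (kK (0, 0)); exact: cmod_ge0.
have i1 x : cintegrable (fun y => B y * k (x, y)) by exact: (cintegrableM Bi (mk1 x)).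
have i2 y : cintegrable (fun x => A x * k (x, y)) by exact: (cintegrableM Ai (mk2 y)).
have leF x y : cmod (F (x, y)) <= (K * cmod (A x)) * cmod (B y).
  rewrite /F/= !cmodM (_ : K * _ * _ = cmod (A x) * (cmod (B y) * K)); last by ring.
  by rewrite ler_wpM2l ?cmod_ge0// ler_wpM2l ?cmod_ge0.
have iF1 x : cintegrable (fun y => F (x, y)).
  apply: (cintegrable_le _ _ (leF x)).
    exact: (cmeasurable_comp mF (measurable_pair1 x)).
  by apply: integrableZlR; exact: cintegrable_cmod.
have iF2 y : cintegrable (fun x => F (x, y)).
  apply: (@cintegrable_le _ (fun x => (cmod (B y) * K) * cmod (A x))).
  - exact: (cmeasurable_comp mF (measurable_pair2 y)).
  - by apply: integrableZlR; exact: cintegrable_cmod.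
  - move=> x; rewrite (_ : _ * _ * _ = K * cmod (A x) * cmod (B y)); [exact: leF|by ring].
have iRe : (lam \x lam)%E.-integrable setT (EFin \o (fun z => complex.Re (F z))).
  apply: (integrable_prod_le (a := fun x => K * cmod (A x)) (b := fun y => cmod (B y))).
  - exact: mF.1.
  - by apply: integrableZlR; exact: cintegrable_cmod.
  - exact: cintegrable_cmod.
  - by move=> x y; exact: le_trans (le_Re_cmod _) (leF x y).
have iIm : (lam \x lam)%E.-integrable setT (EFin \o (fun z => complex.Im (F z))).
  apply: (integrable_prod_le (a := fun x => K * cmod (A x)) (b := fun y => cmod (B y))).
  - exact: mF.2.
  - by apply: integrableZlR; exact: cintegrable_cmod.
  - exact: cintegrable_cmod.
  - by move=> x y; exact: le_trans (le_Im_cmod _) (leF x y).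
transitivity (cintegral (fun x => cintegral (fun y => F (x, y)))).
  by congr cintegral; apply/funext => x; rewrite -cintegralZl.
transitivity (cintegral (fun y => cintegral (fun x => F (x, y)))); last first.
  congr cintegral; apply/funext => y; rewrite -cintegralZl//.
  by congr cintegral; apply/funext => x; rewrite /F/= mulrCA.
rewrite /cintegral /Re_fun /Im_fun /=; apply/eqP; rewrite eq_complex/=.
apply/andP; split; apply/eqP.
  apply: (Rfubini iRe) => [x|y]; [exact: (iF1 x).1|exact: (iF2 y).1].
apply: (Rfubini iIm) => [x|y]; [exact: (iF1 x).2|exact: (iF2 y).2].
Qed.

End cintegral_theory.

(** * Kernels with compactly supported Fourier transform *)

Section fejer.
Context (R : realType).
Local Notation mu := (@lebesgue_measure R).

(* [(1 - cos x) / x^2] is, up to a constant, the Fourier transform of the triangle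
   function on [-1, 1]; hence the transform of [fejer m] is nonnegative and
   supported in [-m, m]. *)
Definition fejer (m : nat) (x : R) : R := ((1 - cos x) / x ^+ 2) ^+ m.

Lemma FTC2_Rintegral (f F : R -> R) (a b : R) : a < b -> continuous f ->
  (forall x : R, is_derive x 1 F (f x)) ->
  (\int[mu]_(x in `[a, b]) (f x)%:E = (F b - F a)%:E)%E.
Proof.
move=> ab cf dF.
have cF x : {for x, continuous F}.
  apply: differentiable_continuous; apply/derivable1_diffP.
  by case: (dF x).
apply: continuous_FTC2 => //.
- exact: continuous_subspaceT.
- split.
  + by move=> x _; case: (dF x).
  + exact/cvg_at_right_filter/cF.
  + exact/cvg_at_left_filter/cF.
- by move=> x _; rewrite derive1E; case: (dF x).
Qed.

Lemma fejer1_integral (x : R) : x != 0 ->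
  (\int[mu]_(t in `[0%R, 1%R]) ((1 - t) * cos (x * t))%:E = (fejer 1 x)%:E)%E.
Proof.
move=> x0.
have cf : continuous (fun t : R => (1 - t) * cos (x * t)).
  move=> t; apply: cvgM.
    by apply: cvgB; [exact: cvg_cst|exact: cvg_id].
  apply: (@cvg_comp _ _ _ (fun t => x * t) cos); last exact: continuous_cos.
  by apply: cvgM; [exact: cvg_cst|exact: cvg_id].
(* Integration by parts gives this primitive, with values [- x ^- 2] at 0 and [- cos x / x ^+ 2] at
   1. *)
have dF (t : R) : is_derive t 1 (fun t => (1 - t) * sin (x * t) / x - cos (x * t) / x ^+ 2)
    ((1 - t) * cos (x * t)).
  have d1 : is_derive t 1 (fun t : R => x * t) x.
    by apply: is_derive_eq (is_deriveM (is_derive_cst x t 1) (is_derive_id t 1)) _; rewrite scaler0 addr0; exact: mulr1.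
  have d2 : is_derive t 1 (fun t : R => 1 - t) (-1).
    by apply: is_derive_eq (is_deriveB (is_derive_cst (1:R) t 1) (is_derive_id t 1)) _; rewrite sub0r.
  have d3 : is_derive t 1 (fun t : R => sin (x * t)) (cos (x * t) * x).
    exact: (@is_derive1_comp _ sin (fun t => x * t)).
  have d4 : is_derive t 1 (fun t : R => cos (x * t)) (- sin (x * t) * x).
    exact: (@is_derive1_comp _ cos (fun t => x * t)).
  have d5 := is_deriveM (is_deriveM d2 d3) (is_derive_cst (x^-1) t 1).
  have d6 := is_deriveM d4 (is_derive_cst (x ^- 2) t 1).
  apply: is_derive_eq (is_deriveB d5 d6) _.
  rewrite !scaler0 !add0r /GRing.scale/=.
  by field.
rewrite (FTC2_Rintegral ltr01 cf dF).
congr EFin; rewrite /fejer expr1 subrr mulr0 sin0 cos0 !mulr1.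
by field.
Qed.

Lemma fejer_ge0 m (x : R) : 0 <= fejer m x.
Proof. by rewrite exprn_ge0// divr_ge0 ?sqr_ge0// subr_ge0 cos_le1. Qed.

(** Division by zero yields 0 here, not the limit [2 ^- m]. So [fejer m] is discontinuous at 0; only
    its measurability is used, and identities in [x] have to be checked at 0 separately. *)
Lemma fejer0 m : (0 < m)%N -> fejer m 0 = 0.
Proof. by move=> m0; rewrite /fejer cos0 subrr mul0r expr0n gtn_eqF. Qed.

Lemma fejerN m (x : R) : fejer m (- x) = fejer m x.
Proof. by rewrite /fejer cosN sqrrN. Qed.

Lemma fejerS m (x : R) : fejer m.+1 x = fejer m x * fejer 1 x.
Proof. by rewrite /fejer expr1 exprSr. Qed.

Lemma measurable_invr : measurable_fun setT (fun x : R => x^-1).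
Proof.
have -> : (fun x : R => x^-1) = (fun x => (if 0 <= x then 1 else -1) * (`|x| `^ (-1))).
  apply/funext => x; have [x0|x0] := leP 0 x.
    by rewrite ger0_norm// powR_inv1// mul1r.
  by rewrite ltr0_norm// powR_inv1 ?oppr_ge0 ?ltW// invrN mulrNN mul1r.
apply: measurable_funM.
  by apply: measurable_fun_ifT => //; exact: measurable_fun_ler.
have mn : measurable_fun setT (fun x : R => `|x|) by exact: measurableT_comp.
by apply: (@measurableT_comp _ _ _ _ _ _ (@powR R ^~ (-1)) _ (fun x : R => `|x|)).
Qed.

Lemma measurable_fejer m : measurable_fun setT (fejer m).
Proof.
apply: measurable_funX; apply: measurable_funM.
  apply: measurable_funB => //.
  by apply: continuous_measurable_fun; exact: continuous_cos.
by apply: (measurableT_comp measurable_invr); exact: measurable_funX.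
Qed.

Lemma fejer1_le1 (x : R) : fejer 1 x <= 1.
Proof.
have [->|x0] := eqVneq x 0; first by rewrite fejer0.
rewrite -lee_fin -fejer1_integral//.
have mc : measurable_fun (`[(0 : R), 1]%classic : set R) (fun t : R => (1 - t) * cos (x * t)).
  apply: measurable_funTS; apply: measurable_funM; first exact: measurable_funB.
  apply: (measurableT_comp (continuous_measurable_fun (@continuous_cos R))).
  exact: measurable_funM.
apply: (@le_trans _ _ (\int[mu]_(t in `[0%R, 1%R]) (cst 1%:E t))%E).
  apply: le_integral => //.
  - apply: measurable_bounded_integrable => //.
      by rewrite /= lebesgue_measure_itv/= lte_fin ltr01 oppr0 adde0 ltry.
    exists 1; split=> // M M1 t /=; rewrite in_itv/= => /andP[t0 t1].
    rewrite (le_trans _ (ltW M1))// normrM -[leRHS]mulr1 ler_pM ?cos_max//.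
    by rewrite ger0_norm ?subr_ge0// lerBlDr lerDl.
  - apply/integrableP; split => //.
    rewrite integral_cst//= lebesgue_measure_itv/= lte_fin ltr01 oppr0 adde0.
    by rewrite normr1 mule1 ltry.
  - move=> t; rewrite /= inE/= in_itv/= => /andP[t0 t1]; rewrite lee_fin.
    have := cos_le1 (x * t) => c1.
    rewrite (le_trans _ (_ : 1 - t <= 1)) ?lerBlDr ?lerDl//.
    by rewrite -[leRHS]mulr1 ler_wpM2l// subr_ge0.
by rewrite integral_cst//= lebesgue_measure_itv/= lte_fin ltr01 oppr0 adde0 mule1.
Qed.

(** Near 0 the bound 1 is used together with [(1 + |x|) ^+ 2 <= 4]. For [|x| > 1] the numerator is
    at most 2 and [1 + |x| <= 2 * |x|], which gives the constant 8. *)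
Lemma fejer1_le (x : R) : fejer 1 x <= 8 * (1 + `|x|) ^- 2.
Proof.
have p : 0 < 1 + `|x| by rewrite ltr_pwDl.
rewrite ler_pdivlMr ?exprn_gt0//.
have [x1|x1] := leP `|x| 1.
  apply: (@le_trans _ _ (1 * 2 ^+ 2)).
    rewrite ler_pM ?fejer_ge0 ?fejer1_le1 ?exprn_ge0 ?(ltW p)//.
    by rewrite lerXn2r ?nnegrE ?(ltW p)//; lra.
  by rewrite mul1r -natrX ler_nat.
have x0 : x != 0 by apply/eqP => x0; move: x1; rewrite x0 normr0 ltr10.
rewrite /fejer expr1 mulrAC ler_pdivrMr ?exprn_even_gt0// -(real_normK (num_real x)).
apply: (@le_trans _ _ (2 * (2 * `|x|) ^+ 2)); last by rewrite exprMn; lra.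
apply: ler_pM.
- by rewrite subr_ge0 cos_le1.
- by rewrite exprn_ge0// ltW.
- by have := cos_geN1 x; lra.
- by rewrite lerXn2r ?nnegrE ?(ltW p)//; lra.
Qed.

Lemma fejer_le m (x : R) : fejer m x <= 8 ^+ m * (1 + `|x|) ^- (2 * m).
Proof.
rewrite exprM -exprVn -exprMn; have := fejer1_le x.
rewrite /fejer expr1 => H; rewrite lerXn2r ?nnegrE//.
by have := fejer_ge0 1 x; rewrite /fejer expr1.
Qed.

Lemma integrable_fejer m : (0 < m)%N -> mu.-integrable setT (EFin \o fejer m).
Proof.
move=> m0; have mf := @measurable_fejer m.
have i2 : mu.-integrable setT (EFin \o (fun x : R => 8 * (1 + `|x|) ^- 2)).
  apply: integrableZlR; apply/integrableP; split.
    apply/measurable_EFinP; apply: continuous_measurable_fun.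
    exact: continuous_weight1.
  under eq_integral do rewrite gee0_abs ?lee_fin ?invr_ge0 ?exprn_ge0 ?addr_ge0//.
  by rewrite integral_weight1 ltry.
apply: le_integrable i2 => //; first exact/measurable_EFinP.
move=> x _; rewrite lee_fin ger0_norm ?fejer_ge0//.
apply: le_trans (ler_norm _); apply: le_trans (fejer1_le x).
case: m m0 mf => // m _ _; rewrite fejerS -[leRHS]mul1r ler_wpM2r ?fejer_ge0//.
rewrite /fejer exprn_ile1//.
  by rewrite divr_ge0 ?sqr_ge0// subr_ge0 cos_le1.
by have := fejer1_le1 x; rewrite /fejer expr1.
Qed.

End fejer.

(** * Positivity and support of the transform of the kernel *)

Section fejer_transform.
Context (R : realType).
Local Notation mu := (@lebesgue_measure R).
Local Notation fejer := (@fejer R).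

Lemma integrable_mul_bounded d0 (T : measurableType d0) (nu : {measure set T -> \bar R})
    (h k : T -> R) : nu.-integrable setT (EFin \o h) -> measurable_fun setT k ->
  (forall x, `|k x| <= 1) -> nu.-integrable setT (EFin \o (fun x => h x * k x)).
Proof.
move=> hi mk k1; have /measurable_int/measurable_EFinP mh := hi.
apply: le_integrable hi => //; first by apply/measurable_EFinP; exact: measurable_funM.
by move=> x _; rewrite lee_fin normrM -[leRHS]mulr1 ler_wpM2l.
Qed.

Lemma measurable_cosM (a : R) : measurable_fun setT (fun x : R => cos (x * a)).
Proof.
apply: (measurableT_comp (continuous_measurable_fun (@continuous_cos R))).
exact: measurable_funM.
Qed.

Lemma measurable_sinM (a : R) : measurable_fun setT (fun x : R => sin (x * a)).
Proof.
apply: (measurableT_comp (continuous_measurable_fun (@continuous_sin R))).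
exact: measurable_funM.
Qed.

Lemma integrable_fejer_cos m xi : (0 < m)%N ->
  mu.-integrable setT (EFin \o (fun x => fejer m x * cos (x * xi))).
Proof.
move=> m0; apply: integrable_mul_bounded; first exact: integrable_fejer.
  exact: measurable_cosM.
by move=> x; exact: cos_max.
Qed.

Lemma integrable_fejer_sin m xi : (0 < m)%N ->
  mu.-integrable setT (EFin \o (fun x => fejer m x * sin (x * xi))).
Proof.
move=> m0; apply: integrable_mul_bounded; first exact: integrable_fejer.
  exact: measurable_sinM.
by move=> x; exact: sin_max.
Qed.

Lemma Rintegral_oppr (h : R -> R) : mu.-integrable setT (EFin \o h) ->
  mu.-integrable setT (EFin \o (fun x => h (- x))) ->
  \int[mu]_x h (- x) = \int[mu]_x h x.
Proof.
move=> hi hi'; congr fine.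
have /measurable_int mh := hi.
pose g : measurableTypeR R -> measurableTypeR R := -%R.
have mg : measurable_fun setT g by exact: oppr_measurable.
have := @integral_pushforward _ _ _ _ R g mg mu setT (EFin \o h) mh.
rewrite preimage_setT => /(_ hi' measurableT) <-.
by apply: eq_measure_integral => A mA _; exact: lebesgue_measureN.
Qed.

Lemma fejer_sin m xi : (0 < m)%N -> \int[mu]_x (fejer m x * sin (x * xi)) = 0.
Proof.
move=> m0; pose h x := fejer m x * sin (x * xi).
have hN x : h (- x) = - h x by rewrite /h fejerN mulNr sinN mulrN.
have hi : mu.-integrable setT (EFin \o h) by exact: integrable_fejer_sin.
have := @Rintegral_oppr h hi.
have -> : (fun x => h (- x)) = (fun x => (-1) * h x).
  by apply/funext => x; rewrite hN mulN1r.
move=> /(_ (integrableZlR (-1) hi)); rewrite RintegralZl//.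
by rewrite -/h => H; lra.
Qed.

(** The whole (unnormalised) Fourier transform of [fejer m], since the sine part vanishes by
    [fejer_sin]. *)
Definition fejerT m xi : R := \int[mu]_x (fejer m x * cos (x * xi)).

Lemma fejerTN m xi : fejerT m (- xi) = fejerT m xi.
Proof. by apply: eq_Rintegral => x _; rewrite mulrN cosN. Qed.

Let D (a x : R) := (1 - cos (x * a)) / x ^+ 2.

(** For [a > 0] the integrand is [a ^+ 2 * fejer 1 (a * x)], also at [x = 0] where both are 0 by
    convention, and the substitution costs one factor [a]. *)
Lemma integral_cos_ge0 (a : R) : 0 <= a ->
  mu.-integrable setT (EFin \o (fun x => (1 - cos (x * a)) / x ^+ 2)) /\
  \int[mu]_x ((1 - cos (x * a)) / x ^+ 2) = a * \int[mu]_x fejer 1 x.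
Proof.
rewrite le_eqVlt => /predU1P[<-|a0].
  have -> : (fun x : R => (1 - cos (x * 0)) / x ^+ 2) = (fun _ => 0).
    by apply/funext => x; rewrite mulr0 cos0 subrr mul0r.
  split; last by rewrite mul0r /Rintegral integral0.
  by apply: (eq_integrable measurableT (cst 0%E)) => //; exact: integrable0.
have fi := @integrable_fejer R 1 isT.
have mf := @measurable_fejer R 1.
have E x : (1 - cos (x * a)) / x ^+ 2 = a ^+ 2 * fejer 1 (a * x + 0).
  rewrite /fejer expr1 addr0 (mulrC a x).
  have [->|x0] := eqVneq x 0; first by rewrite !mul0r cos0 subrr !mul0r mulr0.
  by field; rewrite x0 gt_eqF.
have I0 : (\int[mu]_x (fejer 1 x)%:E)%E = (a%:E * \int[mu]_x (fejer 1 (a * x + 0))%:E)%E.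
  rewrite (@ge0_integral_affine_1d R a 0 (EFin \o fejer 1))//.
  - exact/measurable_EFinP.
  - by move=> x; rewrite lee_fin fejer_ge0.
have m1 : measurable_fun setT (fun x => fejer 1 (a * x + 0)).
  apply: (measurableT_comp mf); exact: measurable_affine.
have i1 : mu.-integrable setT (EFin \o (fun x => fejer 1 (a * x + 0))).
  apply/integrableP; split; first exact/measurable_EFinP.
  under eq_integral do rewrite gee0_abs ?lee_fin ?fejer_ge0//.
  have := integrable_fin_num measurableT fi.
  rewrite /comp I0 => h.
  rewrite ltey; apply/eqP => H; move: h; rewrite H.
  by rewrite mulry gtr0_sg// mul1e.
split.
  under eq_fun do rewrite E.
  exact: integrableZlR.
under eq_Rintegral do rewrite E.
rewrite RintegralZl// /Rintegral I0 fineM//; last exact: integrable_fin_num i1.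
by rewrite /= expr2 mulrA.
Qed.

Lemma integral_cos_abs (a : R) :
  mu.-integrable setT (EFin \o D a) /\
  \int[mu]_x D a x = `|a| * \int[mu]_x fejer 1 x.
Proof.
have -> : D a = (fun x => (1 - cos (x * `|a|)) / x ^+ 2).
  apply/funext => x; rewrite /D; have [a0|a0] := leP 0 a; first by rewrite ger0_norm.
  by rewrite ltr0_norm// mulrN cosN.
exact: integral_cos_ge0.
Qed.

(** The product [(1 - cos x) * cos (x * xi)] is a combination of three terms [1 - cos (x * a)] with
    [a = 1 + xi], [1 - xi] and [xi]. The last factor is the triangle function [max(0, 1 - |xi|)]. *)
Lemma fejerT1 xi : fejerT 1 xi =
  (\int[mu]_x fejer 1 x) * (2^-1 * `|1 + xi| + 2^-1 * `|1 - xi| - `|xi|).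
Proof.
have [i1 e1] := integral_cos_abs (1 + xi).
have [i2 e2] := integral_cos_abs (1 - xi).
have [i3 e3] := integral_cos_abs xi.
rewrite [RHS](_ : _ = 2^-1 * (\int[mu]_x D (1 + xi) x) + 2^-1 * (\int[mu]_x D (1 - xi) x)
   - \int[mu]_x D xi x); last by rewrite e1 e2 e3; ring.
rewrite -!RintegralZl// -RintegralD//; [|exact: integrableZlR..].
rewrite -RintegralB//; last first.
  exact: (integrableD measurableT (integrableZlR _ i1) (integrableZlR _ i2)).
apply: eq_Rintegral => x _; rewrite /D /fejer expr1 !mulrDr mulr1 mulrN cosD cosB.
by move: (cos x) (sin x) (cos (x * xi)) (sin (x * xi)) (x ^- 2) => c1 s1 c2 s2 v; field.
Qed.

Lemma Rintegral_indic_itv (a b : R) : a <= b ->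
  \int[mu]_x (\1_(`[a, b]%classic : set R) x : R) = b - a.
Proof.
move=> ab; rewrite /Rintegral integral_indic//.
rewrite setIT.
rewrite -[RHS]/(fine (b - a)%:E); congr fine.
apply: (etrans (lebesgue_measure_itv _)).
rewrite /= lte_fin; move: ab; rewrite le_eqVlt => /predU1P[->|->].
  by rewrite ltxx subrr.
by rewrite EFinB.
Qed.

Lemma integral_fejer1_gt0 : 0 < \int[mu]_x fejer 1 x.
Proof.
have p0 := @pi_gt0 R.
have lt : pi / 2 < pi :> R by lra.
(* On [[pi / 2, pi]] the cosine is nonpositive, so [fejer 1 x] is at least [x ^- 2], hence at least
   [pi ^- 2]. *)
pose h (x : R) : R := pi ^- 2 * \1_(`[(pi / 2 : R), pi]%classic : set R) x.
have hi : mu.-integrable setT (EFin \o h).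
  by apply: integrableZlR; exact: integrable_indic_itv.
apply: (@lt_le_trans _ _ (\int[mu]_x h x)).
  rewrite /h RintegralZl//; last exact: integrable_indic_itv.
  rewrite mulr_gt0 ?invr_gt0 ?exprn_gt0//.
  by rewrite Rintegral_indic_itv ?subr_gt0// ltW.
apply: le_Rintegral => //; first exact: integrable_fejer.
move=> x _; rewrite /h indicE; case: (boolP (x \in _)) => [|_]; last first.
  by rewrite mulr0 fejer_ge0.
rewrite inE/= in_itv/= => /andP[x1 x2]; rewrite mulr1 /fejer expr1.
have x0 : 0 < x by lra.
rewrite -[leLHS]mul1r ler_pM ?invr_ge0 ?exprn_ge0 ?(ltW p0)//; last first.
  by rewrite lef_pV2 ?posrE ?exprn_gt0// lerXn2r ?nnegrE ?(ltW x0) ?(ltW p0).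
rewrite lerBrDl -lerBrDr subrr.
have -> : x = (x - pi / 2) + pi / 2 by ring.
rewrite cosDpihalf oppr_le0 sin_ge0_pi//; apply/andP; split; lra.
Qed.

(* By [fejer1_integral] and Fubini's theorem, each transform is an average of
   translates of the previous one, which propagates positivity and the support. *)
Lemma fejerT_step m xi : (0 < m)%N ->
  mu.-integrable setT (EFin \o (fun t => (1 - t) * (\1_(`[(0:R), 1]%classic : set R) t) *
    (2^-1 * (fejerT m (xi + t) + fejerT m (xi - t))))) /\
  fejerT m.+1 xi = \int[mu]_t ((1 - t) * (\1_(`[(0:R), 1]%classic : set R) t) *
    (2^-1 * (fejerT m (xi + t) + fejerT m (xi - t)))).
Proof.
move=> m0.
pose w (t : R) := (1 - t) * (\1_(`[(0:R), 1]%classic : set R) t).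
have w01 t : 0 <= w t <= \1_(`[(0:R), 1]%classic : set R) t.
  rewrite /w indicE; case: (boolP (t \in _)) => [|_]; last by rewrite mulr0 lexx.
  rewrite inE/= in_itv/= => /andP[t1 t2]; rewrite mulr1; apply/andP; split; lra.
have mw : measurable_fun setT w by apply: measurable_funM => //; exact: measurable_funB.
have ind_i : mu.-integrable setT (EFin \o (\1_(`[(0:R), 1]%classic : set R) : R -> R)).
  exact: integrable_indic_itv.
have wi : mu.-integrable setT (EFin \o w).
  apply: le_integrable ind_i => //; first exact/measurable_EFinP.
  move=> t _; have /andP[h1 h2] := w01 t.
  by rewrite lee_fin (ger0_norm h1) (le_trans h2)// ler_norm.
(* Integrated over [z.2], this gives the mean of two translates of [fejerT m], by the product
   formula for cosines; integrated over [z.1], it gives the additional factor [fejer 1]. *)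
pose f (z : R * R) : R := fejer m z.2 * cos (z.2 * xi) * (w z.1 * cos (z.2 * z.1)).
have mf : measurable_fun [set: measurableTypeR R * measurableTypeR R] f.
  apply: measurable_funM.
    apply: measurable_funM.
      exact: (measurableT_comp (@measurable_fejer R m) measurable_snd).
    exact: (measurableT_comp (measurable_cosM xi) measurable_snd).
  apply: measurable_funM.
    exact: (measurableT_comp mw measurable_fst).
  apply: (measurableT_comp (continuous_measurable_fun (@continuous_cos R))).
  by apply: measurable_funM; [exact: measurable_snd|exact: measurable_fst].
have fb y x : `|f (y, x)| <= w y * fejer m x.
  rewrite /f/= (normrM (fejer m x * _)) (normrM (fejer m x)) (normrM (w y)) (ger0_norm (fejer_ge0 _ _)).
  have /andP[h1 _] := w01 y; rewrite (ger0_norm h1) [leRHS]mulrC.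
  apply: ler_pM.
  - by apply: mulr_ge0 => //; exact: fejer_ge0.
  - exact: mulr_ge0.
  - by rewrite -[leRHS]mulr1 ler_wpM2l ?fejer_ge0 ?cos_max.
  - by rewrite -[leRHS]mulr1 ler_wpM2l ?cos_max.
have fi : (mu \x mu)%E.-integrable setT (EFin \o f).
  by apply: (integrable_prod_le mf wi _ fb); exact: integrable_fejer.
have f1 x : mu.-integrable setT (EFin \o (fun y => f (y, x))).
  rewrite /f /=; apply: integrableZlR; apply: integrable_mul_bounded => //.
    under eq_fun do rewrite mulrC; exact: measurable_cosM.
  by move=> y; exact: cos_max.
have f2 y : mu.-integrable setT (EFin \o (fun x => f (y, x))).
  rewrite (_ : (fun x => f (y, x)) = (fun x => w y * ((fejer m x * cos (x * xi)) * cos (x * y)))).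
    apply: integrableZlR; apply: integrable_mul_bounded => //.
    - exact: integrable_fejer_cos.
    - exact: measurable_cosM.
    - by move=> x; exact: cos_max.
  by apply/funext => x; rewrite /f/=; ring.
have fE y : \int[mu]_x f (y, x) = w y * (2^-1 * (fejerT m (xi + y) + fejerT m (xi - y))).
  rewrite /fejerT -RintegralD//; [|exact: integrable_fejer_cos..].
  rewrite -RintegralZl//; last first.
    exact: (integrableD measurableT (integrable_fejer_cos _ m0) (integrable_fejer_cos _ m0)).
  rewrite -RintegralZl//; last first.
    apply: integrableZlR.
    exact: (integrableD measurableT (integrable_fejer_cos _ m0) (integrable_fejer_cos _ m0)).
  by apply: eq_Rintegral => x _; rewrite /f/= !mulrDr mulrN cosD cosB; field.
split.
  have := integrable_Rintegral1 fi f2.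
  by apply: eq_integrable => // y _ /=; rewrite fE.
transitivity (\int[mu]_y \int[mu]_x f (y, x)); last first.
  by apply: eq_Rintegral => y _; rewrite fE.
rewrite (Rfubini fi f2 f1) /fejerT; apply: eq_Rintegral => x _.
rewrite /f/= RintegralZl//; last first.
  apply: integrable_mul_bounded => //.
    under eq_fun do rewrite mulrC; exact: measurable_cosM.
  by move=> y; exact: cos_max.
(* At 0 the integral formula for [fejer 1] fails, but both sides carry the factor
   [fejer m 0 = 0]. *)
rewrite fejerS mulrAC; have [->|x0] := eqVneq x 0.
  by rewrite fejer0// !mul0r.
congr (_ * _); rewrite /Rintegral.
have -> : fejer 1 x = fine (fejer 1 x)%:E by [].
rewrite -fejer1_integral//; congr fine.
rewrite [LHS]integral_mkcond; apply: eq_integral => y _.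
rewrite patchE /w indicE; case: ifPn => [yi|yi]; first by rewrite mulr1.
by rewrite mulr0 mul0r.
Qed.

Lemma fejerT_ge0 m xi : (0 < m)%N -> 0 <= fejerT m xi.
Proof.
case: m => // m _; elim: m xi => [|m IH] xi.
  rewrite fejerT1 mulr_ge0 ?(ltW integral_fejer1_gt0)//.
  have := ler_normB (1 + xi) (1 - xi); have := ler_normD (1 + xi) (xi - 1).
  rewrite (distrC xi 1) (_ : 1 + xi + (xi - 1) = 2 * xi); last by ring.
  by rewrite normrM ger0_norm//; lra.
have [_ ->] := @fejerT_step m.+1 xi isT.
apply: Rintegral_ge0 => t _; rewrite indicE; case: (boolP (t \in _)) => [|_]; last first.
  by rewrite mulr0 mul0r.
rewrite inE/= in_itv/= => /andP[t1 t2]; rewrite mulr1 mulr_ge0 ?subr_ge0//.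
by rewrite mulr_ge0// addr_ge0.
Qed.

Lemma fejerT_supp m xi : (0 < m)%N -> m%:R <= `|xi| -> fejerT m xi = 0.
Proof.
case: m => // m _; elim: m xi => [|m IH] xi mxi.
  rewrite fejerT1; apply/eqP; rewrite mulf_eq0; apply/orP; right; apply/eqP.
  have [x0|x0] := leP 0 xi.
    rewrite ger0_norm// in mxi.
    by rewrite (ger0_norm x0) (@ger0_norm _ (1 + xi)) ?(@ler0_norm _ (1 - xi)); lra.
  rewrite ltr0_norm// in mxi.
  by rewrite (ltr0_norm x0) (@ler0_norm _ (1 + xi)) ?(@ger0_norm _ (1 - xi)); lra.
have [_ ->] := @fejerT_step m.+1 xi isT.
rewrite (_ : (fun t => _) = cst 0); first by rewrite Rintegral_cst// mul0r.
apply/funext => t; rewrite indicE; case: (boolP (t \in _)) => [|_]; last first.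
  by rewrite mulr0 mul0r.
rewrite inE/= in_itv/= => /andP[t1 t2].
have H (u : R) : `|u| <= 1 -> m.+1%:R <= `|xi + u|.
  move=> u1; have := ler_normB (xi + u) u; rewrite addrK.
  by move: mxi; rewrite -natr1 => ? ?; lra.
rewrite !IH ?addr0 ?mulr0//; apply: H; rewrite ?normrN ger0_norm//.
Qed.

Lemma fejerT_gt0 m : (0 < m)%N ->
  exists2 c : R, 0 < c & forall xi, `|xi| <= 2^-1 -> c <= fejerT m xi.
Proof.
case: m => // m _; elim: m => [|m [c c0 IH]].
  exists (2^-1 * \int[mu]_x fejer 1 x); first by rewrite mulr_gt0 ?integral_fejer1_gt0.
  move=> xi xi1; rewrite fejerT1 mulrC ler_wpM2l ?(ltW integral_fejer1_gt0)//.
  move: xi1; rewrite ler_norml => /andP[x1 x2].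
  rewrite (@ger0_norm _ (1 + xi)) ?(@ger0_norm _ (1 - xi)); [|lra..].
  have : `|xi| <= 2^-1 by rewrite ler_norml x1 x2.
  by lra.
(* For [t] in [[0, 1/2]] the weight [1 - t] is at least 1/2, and of the two translates of [xi] by
   [t] the one moved towards 0 stays in [[-1/2, 1/2]], the other contributing something nonnegative.
   So the integrand is at least [c / 4] on an interval of length 1/2. *)
exists (8^-1 * c); first by rewrite mulr_gt0.
move=> xi xi1; have [i1 ->] := @fejerT_step m.+1 xi isT.
pose h (t : R) : R := (4^-1 * c) * \1_(`[(0:R), 2^-1]%classic : set R) t.
have hi : mu.-integrable setT (EFin \o h).
  by apply: integrableZlR; exact: integrable_indic_itv.
apply: (@le_trans _ _ (\int[mu]_x h x)).
  rewrite /h RintegralZl//; last exact: integrable_indic_itv.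
  by rewrite Rintegral_indic_itv; lra.
apply: le_Rintegral => // t _; rewrite /h !indicE.
have F0 u : 0 <= fejerT m.+1 u by exact: fejerT_ge0.
case: (boolP (t \in (`[_, 2^-1]%classic : set R))) => [|_]; last first.
  rewrite mulr0; case: (boolP (t \in _)) => [|_]; last by rewrite mulr0 mul0r.
  rewrite inE/= in_itv/= => /andP[t1 t2]; rewrite mulr1 mulr_ge0 ?subr_ge0//.
  by rewrite mulr_ge0// addr_ge0.
rewrite inE/= in_itv/= => /andP[t1 t2].
rewrite mem_set/=; last by rewrite in_itv/= t1/=; lra.
rewrite !mulr1.
have H : c <= fejerT m.+1 (xi + t) + fejerT m.+1 (xi - t).
  have [x0|x0] := leP 0 xi.
    have : c <= fejerT m.+1 (xi - t).
      by apply: IH; move: xi1; rewrite !ler_norml; lra.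
    by have := F0 (xi + t); lra.
  have : c <= fejerT m.+1 (xi + t).
    by apply: IH; move: xi1; rewrite !ler_norml; lra.
  by have := F0 (xi - t); lra.
have -> : 4^-1 * c = 2^-1 * (2^-1 * c) by lra.
by rewrite ler_pM ?mulr_ge0 ?(ltW c0)//; lra.
Qed.

End fejer_transform.

Section fejer_rV.
Context (R : realType).
Local Notation mu := (@lebesgue_measure R).
Local Notation lam := (lebesgue_rV R).

Definition fejer_rV n (m : nat) (x : 'rV[R]_n) : R := \prod_(i < n) fejer m (x ord0 i).

Definition fejerT_rV n (m : nat) (xi : 'rV[R]_n) : R := \prod_(i < n) fejerT m (xi ord0 i).

Lemma fejer_rV_ge0 n m (x : 'rV[R]_n) : 0 <= fejer_rV m x.
Proof. by rewrite prodr_ge0// => i _; exact: fejer_ge0. Qed.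

Lemma measurable_fejer_rV n m : measurable_fun setT (@fejer_rV n m).
Proof. by apply: measurable_prod_rV; exact: measurable_fejer. Qed.

Lemma integrable_fejer_rV n m : (0 < m)%N ->
  (lam n).-integrable setT (EFin \o @fejer_rV n m).
Proof.
move=> m0; apply/integrableP; split.
  by apply/measurable_EFinP; exact: measurable_fejer_rV.
under eq_integral do rewrite gee0_abs ?lee_fin ?fejer_rV_ge0//.
rewrite (@ge0_integral_prod_rV _ n (fejer m) (\int[mu]_x fejer m x)) ?ltry//.
- exact: measurable_fejer.
- by move=> x; exact: fejer_ge0.
- rewrite /Rintegral fineK//; exact: (integrable_fin_num measurableT (integrable_fejer R m0)).
Qed.

Lemma measurable_cos_dotr n (xi : 'rV[R]_n) : measurable_fun setT (fun x : 'rV[R]_n => cos (dotr x xi)).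
Proof.
apply: (measurableT_comp (continuous_measurable_fun (@continuous_cos R))).
by have := @measurable_dotrl R n xi; apply: eq_measurable_fun => x _; rewrite /dotr; apply: eq_bigr => i _; rewrite mulrC.
Qed.

Lemma measurable_sin_dotr n (xi : 'rV[R]_n) : measurable_fun setT (fun x : 'rV[R]_n => sin (dotr x xi)).
Proof.
apply: (measurableT_comp (continuous_measurable_fun (@continuous_sin R))).
by have := @measurable_dotrl R n xi; apply: eq_measurable_fun => x _; rewrite /dotr; apply: eq_bigr => i _; rewrite mulrC.
Qed.

Lemma integrable_fejer_rV_cos n m (xi : 'rV[R]_n) : (0 < m)%N ->
  (lam n).-integrable setT (EFin \o (fun x => fejer_rV m x * cos (dotr x xi))).
Proof.
move=> m0; apply: integrable_mul_bounded; first exact: integrable_fejer_rV.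
  exact: measurable_cos_dotr.
by move=> x; exact: cos_max.
Qed.

Lemma integrable_fejer_rV_sin n m (xi : 'rV[R]_n) : (0 < m)%N ->
  (lam n).-integrable setT (EFin \o (fun x => fejer_rV m x * sin (dotr x xi))).
Proof.
move=> m0; apply: integrable_mul_bounded; first exact: integrable_fejer_rV.
  exact: measurable_sin_dotr.
by move=> x; exact: sin_max.
Qed.

Lemma sinD' (x y : R) : sin (x + y) = sin x * cos y + cos x * sin y.
Proof. exact: sinD. Qed.

(** Cosine and sine are treated together because the addition formulas mix them when a coordinate is
    split off. *)
Lemma fejer_rV_transform n m (xi : 'rV[R]_n) : (0 < m)%N ->
  (\int[lam n]_x (fejer_rV m x * cos (dotr x xi))%:E = (fejerT_rV m xi)%:E)%E /\
  (\int[lam n]_x (fejer_rV m x * sin (dotr x xi))%:E = 0)%E.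
Proof.
move=> m0; elim: n xi => [|n IH] xi.
  have h (f : 'rV[R]_0 -> R) : measurable_fun setT f ->
      (\int[lam 0]_x (f x)%:E = (f 0)%:E)%E.
    move=> mf; rewrite [LHS]integral_dirac//; last exact/measurable_EFinP.
    by rewrite -[RHS]mul1e; congr (_ * _)%E; exact: diracT.
  split; rewrite h.
  - by rewrite /fejer_rV /fejerT_rV /dotr !big_ord0 cos0 mulr1.
  - have /measurable_int/measurable_EFinP := integrable_fejer_rV_cos xi m0; exact.
  - by rewrite /dotr big_ord0 sin0 mulr0.
  - have /measurable_int/measurable_EFinP := integrable_fejer_rV_sin xi m0; exact.
pose xi' := \row_j xi ord0 (lift ord0 j).
have [IHc IHs] := IH xi'.
have ic := integrable_fejer_rV_cos xi' m0; have is_ := integrable_fejer_rV_sin xi' m0.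
have E1 : fejerT_rV m xi = fejerT m (xi ord0 ord0) * fejerT_rV m xi'.
  by rewrite /fejerT_rV big_ord_recl; congr (_ * _); apply: eq_bigr => i _; rewrite mxE.
have fc := integrable_fejer_cos (xi ord0 ord0) m0.
have fs := integrable_fejer_sin (xi ord0 ord0) m0.
(* By induction the sine part of the remaining coordinates integrates to 0, whatever its
   coefficient. *)
have key (a b : R -> R) x : (\int[lam n]_v (a x * (fejer_rV m v * cos (dotr v xi')) +
    b x * (fejer_rV m v * sin (dotr v xi')))%:E = (a x * fejerT_rV m xi')%:E)%E.
  under eq_integral do rewrite EFinD.
  rewrite integralD//; [|exact: integrableZlR..].
  under eq_integral do rewrite EFinM.
  rewrite integralZl// IHc.
  under eq_integral do rewrite EFinM.
  by rewrite integralZl// IHs mule0 adde0.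
have mint (g : R -> R) : mu.-integrable setT (EFin \o g) ->
    (\int[mu]_x (g x * fejerT_rV m xi')%:E = (fejerT_rV m xi' * \int[mu]_x g x)%:E)%E.
  move=> gi; under eq_integral do rewrite mulrC EFinM.
  rewrite integralZl// /Rintegral EFinM fineK//; exact: integrable_fin_num gi.
split.
  rewrite integral_cons_rV; last exact: integrable_fejer_rV_cos.
  transitivity (\int[mu]_x (fejer m x * cos (x * xi ord0 ord0) * fejerT_rV m xi')%:E)%E.
    apply: eq_integral => x _.
    rewrite -(key (fun x => fejer m x * cos (x * xi ord0 ord0)) (fun x => - (fejer m x * sin (x * xi ord0 ord0)))).
    apply: eq_integral => v _; congr EFin.
    by rewrite /fejer_rV prod_cons_rV dotr_cons_rV cosD; ring.
  by rewrite mint// E1 mulrC.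
rewrite integral_cons_rV; last exact: integrable_fejer_rV_sin.
transitivity (\int[mu]_x (fejer m x * sin (x * xi ord0 ord0) * fejerT_rV m xi')%:E)%E.
  apply: eq_integral => x _.
  rewrite -(key (fun x => fejer m x * sin (x * xi ord0 ord0)) (fun x => (fejer m x * cos (x * xi ord0 ord0)))).
  apply: eq_integral => v _; congr EFin.
  by rewrite /fejer_rV prod_cons_rV dotr_cons_rV sinD'; ring.
by rewrite mint// fejer_sin// mulr0.
Qed.

Lemma cintegral_fejer_rV n m (xi : 'rV[R]_n) : (0 < m)%N ->
  cintegral (fun x => (fejer_rV m x)%:C * expi (dotr x xi)) = (fejerT_rV m xi)%:C.
Proof.
move=> m0; have [c s] := fejer_rV_transform xi m0.
rewrite /cintegral /Re_fun /Im_fun.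
have -> : (fun x : 'rV[R]_n => complex.Re ((fejer_rV m x)%:C * expi (dotr x xi))) =
   (fun x => fejer_rV m x * cos (dotr x xi)).
  by apply/funext => x /=; rewrite mul0r subr0.
have -> : (fun x : 'rV[R]_n => complex.Im ((fejer_rV m x)%:C * expi (dotr x xi))) =
   (fun x => fejer_rV m x * sin (dotr x xi)).
  by apply/funext => x /=; rewrite mul0r addr0.
by rewrite /Rintegral c s.
Qed.

Lemma fejerT_rV_ge0 n m (xi : 'rV[R]_n) : (0 < m)%N -> 0 <= fejerT_rV m xi.
Proof. by move=> m0; rewrite prodr_ge0// => i _; exact: fejerT_ge0. Qed.

Lemma fejerT_rVN n m (xi : 'rV[R]_n) : fejerT_rV m (- xi) = fejerT_rV m xi.
Proof. by apply: eq_bigr => i _; rewrite mxE fejerTN. Qed.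

(** The coordinate of largest modulus makes its factor vanish; in dimension 0 the empty product
    would be 1. *)
Lemma fejerT_rV_supp n m (xi : 'rV[R]_n) : (0 < n)%N -> (0 < m)%N -> m%:R <= `|xi| ->
  fejerT_rV m xi = 0.
Proof.
move=> n0 m0 mxi; have [i xiE] := exists_rV_norm xi n0.
by rewrite /fejerT_rV (bigD1 i)//= fejerT_supp ?mul0r// -xiE.
Qed.

Lemma fejerT_rV_gt0 n m : (0 < m)%N ->
  exists2 c : R, 0 < c & forall xi : 'rV[R]_n, `|xi| <= 2^-1 -> c <= fejerT_rV m xi.
Proof.
move=> m0; have [c c0 H] := fejerT_gt0 R m0.
exists (c ^+ n); first by rewrite exprn_gt0.
move=> xi xi1; rewrite -[X in _ ^+ X]card_ord -prodr_const ler_prod// => i _.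
by rewrite (ltW c0)/= H// (le_trans (le_rV_norm _ _)).
Qed.

(** The decay is taken from the coordinate of largest modulus alone; the other weights are bounded
    by 1. *)
Lemma fejer_rV_le n m (x : 'rV[R]_n) : fejer_rV m x <= 8 ^+ (m * n) * weight (2 * m) x.
Proof.
case: n x => [|n] x.
  rewrite /fejer_rV big_ord0 muln0 expr0 mul1r.
  have -> : x = 0 by apply/rowP => -[].
  by rewrite /weight normr0 addr0 expr1n invr1.
apply: (@le_trans _ _ (\prod_(i < n.+1) (8 ^+ m * (1 + `|x ord0 i|) ^- (2 * m)))).
  by apply: ler_prod => i _; rewrite fejer_ge0 fejer_le.
rewrite big_split/= prodr_const card_ord -exprM ler_wpM2l ?exprn_ge0//.
have [i xi] := exists_rV_norm x (isT : (0 < n.+1)%N).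
rewrite (bigD1 i)//= -xi -[leRHS]mulr1 ler_wpM2l ?weight_ge0//.
apply: prodr_ile1 => j _; rewrite invr_ge0 exprn_ge0 ?addr_ge0//=.
by rewrite invf_le1 ?exprn_gt0 ?ltr_pwDl// exprn_ege1// lerDl.
Qed.

End fejer_rV.

(** * Littlewood-Paley blocks of regular distributions *)

Section directional.
Context (R : realType) (d : nat).
Local Notation V := 'rV[R]_d.

Lemma is_derive_translate (w : V -> R) (x a e : V) (dw : R) :
  is_derive (x + a) e w dw -> is_derive x e (fun y => w (y + a)) dw.
Proof.
move=> [H1 H2].
have E : (fun h : R => h^-1 *: (((fun y => w (y + a)) \o shift x) (h *: e) - w (x + a))) =
         (fun h : R => h^-1 *: ((w \o shift (x + a)) (h *: e) - w (x + a))).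
  by apply/funext => h /=; rewrite addrA.
by split; rewrite /derivable /derive ?E.
Qed.

Lemma is_derive_line (w : V -> R) (x e : V) (t dw : R) :
  is_derive (t *: e + x) e w dw -> is_derive t (1 : R) (fun s : R => w (s *: e + x)) dw.
Proof.
move=> [H1 H2].
have E : (fun h : R => h^-1 *: (((fun s => w (s *: e + x)) \o shift t) (h *: (1:R)) - w (t *: e + x))) =
         (fun h : R => h^-1 *: ((w \o shift (t *: e + x)) (h *: e) - w (t *: e + x))).
  apply/funext => h /=; rewrite addrA -scalerDl; do 4 f_equal.
  by rewrite /GRing.scale/= mulr1.
by split; rewrite /derivable /derive ?E.
Qed.

Lemma le_increment (w dw : V -> R) (x e : V) (h B : R) :
  (forall y, is_derive y e w (dw y)) -> (forall y, `|dw y| <= B) ->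
  `|w x - w (x + h *: e)| <= `|h| * B.
Proof.
move=> wd dB.
have pos (y : V) (k : R) : 0 < k -> `|w (k *: e + y) - w y| <= k * B.
  move=> k0.
  have dl t : is_derive t (1:R) (fun s : R => w (s *: e + y)) (dw (t *: e + y)).
    exact: is_derive_line.
  have [|c _] := @MVT_segment R (fun s : R => w (s *: e + y)) (fun t => dw (t *: e + y)) 0 k (ltW k0).
    apply: continuous_subspaceT => t; apply: differentiable_continuous.
    by apply/derivable1_diffP; case: (dl t).
  rewrite scale0r add0r subr0 => ->.
  by rewrite normrM (gtr0_norm k0) mulrC ler_wpM2l// ltW.
have [h0|h0|->] := ltgtP h 0; last by rewrite scale0r addr0 subrr normr0 mul0r.
- have := pos (x + h *: e) (- h); rewrite oppr_gt0 => /(_ h0).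
  by rewrite scaleNr (addrC x) addKr (ltr0_norm h0).
- by rewrite distrC (addrC x) (gtr0_norm h0); exact: pos.
Qed.

End directional.

(** * Decay of the convolution kernels of smooth multipliers *)

Section kernel_decay.
Context (R : realType) (d : nat).
Local Notation V := 'rV[R]_d.
Local Notation lam := (lebesgue_rV R d).

Definition box_fun (A : R) (x : V) : R := if `|x| <= A then 1 else 0.

Lemma box_fun_ge0 A x : 0 <= box_fun A x.
Proof. by rewrite /box_fun; case: ifP. Qed.

Lemma integrable_box_fun A : lam.-integrable setT (EFin \o box_fun A).
Proof.
have [A0|A0] := ltP A 0.
  apply: (eq_integrable measurableT (cst 0%E)); last exact: integrable0.
  move=> x _ /=; rewrite /box_fun; case: ifPn => // xA.
  by have := le_lt_trans xA A0; rewrite ltNge normr_ge0.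
apply: (le_integrable measurableT _ _ (integrableZlR ((1 + A) ^+ (2 * d)) (@integrable_weight R d (2 * d) (leqnn _)))).
  apply/measurable_EFinP; apply: measurable_fun_ifT => //.
  apply: measurable_fun_ler => //; apply: continuous_measurable_rV.
  exact: continuous_rV_norm.
move=> x _; rewrite lee_fin (ger0_norm (box_fun_ge0 _ _)).
rewrite ger0_norm ?mulr_ge0 ?exprn_ge0 ?addr_ge0 ?weight_ge0// /box_fun.
case: ifPn => xA; last by rewrite mulr_ge0 ?exprn_ge0 ?addr_ge0 ?weight_ge0.
rewrite ler_pdivlMr ?exprn_gt0 ?ltr_pwDl// mul1r lerXn2r ?nnegrE ?addr_ge0//.
by rewrite lerD2l.
Qed.

Definition box_vol A : R := \int[lam]_x box_fun A x.

Lemma box_vol_ge0 A : 0 <= box_vol A.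
Proof. by apply: Rintegral_ge0 => x _; exact: box_fun_ge0. Qed.

(** Up to the normalising constant, the convolution kernel of the Fourier multiplier [u]. *)
Definition ftransform (u : V -> R) (z : V) : R[i] :=
  cintegral (fun xi => (u xi)%:C * expi (dotr z xi)).

Lemma cmeasurable_ftransform (u : V -> R) (z : V) : measurable_fun setT u ->
  cmeasurable (fun xi => (u xi)%:C * expi (dotr z xi)).
Proof.
move=> mu; apply: cmeasurableM; first exact: cmeasurable_real.
by apply: cmeasurable_expi; exact: measurable_dotrl.
Qed.

Lemma cmod_ftransform_le (u : V -> R) (A B : R) (z : V) : measurable_fun setT u ->
  (forall x, A < `|x| -> u x = 0) -> (forall x, `|u x| <= B) ->
  cintegrable (fun xi => (u xi)%:C * expi (dotr z xi)) /\
  cmod (ftransform u z) <= 2 * (B * box_vol A).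
Proof.
move=> mu uA uB; have mf := cmeasurable_ftransform z mu.
have fb xi : cmod ((u xi)%:C * expi (dotr z xi)) <= B * box_fun A xi.
  rewrite cmodM cmod_expi mulr1 cmod_real /box_fun.
  by case: (leP `|xi| A) => [_|/uA->]; rewrite ?mulr1// normr0 mulr0.
have ib : lam.-integrable setT (EFin \o (fun x => B * box_fun A x)).
  by apply: integrableZlR; exact: integrable_box_fun.
split; first exact: (cintegrable_le mf ib fb).
rewrite -RintegralZl//; last exact: integrable_box_fun.
exact: cmod_cintegral_le.
Qed.

(* Replacing [U] by [U - U (. + h e_i)] with [h = pi / z_i] doubles the transform,
   and by the mean value theorem the difference is [O(h)]: each such step gains a
   factor [1 / z_i]. *)
Lemma ftransform_decay (i : 'I_d) (z : V) (M : nat) (U : nat -> V -> R) (A B : R) :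
  1 <= `|z ord0 i| -> 0 <= B ->
  measurable_fun setT (U 0%N) -> (forall x, A < `|x| -> U 0%N x = 0) ->
  (exists K : R, forall x, `|U 0%N x| <= K) ->
  (forall k x, (k < M)%N -> is_derive x (delta_mx ord0 i : V) (U k) (U k.+1 x)) ->
  (forall x, `|U M x| <= B) ->
  cmod (ftransform (U 0%N) z) <=
    (pi / (2 * `|z ord0 i|)) ^+ M * (2 * (B * box_vol (A + M%:R * pi))).
Proof.
set e : V := delta_mx ord0 i.
move=> z1; elim: M U A B => [|M IH] U A B B0 mU UA [K UK] dU UB.
  rewrite expr0 mul1r mul0r addr0.
  by have [_] := cmod_ftransform_le z mU UA UB.
have z0 : z ord0 i != 0.
  by apply/eqP => z0; move: z1; rewrite z0 normr0 ler10.
pose h : R := pi / z ord0 i.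
have h_pi : `|h| <= pi.
  rewrite normrM normfV (gtr0_norm (pi_gt0 R)) -[leRHS]mulr1 ler_wpM2l ?pi_ge0//.
  by rewrite invf_le1// (lt_le_trans _ z1).
(* The differences form again a chain of derivatives, one shorter since the last derivative of [U]
   is spent on the mean value bound; the radius of the support grows by at most [pi]. An abstract
   chain [U] is used since [W] is no longer made of iterated derivatives of the original
   function. *)
pose W k x := U k x - U k (x + h *: e).
have mW : measurable_fun setT (W 0%N).
  apply: measurable_funB => //; apply: (measurableT_comp mU).
  have := @measurable_affine_rV R d 1 (h *: e).
  by apply: eq_measurable_fun => x _; rewrite scale1r.
have e1 : `|e| <= 1.
  apply: rV_norm_le => // j; rewrite mxE eqxx/=; case: eqP => _; rewrite ?normr1 ?normr0//.
have WA x : A + pi < `|x| -> W 0%N x = 0.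
  move=> xA; rewrite /W !UA ?subrr//.
    have := ler_normB (x + h *: e) (h *: e); rewrite addrK normrZ => H.
    have : `|h| * `|e| <= pi by rewrite -[leRHS]mulr1 ler_pM.
    by lra.
  by have := pi_ge0 R; lra.
have WK x : `|W 0%N x| <= K + K.
  by apply: (le_trans (ler_normB _ _)); exact: lerD.
have dW k x : (k < M)%N -> is_derive x e (W k) (W k.+1 x).
  move=> kM; apply: is_deriveB; first by apply: dU; exact: ltnW.
  by apply: is_derive_translate; apply: dU; exact: ltnW.
have WB x : `|W M x| <= `|h| * B.
  by apply: (le_increment (dw := U M.+1)) => // y; exact: dU.
have hB : 0 <= `|h| * B by rewrite mulr_ge0.
have := IH W (A + pi) (`|h| * B) hB mW WA (ex_intro _ _ WK) dW WB.
have [iU _] := cmod_ftransform_le z mU UA UK.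
have E : ftransform (W 0%N) z = (2%:R : R)%:C * ftransform (U 0%N) z.
  rewrite /ftransform.
  pose f xi := (U 0%N xi)%:C * expi (dotr z xi).
  have ia : cintegrable (fun xi => f (1 *: xi + h *: e)).
    exact: (cintegrable_affine (h *: e) ltr01 iU).
  have Ef : (fun xi => (W 0%N xi)%:C * expi (dotr z xi)) = (fun xi => f xi + f (1 *: xi + h *: e)).
    apply/funext => xi; rewrite /f /W scale1r dotrDr dotrZr.
    have -> : dotr z e = z ord0 i.
      rewrite /dotr (bigD1 i)//= mxE !eqxx mulr1 big1 ?addr0// => j ji.
      by rewrite mxE eqxx/= (negbTE ji) mulr0.
    rewrite /h mulfVK// expiD.
    have -> : expi (pi : R) = -1.
      by apply/eqP; rewrite eq_complex/= cospi sinpi oppr0 !eqxx.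
    by rewrite mulrN1 rmorphB/= mulrBl mulrN.
  rewrite Ef cintegralD// -/f.
  have := cintegral_affine (h *: e) ltr01 iU; rewrite expr1n mul1r -/f => <-.
  have -> : (2%:R : R)%:C = 1 + 1 :> R[i] by rewrite -[2%:R]/(1 + 1) rmorphD.
  by rewrite mulrDl !mul1r.
rewrite E cmodM cmod_real ger0_norm// => H.
have -> : (pi / (2 * `|z ord0 i|)) ^+ M.+1 * (2 * (B * box_vol (A + M.+1%:R * pi))) =
   2^-1 * ((pi / (2 * `|z ord0 i|)) ^+ M * (2 * (`|h| * B * box_vol (A + pi + M%:R * pi)))).
  rewrite /h normrM normfV (gtr0_norm (pi_gt0 R)).
  have -> : A + M.+1%:R * pi = A + pi + M%:R * pi by rewrite -[in LHS]natr1; ring.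
  rewrite exprS; move: (_ ^+ M) (box_vol _) => X Y.
  by field; rewrite normr_eq0.
lra.
Qed.

Lemma schwartz_le (f : V -> R[i]) (N : nat) : schwartz f ->
  exists2 K : R, 0 <= K & forall l x, (size l <= N)%N ->
    (1 + `|x|) ^+ N * cmod (cpderiv l f x) <= K.
Proof.
move=> [_ _ /(_ N)]; rewrite /schwartz_seminorm => H.
set S := (X in ereal_sup X) in H.
have ub l x : (size l <= N)%N -> (((1 + `|x|) ^+ N * cmod (cpderiv l f x))%:E <= ereal_sup S)%E.
  by move=> lN; apply: ereal_sup_ubound; exists l => //; exists x.
have S0 : (0 <= ereal_sup S)%E.
  apply: (le_trans _ (ub [::] 0 isT)); by rewrite lee_fin mulr_ge0 ?cmod_ge0.
have Sfin : ereal_sup S \is a fin_num by rewrite ge0_fin_numE.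
exists (fine (ereal_sup S)); first exact: fine_ge0.
by move=> l x lN; rewrite -lee_fin fineK// ub.
Qed.

Lemma test_fun_bounded_supp (th : V -> R) : test_fun th ->
  exists2 A : R, 0 < A & forall x, A < `|x| -> th x = 0.
Proof.
move=> [_ _ cs]; have [A [Ar AA]] := compact_bounded cs.
exists (`|A| + 1); first by rewrite ltr_wpDl.
move=> x xA; apply: contraPP (AA (`|A| + 1) _) => [/eqP thx|]; last first.
  by rewrite (le_lt_trans (ler_norm _))// ltrDl.
move=> /(_ x); apply/not_implyP; split; last by apply/negP; rewrite -ltNge.
by apply: subset_closure.
Qed.

Lemma test_fun_continuous (th : V -> R) : test_fun th -> continuous th.
Proof. by move=> [[s _ _] _ _]; case: (s [::]). Qed.

Lemma test_fun_bounded (th : V -> R) : test_fun th ->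
  exists2 K : R, 0 <= K & forall x, `|th x| <= K.
Proof.
move=> [s _ _]; have [K K0 H] := schwartz_le 0 s; exists K => // x.
by have := H [::] x isT; rewrite expr0 mul1r; apply: le_trans; exact: (le_Re_cmod (cpderiv [::] (fun x => (th x)%:C) x)).
Qed.

(** For [|z| >= 1], [M] derivatives in the direction of the largest coordinate of [z] give the
    decay, with [1 + |z| <= 2 * |z|]. For [|z| < 1] the trivial bound suffices, as the weight is
    then at least [2 ^- M]. The constant is the sum of those of the two cases. *)
Lemma kernel_decay (th : V -> R) (M : nat) : (0 < d)%N -> test_fun th ->
  exists2 C : R, 0 <= C & forall z, cmod (ftransform th z) <= C * weight M z.
Proof.
move=> d0 tth; have [s _ _] := tth; have [K K0 HK] := schwartz_le M s.
have [A A0 HA] := test_fun_bounded_supp tth.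
have mth : measurable_fun setT th.
  by apply: continuous_measurable_rV; exact: test_fun_continuous.
have KK l x : (size l <= M)%N -> `|pderiv l th x| <= K.
  move=> lM; apply: le_trans (HK l x lM).
  rewrite -[leLHS]mul1r ler_pM// ?exprn_ege1 ?lerDl//.
  exact: (le_Re_cmod (cpderiv l (fun x => (th x)%:C) x)).
have p0 := pi_ge0 R.
exists (pi ^+ M * (2 * (K * box_vol (A + M%:R * pi))) + 2 ^+ M * (2 * (K * box_vol A))).
  by rewrite addr_ge0// mulr_ge0 ?exprn_ge0// mulr_ge0// mulr_ge0// box_vol_ge0.
move=> z; have Kz := exprn_ge0 M p0.
have b1 : 0 <= 2 * (K * box_vol A) by rewrite mulr_ge0// mulr_ge0// box_vol_ge0.
have b2 : 0 <= 2 * (K * box_vol (A + M%:R * pi)) by rewrite mulr_ge0// mulr_ge0// box_vol_ge0.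
rewrite mulrDl; have [z1|z1] := leP 1 `|z|.
  have [i zi] := exists_rV_norm z d0.
  apply: (@le_trans _ _ (pi ^+ M * (2 * (K * box_vol (A + M%:R * pi))) * weight M z)); last first.
    by rewrite lerDl mulr_ge0 ?weight_ge0// mulr_ge0// exprn_ge0.
  pose U k := pderiv (nseq k i) th.
  have := @ftransform_decay i z M U A K; rewrite -zi => /(_ z1 K0 mth HA).
  have uK x : `|U 0%N x| <= K by exact: KK.
  move=> /(_ (ex_intro _ _ uK)) H.
  apply: (le_trans (H _ _)).
  - move=> k x kM; case: s => /(_ (nseq k i)) [_ ds] _ _.
    by apply: DeriveDef; [exact: ds|].
  - by move=> x; apply: KK; rewrite size_nseq.
  - rewrite [leRHS]mulrAC ler_wpM2r// /weight -exprVn -exprMn lerXn2r ?nnegrE.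
    + by [].
    + by rewrite divr_ge0// mulr_ge0.
    + by rewrite divr_ge0// addr_ge0.
    + rewrite ler_wpM2l// lef_pV2 ?posrE ?ltr_pwDl//; first lra.
      by rewrite mulr_gt0// (lt_le_trans _ z1).
have [_] := cmod_ftransform_le z mth HA (fun x => KK [::] x isT).
move=> H; apply: (le_trans H); apply: (@le_trans _ _ (2 ^+ M * (2 * (K * box_vol A)) * weight M z)); last first.
  by rewrite lerDr mulr_ge0 ?weight_ge0// mulr_ge0.
rewrite mulrAC -[leLHS]mul1r ler_wpM2r// ler_pdivlMr ?exprn_gt0 ?ltr_pwDl// mul1r.
by rewrite lerXn2r ?nnegrE ?addr_ge0//; lra.
Qed.

End kernel_decay.

Section normed_continuity.
Context (R : realType) (V : normedModType R).

Lemma continuous_affine (l : R) (a : V) : continuous (fun y : V => l *: y + a).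
Proof.
move=> y; apply: cvgD; last exact: cvg_cst.
by apply: cvgZ; [exact: cvg_cst|exact: cvg_id].
Qed.

Lemma lipschitz_continuous (f : V -> R) (L : R) :
  (forall x y, `|f x - f y| <= L * `|x - y|) -> continuous f.
Proof.
move=> fL x; apply/cvgrPdist_le => /= e e0.
have L1 : 0 < `|L| + 1 by rewrite ltr_wpDl.
near=> y.
apply: (le_trans (fL x y)); apply: (@le_trans _ _ ((`|L| + 1) * `|x - y|)).
  by rewrite ler_wpM2r// (le_trans (ler_norm _))// lerDl.
rewrite mulrC -ler_pdivlMr//.
near: y; apply/nbhs_normP => /=; exists (e / (`|L| + 1)); first by rewrite /= divr_gt0.
by move=> y /= /ltW.
Unshelve. all: by end_near. Qed.

End normed_continuity.

Section schwartz_scaling.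
Context (R : realType) (d : nat).
Local Notation V := 'rV[R]_d.

Lemma is_derive_lineP (w : V -> R) (x e : V) (t dw : R) :
  is_derive t (1 : R) (fun s : R => w (s *: e + x)) dw -> is_derive (t *: e + x) e w dw.
Proof.
have E : (fun h : R => h^-1 *: (((fun s => w (s *: e + x)) \o shift t) (h *: (1:R)) - w (t *: e + x))) =
         (fun h : R => h^-1 *: ((w \o shift (t *: e + x)) (h *: e) - w (t *: e + x))).
  apply/funext => h /=; rewrite addrA -scalerDl; do 4 f_equal.
  by rewrite /GRing.scale/= mulr1.
move=> [H1 H2].
by split; [move: H1|move: H2]; rewrite /derivable /derive ?E.
Qed.

Lemma is_derive_scale (w : V -> R) (x a e : V) (l dw : R) :
  is_derive (l *: x + a) e w dw -> is_derive x e (fun y => w (l *: y + a)) (l * dw).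
Proof.
move=> H.
have H0 : is_derive (0:R) (1:R) (fun s : R => w (s *: e + (l *: x + a))) dw.
  by apply: is_derive_line; rewrite scale0r add0r.
have H1 : is_derive (0:R) (1:R) (fun s : R => l * s) l.
  by apply: is_derive_eq (is_deriveM (is_derive_cst l (0:R) 1) (is_derive_id (0:R) 1)) _; rewrite scaler0 addr0; exact: mulr1.
have H2 : is_derive (0:R) (1:R) (fun s : R => w ((l * s) *: e + (l *: x + a))) (dw * l).
  apply: (@is_derive1_comp _ (fun s : R => w (s *: e + (l *: x + a))) (fun s => l * s)) => //.
  by rewrite mulr0.
have := @is_derive_lineP (fun y => w (l *: y + a)) x e 0 (l * dw).
rewrite scale0r add0r; apply; rewrite mulrC.
move: H2; congr is_derive; apply/funext => s.
by rewrite scalerDr scalerA addrA.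
Qed.

Lemma pderiv_scale (w : V -> R) (a : V) (l : R) (s : seq 'I_d) : smooth w ->
  pderiv s (fun y => w (l *: y + a)) = (fun y => l ^+ size s * pderiv s w (l *: y + a)).
Proof.
move=> sw; elim: s => [|i s IH] /=.
  by apply/funext => y; rewrite mul1r.
rewrite IH; apply/funext => y; have [_ ds] := sw s.
have D : is_derive y (delta_mx ord0 i : V) (fun y => pderiv s w (l *: y + a))
    (l * 'D_(delta_mx ord0 i) (pderiv s w) (l *: y + a)).
  by apply: is_derive_scale; apply: DeriveDef; [exact: ds|].
have := is_deriveZ (l ^+ size s) D => D'.
by rewrite (@derive_val _ _ _ _ _ _ _ D') /GRing.scale/= mulrA -exprSr.
Qed.

Lemma continuous_affine_rV (l : R) (a : V) : continuous (fun y : V => l *: y + a).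
Proof. exact: continuous_affine. Qed.

Lemma smooth_scale (w : V -> R) (a : V) (l : R) : smooth w ->
  smooth (fun y => w (l *: y + a)).
Proof.
move=> sw s; rewrite pderiv_scale//; have [cs ds] := sw s; split.
  move=> y; apply: (@continuous_comp _ _ _ (fun y : V => l *: y + a) (fun z => l ^+ size s * pderiv s w z)).
    exact: continuous_affine_rV.
  apply: (@continuous_comp _ _ _ (pderiv s w) (fun z => l ^+ size s * z)).
    exact: cs.
  exact: mulrl_continuous.
move=> i x.
have D : is_derive x (delta_mx ord0 i : V) (fun y => pderiv s w (l *: y + a))
    (l * 'D_(delta_mx ord0 i) (pderiv s w) (l *: x + a)).
  by apply: is_derive_scale; apply: DeriveDef; [exact: ds|].
by have [] := is_deriveZ (l ^+ size s) D.
Qed.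

Lemma pderiv_cst0 (s : seq 'I_d) : pderiv s (fun _ : V => 0 : R) = (fun=> 0).
Proof.
elim: s => //= i s ->; apply/funext => x.
exact: derive_cst.
Qed.

Lemma schwartz_scale (th : V -> R) (a : V) (l : R) : l != 0 ->
  schwartz (fun x => (th x)%:C) -> schwartz (fun x => (th (l *: x + a))%:C).
Proof.
move=> l0 sth; have [s1 s2 _] := sth.
split; [exact: smooth_scale|exact: s2|].
move=> N; have [K K0 HK] := schwartz_le N sth.
(* [c] compares the polynomial weights at [x] and at [l *: x + a]; [L] bounds the powers of [l]
   produced by the chain rule. *)
pose c := 1 + `|l|^-1 * (1 + `|a|).
pose L := 1 + `|l|.
have c0 : 0 <= c by rewrite addr_ge0// mulr_ge0 ?invr_ge0// addr_ge0.
have cx x : 1 + `|x| <= c * (1 + `|l *: x + a|).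
  have h : `|x| <= `|l|^-1 * (`|l *: x + a| + `|a|).
    rewrite ler_pdivlMl ?normr_gt0// -normrZ.
    by have := ler_normB (l *: x + a) a; rewrite addrK.
  rewrite /c; apply: (le_trans (_ : _ <= 1 + `|l|^-1 * (`|l *: x + a| + `|a|))); first by rewrite lerD2l.
  have : 0 <= `|l|^-1 by rewrite invr_ge0.
  move: (normr_ge0 (l *: x + a)) (normr_ge0 a); move: `|_ + _| `|a| `|l|^-1 => u v w u0 v0 w0.
  by have := mulr_ge0 w0 (mulr_ge0 u0 v0); nra.
apply: (@le_lt_trans _ _ (c ^+ N * (L ^+ N * K))%:E); last exact: ltry.
apply: ge_ereal_sup => _ [s sN] [x _] <-; rewrite lee_fin.
have E : cpderiv s (fun x => (th (l *: x + a))%:C) x = (l ^+ size s)%:C * cpderiv s (fun x => (th x)%:C) (l *: x + a).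
  rewrite /cpderiv.
  have -> : Re_fun (fun x => (th (l *: x + a))%:C) = (fun y => th (l *: y + a)) by [].
  rewrite pderiv_scale//.
  have -> : Im_fun (fun x => (th (l *: x + a))%:C) = (fun=> 0) by [].
  have -> : Im_fun (fun x : V => (th x)%:C) = (fun=> 0) by [].
  rewrite pderiv_cst0; apply/eqP; rewrite eq_complex/=.
  by rewrite !(mulr0, mul0r, subr0, addr0) !eqxx.
rewrite E cmodM cmod_real normrX.
apply: (@le_trans _ _ ((c * (1 + `|l *: x + a|)) ^+ N * (L ^+ N * cmod (cpderiv s (fun x => (th x)%:C) (l *: x + a))))).
  apply: ler_pM.
  - by rewrite exprn_ge0// addr_ge0.
  - by rewrite mulr_ge0 ?exprn_ge0 ?cmod_ge0.
  - by rewrite lerXn2r ?nnegrE ?addr_ge0 ?mulr_ge0// addr_ge0.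
  - rewrite ler_wpM2r ?cmod_ge0//.
    apply: (@le_trans _ _ (L ^+ size s)).
      by rewrite lerXn2r ?nnegrE ?addr_ge0// lerDr.
    by rewrite ler_weXn2l// lerDl.
rewrite exprMn -mulrA ler_wpM2l ?exprn_ge0// mulrCA ler_wpM2l ?exprn_ge0 ?addr_ge0//.
exact: HK.
Qed.

End schwartz_scaling.

Section integrable_schwartz.
Context (R : realType) (d : nat).
Local Notation V := 'rV[R]_d.

Lemma cmeasurable_continuous (f : V -> R[i]) :
  continuous (Re_fun f) -> continuous (Im_fun f) -> cmeasurable f.
Proof. by move=> f1 f2; split; exact: continuous_measurable_rV. Qed.

Lemma cmeasurable_schwartz (f : V -> R[i]) : schwartz f -> cmeasurable f.
Proof.
move=> [s1 s2 _]; apply: cmeasurable_continuous; first by case: (s1 [::]).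
by case: (s2 [::]).
Qed.

Lemma cpderiv_nil (f : V -> R[i]) x : cpderiv [::] f x = f x.
Proof. by rewrite /cpderiv /= /Re_fun /Im_fun; case: (f x). Qed.

Lemma schwartz_bounded (f : V -> R[i]) : schwartz f ->
  exists K : R, forall x, cmod (f x) <= K.
Proof.
move=> sf; have [K K0 HK] := schwartz_le 0 sf; exists K => x.
by have := HK [::] x isT; rewrite cpderiv_nil mul1r.
Qed.

Lemma cintegrable_schwartz (f : V -> R[i]) : schwartz f -> cintegrable f.
Proof.
move=> sf; have [K K0 HK] := schwartz_le (2 * d) sf.
apply: (cintegrable_le (cmeasurable_schwartz sf) (integrableZlR K (@integrable_weight R d _ (leqnn (2 * d))))).
move=> x; rewrite ler_pdivlMr ?exprn_gt0 ?ltr_pwDl//.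
by have := HK [::] x isT; rewrite cpderiv_nil mulrC.
Qed.

Lemma lipschitz_continuous_rV (f : V -> R) (L : R) :
  (forall x y, `|f x - f y| <= L * `|x - y|) -> continuous f.
Proof. exact: lipschitz_continuous. Qed.

Lemma clipschitz (f : V -> R[i]) (L : R) :
  (forall x y, cmod (f x - f y) <= L * `|x - y|) ->
  continuous (Re_fun f) /\ continuous (Im_fun f).
Proof.
move=> fL; split; apply: (@lipschitz_continuous_rV _ L) => x y.
  apply: le_trans (fL x y); apply: le_trans (le_Re_cmod _).
  by rewrite /Re_fun; case: (f x); case: (f y).
apply: le_trans (fL x y); apply: le_trans (le_Im_cmod _).
by rewrite /Im_fun; case: (f x); case: (f y).
Qed.

Lemma cos_lipschitz (a b : R) : `|cos a - cos b| <= `|a - b|.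
Proof.
wlog ab : a b / a <= b.
  by move=> H; have [|/ltW ba] := leP a b; [exact: H|rewrite distrC (distrC a); exact: H].
rewrite distrC (distrC a).
have [|c _ ->] := @MVT_segment R cos (fun x => - sin x) a b ab.
  by apply: continuous_subspaceT; exact: continuous_cos.
by rewrite normrM normrN -[leRHS]mul1r ler_wpM2r// sin_max.
Qed.

Lemma sin_lipschitz (a b : R) : `|sin a - sin b| <= `|a - b|.
Proof.
wlog ab : a b / a <= b.
  by move=> H; have [|/ltW ba] := leP a b; [exact: H|rewrite distrC (distrC a); exact: H].
rewrite distrC (distrC a).
have [|c _ ->] := @MVT_segment R sin (fun x => cos x) a b ab.
  by apply: continuous_subspaceT; exact: continuous_sin.
by rewrite normrM -[leRHS]mul1r ler_wpM2r// cos_max.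
Qed.

Lemma expi_lipschitz (a b : R) : cmod (expi a - expi b) <= 2 * `|a - b|.
Proof.
apply: (le_trans (cmod_le _)); rewrite /expi/=.
by have := cos_lipschitz a b; have := sin_lipschitz a b; lra.
Qed.

Lemma cintegrableZl (c : R[i]) (f : V -> R[i]) : cintegrable f ->
  cintegrable (fun x => c * f x).
Proof.
move=> fi; rewrite (_ : (fun x => _) = (fun x => f x * c)).
  by apply: (cintegrableM fi (K := cmod c)) => //; split; exact: measurable_cst.
by apply/funext => x; rewrite mulrC.
Qed.

Lemma cintegrableB (f g : V -> R[i]) : cintegrable f -> cintegrable g ->
  cintegrable (fun x => f x - g x).
Proof.
move=> fi /(cintegrableZl (-1)) gi; have := cintegrableD fi gi.
by under eq_fun do rewrite mulN1r.
Qed.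

Lemma cintegralB (f g : V -> R[i]) : cintegrable f -> cintegrable g ->
  cintegral (fun x => f x - g x) = cintegral f - cintegral g.
Proof.
move=> fi gi; have gi' := cintegrableZl (-1) gi.
have -> : (fun x => f x - g x) = (fun x => f x + (-1) * g x).
  by apply/funext => x; rewrite mulN1r.
by rewrite cintegralD// cintegralZl// mulN1r.
Qed.

(** On the bounded support of [th] the phases are Lipschitz in the point, uniformly in the
    frequency. Unlike mere continuity, this property passes directly to the convolution with an
    integrable function. *)
Lemma ftransform_lipschitz (th : V -> R) : test_fun th ->
  exists L : R, forall x y, cmod (ftransform th x - ftransform th y) <= L * `|x - y|.
Proof.
move=> tth; have [A A0 HA] := test_fun_bounded_supp tth.
have [K K0 HK] := test_fun_bounded tth.
have mth : measurable_fun setT th by apply: continuous_measurable_rV; exact: test_fun_continuous.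
exists (2 * (K * (2 * (d%:R * A)) * box_vol d A)) => x y.
have [ix _] := cmod_ftransform_le x mth HA HK.
have [iy _] := cmod_ftransform_le y mth HA HK.
rewrite /ftransform -cintegralB//.
apply: (le_trans (@cmod_cintegral_le _ _ _ (fun xi => (K * (2 * (d%:R * A)) * `|x - y|) * box_fun A xi) _ _ _)).
- exact: cintegrable_cmeasurable (cintegrableB ix iy).
- by apply: integrableZlR; exact: integrable_box_fun.
- move=> xi; rewrite -mulrBr cmodM cmod_real /box_fun.
  case: (leP `|xi| A) => [xA|/HA->]; last by rewrite normr0 mul0r mulr0.
  rewrite mulr1 -!mulrA; apply: ler_pM; rewrite ?cmod_ge0//.
  apply: (le_trans (expi_lipschitz _ _)); rewrite ler_wpM2l//.
  rewrite -dotrBl; apply: (le_trans (le_dotr _ _)).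
  by rewrite ler_wpM2l// mulrC ler_wpM2r.
- by rewrite RintegralZl//; [rewrite /box_vol; lra|exact: integrable_box_fun].
Qed.

End integrable_schwartz.

Section positivity.
Context (R : realType).

Lemma continuous_pos_ball (V : normedModType R) (f : V -> R) (x0 : V) :
  continuous f -> 0 < f x0 ->
  exists2 e : R, 0 < e & forall x, `|x - x0| < e -> f x0 / 2 < f x.
Proof.
move=> cf fx0; have /cvgrPdist_lt := cf x0 => /(_ _ (divr_gt0 fx0 (ltr0n R 2))).
move=> /nbhs_normP[e /= e0 H]; exists e => // x xe.
have := H x; rewrite /= distrC => /(_ xe); rewrite ltr_norml => /andP[_ h]; lra.
Qed.

Lemma continuous_sub (V : normedModType R) (f g : V -> R) :
  continuous f -> continuous g -> continuous (fun x => f x - g x).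
Proof. by move=> cf cg x; apply: cvgB; [exact: cf|exact: cg]. Qed.

Lemma continuous_const (V : normedModType R) (c : R) : continuous (fun _ : V => c).
Proof. by move=> x; exact: cvg_cst. Qed.

Lemma rV_continuous_pos_ball d (f : 'rV[R]_d -> R) (x0 : 'rV[R]_d) :
  continuous f -> 0 < f x0 ->
  exists2 e : R, 0 < e & forall x, `|x - x0| < e -> f x0 / 2 < f x.
Proof. exact: continuous_pos_ball. Qed.

Lemma box_volE d (A : R) : 0 <= A -> box_vol d A = (2 * A) ^+ d.
Proof.
move=> A0; rewrite /box_vol /Rintegral.
pose g : R -> R := \1_(`[(- A : R), A]%classic : set R).
have AA : - A <= A by rewrite ge0_cp.
have gI : (\int[lebesgue_measure]_x (g x)%:E = (2 * A)%:E)%E.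
  have := Rintegral_indic_itv AA; rewrite opprK /Rintegral => E.
  rewrite mulr_natl mulr2n -E fineK//.
  exact: (integrable_fin_num measurableT (integrable_indic_itv _ _ _ _)).
rewrite -[RHS]/(fine ((2 * A) ^+ d)%:E) -(ge0_integral_prod_rV d _ _ gI).
- congr fine; apply: eq_integral => x _; congr EFin.
  rewrite /box_fun; case: ifPn => [xA|].
    rewrite big1// => i _; rewrite /g indicE mem_set//= in_itv/= -ler_norml.
    exact: le_trans (le_rV_norm _ _) xA.
  rewrite -ltNge => xA.
  have d0 : (0 < d)%N.
    rewrite lt0n; apply/eqP => d0; move: xA; subst d.
    have -> : x = 0 by apply/rowP => -[].
    by rewrite normr0 ltNge A0.
  have [i xi] := exists_rV_norm x d0.
  rewrite (bigD1 i)//= /g indicE memNset ?mul0r//= in_itv/= -ler_norml -xi.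
  by apply/negP; rewrite -ltNge.
- exact: measurable_indic.
- by move=> x; rewrite /g indicE.
Qed.

End positivity.

(** * Blocks of distributions given by integrable functions *)

Section representation.
Context (R : realType) (d : nat).
Local Notation V := 'rV[R]_d.
Local Notation lam := (lebesgue_rV R d).

Let bump_separates_pos (th u : V -> R) (x0 : V) : test_fun th -> 0 < th 0 -> continuous u ->
  (forall l a, 0 < l -> lam.-integrable setT (EFin \o (fun x => u x * th (l *: x + a))) /\
     \int[lam]_x (u x * th (l *: x + a)) = 0) -> 0 < u x0 -> False.
Proof.
move=> tth th0 cu H ux0.
have [e e0 He] := rV_continuous_pos_ball cu ux0.
have [r r0 Hr] := rV_continuous_pos_ball (test_fun_continuous tth) th0.
have [A A0 HA] := test_fun_bounded_supp tth.
have [_ thp _] := tth.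
(* With this [l] the rescaled [th] lives within distance [e / 2] of [x0], where [u] exceeds half of
   [u x0]. On the smaller box where [th] exceeds half of [th 0] the product is at least [c], so its
   integral is positive. *)
pose l := A / e * 2; have l0 : 0 < l by rewrite mulr_gt0// divr_gt0.
have [iu] := H l (- (l *: x0)) l0.
pose c := u x0 / 2 * (th 0 / 2).
have c0 : 0 < c by rewrite mulr_gt0// divr_gt0.
have ibox := integrable_affine (- (l *: x0)) l0 (integrable_box_fun d (r / 2)).
have ib : lam.-integrable setT (EFin \o (fun x => c * box_fun (r / 2) (l *: x - l *: x0))).
  exact: (integrableZlR c ibox).
have : \int[lam]_x (c * box_fun (r / 2) (l *: x - l *: x0)) <= \int[lam]_x (u x * th (l *: x - l *: x0)).
  apply: le_Rintegral => // x _.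
  have [thx|thx] := eqVneq (th (l *: x - l *: x0)) 0.
    rewrite thx mulr0 /box_fun; case: ifPn => [xr|]; last by rewrite mulr0.
    have := Hr (l *: x - l *: x0); rewrite subr0 thx => /(_ _).
    have xr' : `|l *: x - l *: x0| < r by apply: (le_lt_trans xr); lra.
    move=> /(_ xr'); lra.
  have ux : u x0 / 2 < u x.
    apply: He; have : `|l *: x - l *: x0| <= A.
      by rewrite leNgt; apply/negP => /HA /eqP; rewrite (negbTE thx).
    rewrite -scalerBr normrZ (gtr0_norm l0) -ler_pdivlMl// => /le_lt_trans; apply.
    rewrite /l invfM invf_div (_ : _ * A = 2^-1 * e); first by lra.
    by field; rewrite gt_eqF.
  rewrite /c -mulrA; apply: ler_pM; rewrite ?mulr_ge0 ?box_fun_ge0 ?divr_ge0 ?(ltW ux0) ?(ltW th0) ?(ltW ux)//.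
  rewrite /box_fun; case: ifPn => [xr|_]; last by rewrite mulr0 thp.
  rewrite mulr1; have := Hr (l *: x - l *: x0); rewrite subr0 => h; apply/ltW/h.
  apply: (le_lt_trans xr); lra.
move=> + h0; rewrite h0 RintegralZl//.
have := box_volE d (ltW (divr_gt0 r0 (ltr0n R 2))).
rewrite /box_vol /Rintegral (integral_affine (- (l *: x0)) l0 (integrable_box_fun d (r / 2))).
rewrite fineM//; last exact: integrable_fin_num ibox.
move=> /= E.
have p : 0 < \int[lam]_x (box_fun (r / 2) (l *: x - l *: x0)).
  rewrite -(pmulr_rgt0 _ (exprn_gt0 d l0)) /Rintegral E exprn_gt0//.
  by rewrite mulr_gt0// divr_gt0.
by rewrite leNgt mulr_gt0.
Qed.

Lemma bump_separates (th u : V -> R) : test_fun th -> 0 < th 0 -> continuous u ->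
  (forall l a, 0 < l -> lam.-integrable setT (EFin \o (fun x => u x * th (l *: x + a))) /\
     \int[lam]_x (u x * th (l *: x + a)) = 0) -> forall x, u x = 0.
Proof.
move=> tth th0 cu H x0; apply/eqP; rewrite eq_le !leNgt; apply/andP; split; apply/negP => h.
  exact: (bump_separates_pos tth th0 cu H h).
have cu' : continuous (fun x => - u x).
  by move=> x; apply: (@continuous_comp _ _ _ u -%R); [exact: cu|exact: oppr_continuous].
apply: (@bump_separates_pos th (fun x => - u x) x0) => //; last by rewrite oppr_gt0.
move=> l a l0; have [i e] := H l a l0.
have E : (fun x => - u x * th (l *: x + a)) = (fun x => (-1) * (u x * th (l *: x + a))).
  by apply/funext => x; rewrite mulN1r mulNr.
rewrite E; split; first exact: integrableZlR.
by rewrite RintegralZl// e mulr0.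
Qed.

(* The rescaled copies of [th] around a point are test functions that separate two
   distinct continuous functions. *)
Lemma represents_unique (th : V -> R) (h h' : V -> R[i]) (T : functional R d) :
  test_fun th -> 0 < th 0 -> represents h T -> represents h' T -> h = h'.
Proof.
move=> tth th0 [c1 c2 H] [c1' c2' H'].
have [sth _ _] := tth.
have sc l a : 0 < l -> schwartz (fun x => (th (l *: x + a))%:C).
  by move=> l0; apply: schwartz_scale => //; rewrite gt_eqF.
(* [P] stands for the real or the imaginary part; the test functions are real, so the two parts
   separate. *)
have key (P : R[i] -> R) (g g' : V -> R) :
    (forall z (t : R), P (z * t%:C) = P z * t) ->
    (forall x, g x = P (h x)) -> (forall x, g' x = P (h' x)) ->
    continuous g -> continuous g' ->
    (forall f : V -> R[i], cintegrable f -> lam.-integrable setT (EFin \o (fun x => P (f x)))) ->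
    (forall f : V -> R[i], P (cintegral f) = \int[lam]_x P (f x)) ->
    forall x, g x = g' x.
  move=> PM gE gE' cg cg' Pi Pint x; apply/eqP; rewrite -subr_eq0; apply/eqP.
  apply: (@bump_separates th (fun x => g x - g' x)) => //.
    exact: (@continuous_sub _ V).
  move=> l a l0; have [i1 e1] := H _ (sc l a l0); have [i2 e2] := H' _ (sc l a l0).
  have j1 := Pi _ i1; have j2 := Pi _ i2.
  have E : (fun x => (g x - g' x) * th (l *: x + a)) =
     (fun x => P (h x * (th (l *: x + a))%:C) - P (h' x * (th (l *: x + a))%:C)).
    by apply/funext => y; rewrite !PM -gE -gE' mulrBl.
  rewrite E; split; first exact: (integrableB measurableT j1 j2).
  by rewrite RintegralB// -!Pint -e1 -e2 subrr.
apply/funext => x; apply/eqP; rewrite eq_complex; apply/andP; split; apply/eqP.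
  apply: (@key (@complex.Re R) (Re_fun h) (Re_fun h')) => //.
    by move=> [a b] t /=; rewrite mulr0 subr0.
  by move=> f [].
apply: (@key (@complex.Im R) (Im_fun h) (Im_fun h')) => //.
  by move=> [a b] t /=; rewrite mulr0 add0r.
by move=> f [].
Qed.

(** By uniqueness the choice in the definition can only return the representative at hand. *)
Lemma fun_of_distE (th : V -> R) (h : V -> R[i]) (T : functional R d) :
  test_fun th -> 0 < th 0 -> represents h T -> fun_of_dist T = h.
Proof.
move=> tth th0 hT; apply: (represents_unique tth th0 _ hT).
have := @xgetPex _ (fun=> 0) [set h | represents h T]; apply.
by exists h.
Qed.

(** True for every functional, represented or not, because the default value 0 is continuous too.
    The resulting measurability of the blocks is all that the positive embeddings require of
    them. *)
Lemma continuous_fun_of_dist (T : functional R d) :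
  continuous (Re_fun (fun_of_dist T)) /\ continuous (Im_fun (fun_of_dist T)).
Proof.
rewrite /fun_of_dist; case: xgetP => [h -> [c1 c2 _]|_]; first by split.
by split; exact: (@continuous_const _ V).
Qed.

Lemma measurable_lp_block (eta0 eta : V -> R) f j :
  measurable_fun setT (fun x => cmod (lp_block eta0 eta f j x)).
Proof.
have [c1 c2] := continuous_fun_of_dist
  (dist_inv_fourier (dist_mul (eta_ eta0 eta j) (dist_fourier f))).
by apply: measurable_cmod; exact: cmeasurable_continuous.
Qed.

Definition dist_of (F : V -> R[i]) : functional R d := fun phi => cintegral (fun x => F x * phi x).

Lemma tempered_dist_of (F : V -> R[i]) : cintegrable F -> tempered (dist_of F).
Proof.
move=> Fi.
have iF phi : schwartz phi -> cintegrable (fun x => F x * phi x).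
  move=> sp; have [K HK] := schwartz_bounded sp.
  exact: (cintegrableM Fi (cmeasurable_schwartz sp) HK).
split.
  move=> a phi psi sphi spsi; rewrite /dist_of.
  have -> : (fun x => F x * (a * phi x + psi x)) = (fun x => a * (F x * phi x) + F x * psi x).
    by apply/funext => x; rewrite mulrDr mulrCA.
  rewrite cintegralD//; [by rewrite cintegralZl//; exact: iF|apply: cintegrableZl; exact: iF|exact: iF].
move=> phi sphi e e0.
have iC := cintegrable_cmod Fi.
pose I := \int[lam]_x cmod (F x).
have I0 : 0 <= I by apply: Rintegral_ge0 => x _; exact: cmod_ge0.
(* The seminorm of order 0 bounds the supremum. The 2 is the loss in [cmod_cintegral_le], and
   [I + 1] avoids dividing by [I = 0]. *)
exists 0%N, (e / (2 * (I + 1))); split; first by rewrite divr_gt0// mulr_gt0// ltr_wpDl.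
move=> psi spsi; set D := _ / _ => hD.
have dlt x : cmod (psi x - phi x) <= D.
  rewrite -lee_fin; apply/ltW; apply: le_lt_trans hD.
  apply: ereal_sup_ubound; exists [::] => //; exists x => //.
  by rewrite expr0 mul1r cpderiv_nil.
rewrite /dist_of -cintegralB; [|exact: iF..].
apply: (@le_lt_trans _ _ (2 * \int[lam]_x (D * cmod (F x)))).
  apply: cmod_cintegral_le.
  - by apply: cintegrable_cmeasurable; apply: cintegrableB; exact: iF.
  - exact: integrableZlR.
  - by move=> x; rewrite -mulrBr cmodM mulrC ler_wpM2r// cmod_ge0.
rewrite RintegralZl// -/I /D (_ : 2 * _ = e * (I / (I + 1))); last by field; rewrite gt_eqF// ltr_wpDl.
by rewrite -[ltRHS]mulr1 ltr_pM2l// ltr_pdivrMr ?ltr_wpDl// mul1r ltrDl.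
Qed.

Definition fourier_const : R[i] := ((2 * pi) `^ (- (d%:R / 2)))%:C.

Lemma measurable_ftransform_sub (th : V -> R) : test_fun th ->
  cmeasurable (fun z : V * V => ftransform th (z.2 - z.1)).
Proof.
move=> tth; have [L HL] := ftransform_lipschitz tth; have [c1 c2] := clipschitz HL.
have mf : cmeasurable (ftransform th) by exact: cmeasurable_continuous.
have ms : measurable_fun setT (fun z : V * V => z.2 - z.1 : V).
  have : measurable_fun setT (fun z : V * V => (z.2, z.1)).
    by apply: measurable_fun_pair; [exact: measurable_snd|exact: measurable_fst].
  exact: measurableT_comp (@measurable_subrV R d).
exact: (cmeasurable_comp mf ms).
Qed.

Lemma ftransform_bounded (th : V -> R) : test_fun th ->
  exists K : R, forall z, cmod (ftransform th z) <= K.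
Proof.
move=> tth; have [A A0 HA] := test_fun_bounded_supp tth.
have [K K0 HK] := test_fun_bounded tth.
have mth : measurable_fun setT th by apply: continuous_measurable_rV; exact: test_fun_continuous.
by exists (2 * (K * box_vol d A)) => z; have [_] := cmod_ftransform_le z mth HA HK.
Qed.

Lemma cintegrable_test (th : V -> R) : test_fun th -> cintegrable (fun x => (th x)%:C).
Proof. by move=> [s _ _]; exact: cintegrable_schwartz. Qed.

Lemma dotrC (x y : V) : dotr x y = dotr y x.
Proof. by apply: eq_bigr => i _; rewrite mulrC. Qed.

Lemma cintegrable_expi (f : V -> R[i]) (x : V) : cintegrable f ->
  cintegrable (fun y => f y * expi (dotr x y)).
Proof.
move=> fi; apply: (cintegrableM fi (K := 1)); last by move=> y; rewrite cmod_expi.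
by apply: cmeasurable_expi; exact: measurable_dotrl.
Qed.

(** Fubini's theorem merges the exponentials of the two transforms into one, whose integral against
    [th] is the kernel at [y - x]; no inversion formula enters. *)
Lemma fourier_block (th : V -> R) (phi : V -> R[i]) x : test_fun th -> schwartz phi ->
  fourier (fun xi => (th xi)%:C * inv_fourier phi xi) x =
  cintegral (fun y => (fourier_const ^+ 2 * phi y) * ftransform th (y - x)).
Proof.
move=> tth sphi; have phii := cintegrable_schwartz sphi.
have ti := cintegrable_test tth.
rewrite /fourier -/fourier_const.
pose k (z : V * V) := expi (dotr z.1 z.2 - dotr z.1 x).
have mk : cmeasurable k.
  apply: cmeasurable_expi; apply: measurable_funB; first exact: measurable_dotr.
  have := measurableT_comp (@measurable_dotrl R d x) (@measurable_fst _ _ V V).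
  by apply: eq_measurable_fun => y _; rewrite /= dotrC.
have kK z : cmod (k z) <= 1 by rewrite cmod_expi.
have ci : cintegrable (fun y => fourier_const * phi y) by exact: cintegrableZl.
have -> : (fun xi => expi (- dotr xi x) * ((th xi)%:C * inv_fourier phi xi)) =
   (fun xi => (th xi)%:C * cintegral (fun y => (fourier_const * phi y) * k (xi, y))).
  apply/funext => xi; rewrite mulrCA; congr (_ * _).
  rewrite /inv_fourier -/fourier_const mulrA -cintegralZl; last first.
    have := cintegrable_expi xi phii.
    by rewrite (_ : (fun y => phi y * _) = (fun y => expi (dotr xi y) * phi y))//; apply/funext => y; rewrite mulrC.
  congr cintegral; apply/funext => y; rewrite /k/= addrC expiD; ring.
rewrite (cfubini ti ci mk kK) -cintegralZl.
  congr cintegral; apply/funext => y.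
  have -> : cintegral (fun xi => (th xi)%:C * k (xi, y)) = ftransform th (y - x).
    congr cintegral; apply/funext => xi; rewrite /k/=; congr (_ * expi _).
    by rewrite dotrBl dotrC (dotrC x).
  by rewrite expr2; ring.
have [L HL] := ftransform_lipschitz tth; have [c1 c2] := clipschitz HL.
have [K HK] := ftransform_bounded tth.
rewrite (_ : (fun y => _) = (fun y => (fourier_const * phi y) * ftransform th (1 *: y - x))).
  apply: (cintegrableM ci (K := K)); last by move=> y; exact: HK.
  have mf : cmeasurable (ftransform th) by exact: cmeasurable_continuous.
  exact: (cmeasurable_comp mf (measurable_affine_rV 1 (- x))).
apply/funext => y; rewrite scale1r; congr (_ * _); congr cintegral.
apply/funext => xi; rewrite /k/=; congr (_ * expi _).
by rewrite dotrBl dotrC (dotrC x).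
Qed.

(** The multiplier [th] applied to [F], in convolution form: the explicit candidate for the block of
    [dist_of F]. *)
Definition block_fun (th : V -> R) (F : V -> R[i]) (y : V) : R[i] :=
  fourier_const ^+ 2 * cintegral (fun x => F x * ftransform th (y - x)).

Lemma dist_of_block (th : V -> R) (F phi : V -> R[i]) : test_fun th ->
  cintegrable F -> schwartz phi ->
  dist_inv_fourier (dist_mul th (dist_fourier (dist_of F))) phi =
  cintegral (fun y => block_fun th F y * phi y).
Proof.
move=> tth Fi sphi; have phii := cintegrable_schwartz sphi.
have [K HK] := ftransform_bounded tth.
have ci : cintegrable (fun y => fourier_const ^+ 2 * phi y) by exact: cintegrableZl.
rewrite /dist_inv_fourier /dist_mul /dist_fourier /dist_of.
under eq_fun do rewrite fourier_block//.
rewrite (cfubini Fi ci (measurable_ftransform_sub tth) (K := K))//=.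
by congr cintegral; apply/funext => y; rewrite /block_fun; ring.
Qed.

Lemma cintegrable_ftransform (th : V -> R) (F : V -> R[i]) (y : V) : test_fun th ->
  cintegrable F -> cintegrable (fun x => F x * ftransform th (y - x)).
Proof.
move=> tth Fi; have [K HK] := ftransform_bounded tth.
apply: (cintegrableM Fi (K := K)); last by move=> x.
exact: (cmeasurable_comp (measurable_ftransform_sub tth) (measurable_pair2 y)).
Qed.

Lemma represents_block (th : V -> R) (F : V -> R[i]) : test_fun th -> cintegrable F ->
  represents (block_fun th F) (dist_inv_fourier (dist_mul th (dist_fourier (dist_of F)))).
Proof.
move=> tth Fi.
have [L HL] := ftransform_lipschitz tth.
have iC := cintegrable_cmod Fi.
have I0 : 0 <= \int[lam]_x cmod (F x) by apply: Rintegral_ge0 => x _; exact: cmod_ge0.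
have HB y y' : cmod (block_fun th F y - block_fun th F y') <=
    (cmod (fourier_const ^+ 2) * (2 * (L * \int[lam]_x cmod (F x)))) * `|y - y'|.
  rewrite /block_fun -mulrBr cmodM -mulrA ler_wpM2l ?cmod_ge0//.
  rewrite -cintegralB; [|exact: cintegrable_ftransform..].
  rewrite (_ : _ * `|_| = 2 * \int[lam]_x (L * `|y - y'| * cmod (F x))); last first.
    by rewrite RintegralZl//; ring.
  apply: cmod_cintegral_le.
  - by apply: cintegrable_cmeasurable; apply: cintegrableB; exact: cintegrable_ftransform.
  - exact: integrableZlR.
  - move=> x; rewrite -mulrBr cmodM mulrC ler_wpM2r ?cmod_ge0//.
    by apply: (le_trans (HL _ _)); rewrite opprB addrA subrK.
have [c1 c2] := clipschitz HB; split => // phi sphi; split; last exact: dist_of_block.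
have mb : cmeasurable (block_fun th F) by exact: cmeasurable_continuous.
have [K HK] := ftransform_bounded tth.
rewrite (_ : (fun x => _) = (fun x => phi x * block_fun th F x)); last first.
  by apply/funext => x; rewrite mulrC.
apply: (cintegrableM (cintegrable_schwartz sphi) mb
  (K := cmod (fourier_const ^+ 2) * (2 * \int[lam]_x (K * cmod (F x))))).
move=> y; rewrite /block_fun cmodM ler_wpM2l ?cmod_ge0//.
apply: cmod_cintegral_le.
- by apply: cintegrable_cmeasurable; exact: cintegrable_ftransform.
- exact: integrableZlR.
- by move=> x; rewrite cmodM mulrC ler_wpM2r ?cmod_ge0.
Qed.

(** The convolution form serves for upper bounds. This form on the frequency side shows when a block
    vanishes and bounds it from below. *)
Lemma block_frequency (th : V -> R) (F : V -> R[i]) (y : V) : test_fun th -> cintegrable F ->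
  block_fun th F y = fourier_const ^+ 2 *
    cintegral (fun xi => (th xi)%:C * cintegral (fun x => F x * expi (dotr (y - x) xi))).
Proof.
move=> tth Fi.
pose k (z : V * V) := expi (dotr (y - z.1) z.2).
have mk : cmeasurable k.
  apply: cmeasurable_expi.
  have m1 : measurable_fun setT (fun z : V * V => (y - z.1, z.2)).
    apply: measurable_fun_pair; last exact: measurable_snd.
    have m2 : measurable_fun setT (fun z : V * V => (y, z.1)).
      by apply: measurable_fun_pair => //; exact: measurable_fst.
    exact: (measurableT_comp (@measurable_subrV R d) m2).
  exact: (measurableT_comp (@measurable_dotr R d) m1).
have kK z : cmod (k z) <= 1 by rewrite cmod_expi.
by rewrite /block_fun -(cfubini Fi (cintegrable_test tth) mk kK).
Qed.

Lemma block_fun_sum (th : V -> R) n (F : 'I_n -> V -> R[i]) (y : V) : test_fun th ->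
  (forall i, cintegrable (F i)) ->
  block_fun th (fun x => \sum_(i < n) F i x) y = \sum_(i < n) block_fun th (F i) y.
Proof.
move=> tth Fi; rewrite /block_fun -mulr_sumr -cintegral_sum; last first.
  by move=> i; exact: cintegrable_ftransform.
by congr (_ * cintegral _); apply/funext => x; rewrite mulr_suml.
Qed.

Lemma block_funZ (th : V -> R) (c : R[i]) (F : V -> R[i]) (y : V) : test_fun th ->
  cintegrable F -> block_fun th (fun x => c * F x) y = c * block_fun th F y.
Proof.
move=> tth Fi; rewrite /block_fun [RHS]mulrCA.
have <- := cintegralZl c (cintegrable_ftransform y tth Fi).
have -> : (fun x => c * F x * ftransform th (y - x)) = (fun x => c * (F x * ftransform th (y - x))).
  by apply/funext => x; rewrite mulrA.
by [].
Qed.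

Lemma fourier_const_gt0 : 0 < cmod fourier_const.
Proof.
rewrite cmod_real ger0_norm ?powR_ge0// powR_gt0//.
by rewrite mulr_gt0// pi_gt0.
Qed.

End representation.

(** * Wave packets *)

Section atoms.
Context (R : realType) (d : nat).
Local Notation V := 'rV[R]_d.
Local Notation lam := (lebesgue_rV R d).

(** With [1 + cos] in place of [cos] the integrand is nonnegative and Tonelli's theorem gives
    measurability; the added constant is subtracted afterwards. *)
Lemma measurable_fejerT m : (0 < m)%N -> measurable_fun setT (@fejerT R m).
Proof.
move=> m0; pose mu := @lebesgue_measure R.
pose f (z : measurableTypeR R * measurableTypeR R) : \bar R :=
  (fejer m z.2 * (1 + cos (z.2 * z.1)))%:E.
have mf : measurable_fun setT f.
  apply/measurable_EFinP; apply: measurable_funM.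
    exact: (measurableT_comp (@measurable_fejer R m) measurable_snd).
  apply: measurable_funD => //.
  apply: (measurableT_comp (continuous_measurable_fun (@continuous_cos R))).
  by apply: measurable_funM; [exact: measurable_snd|exact: measurable_fst].
have f0 z : (0 <= f z)%E.
  rewrite lee_fin mulr_ge0 ?fejer_ge0//.
have := @measurable_fun_fubini_tonelli_F _ _ _ _ _ mu _ mf f0.
have E xi : fubini_F mu f xi = (\int[mu]_x fejer m x + fejerT m xi)%:E.
  rewrite /fubini_F /f/= EFinD /fejerT /Rintegral !fineK.
  2-3: by [exact: (integrable_fin_num measurableT (integrable_fejer R m0))|
    exact: (integrable_fin_num measurableT (integrable_fejer_cos xi m0))].
  rewrite -integralD//; [|exact: integrable_fejer|exact: integrable_fejer_cos].
  by apply: eq_integral => x _; rewrite mulrDr mulr1.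
have -> : fubini_F mu f = EFin \o (fun xi => \int[mu]_x fejer m x + fejerT m xi) by exact/funext.
move/measurable_EFinP => h.
have := measurable_funB h (@measurable_cst _ _ _ _ setT (\int[mu]_x fejer m x)).
by apply: eq_measurable_fun => xi _ /=; rewrite addrAC subrr add0r.
Qed.

Lemma measurable_fejerT_rV m : (0 < m)%N -> measurable_fun setT (@fejerT_rV R d m).
Proof. by move=> m0; apply: measurable_prod_rV; exact: measurable_fejerT. Qed.

Definition atom m (r : R) (a zeta : V) : V -> R[i] := fun x =>
  (fejer_rV m (r^-1 *: (x - a)))%:C * expi (dotr zeta x).

Lemma cintegrable_atom m (r : R) (a zeta : V) : (0 < m)%N -> 0 < r ->
  cintegrable (atom m r a zeta).
Proof.
move=> m0 r0; apply: cintegrable_expi; split; last first.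
  by apply: (eq_integrable measurableT (cst 0%E)) => //; exact: integrable0.
have ir : 0 < r^-1 by rewrite invr_gt0.
have := integrable_affine (- (r^-1 *: a)) ir (integrable_fejer_rV R d m0).
by apply: eq_integrable => // x _ /=; rewrite /Re_fun/= scalerBr.
Qed.

(** The modulation of [atom] is not recentred at [a], whence the phase [dotr a (xi - zeta)]. After
    the substitution [r *: x + a] the Fejer transform appears at [r *: (zeta - xi)], and it is
    even. *)
Lemma atom_transform m (r : R) (a zeta y xi : V) : (0 < m)%N -> 0 < r ->
  cintegral (fun x => atom m r a zeta x * expi (dotr (y - x) xi)) =
  (r ^+ d * fejerT_rV m (r *: (xi - zeta)))%:C * expi (dotr y xi - dotr a (xi - zeta)).
Proof.
move=> m0 r0.
have ca := cintegrable_atom a zeta m0 r0.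
have ci : cintegrable (fun x => atom m r a zeta x * expi (dotr (y - x) xi)).
  apply: (cintegrableM ca (K := 1)); last by move=> x; rewrite cmod_expi.
  apply: cmeasurable_expi.
  have m1 : measurable_fun setT (fun x : V => (-1) *: x + y) by exact: measurable_affine_rV.
  have := measurableT_comp (@measurable_dotrl R d xi) m1.
  by apply: eq_measurable_fun => x _; rewrite /= dotrC scaleN1r addrC.
rewrite (cintegral_affine a r0 ci) rmorphM/= -mulrA; congr (_ * _).
have -> : (fun x => atom m r a zeta (r *: x + a) * expi (dotr (y - (r *: x + a)) xi)) =
  (fun x => expi (dotr y xi - dotr a (xi - zeta)) * ((fejer_rV m x)%:C * expi (dotr x (r *: (zeta - xi))))).
  apply/funext => x; rewrite /atom addrK scalerA mulVf ?gt_eqF// scale1r.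
  rewrite mulrCA -!mulrA; congr (_ * _); rewrite -!expiD; congr expi.
  rewrite !dotrBl !dotrDl !dotrZl !dotrBr !dotrZr dotrBr (dotrC zeta) !dotrDl !dotrZl.
  ring.
rewrite cintegralZl; last first.
  apply: (cintegrableM (f := fun x => (fejer_rV m x)%:C) (K := 1)).
  - split; first exact: integrable_fejer_rV.
    by apply: (eq_integrable measurableT (cst 0%E)) => //; exact: integrable0.
  - apply: cmeasurable_expi; have := @measurable_dotrl R d (r *: (zeta - xi)).
    by apply: eq_measurable_fun => x _; rewrite dotrC.
  - by move=> x; rewrite cmod_expi.
rewrite cintegral_fejer_rV// mulrC; congr (_%:C * _).
by rewrite -fejerT_rVN -scalerN opprB.
Qed.

Lemma block_atom (th : V -> R) m (r : R) (a zeta y : V) : test_fun th -> (0 < m)%N -> 0 < r ->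
  block_fun th (atom m r a zeta) y = fourier_const R d ^+ 2 *
   cintegral (fun xi => (th xi * (r ^+ d * fejerT_rV m (r *: (xi - zeta))))%:C *
     expi (dotr y xi - dotr a (xi - zeta))).
Proof.
move=> tth m0 r0; rewrite block_frequency//; last exact: cintegrable_atom.
have -> : (fun xi => (th xi)%:C * cintegral (fun x => atom m r a zeta x * expi (dotr (y - x) xi))) =
  (fun xi => (th xi * (r ^+ d * fejerT_rV m (r *: (xi - zeta))))%:C *
     expi (dotr y xi - dotr a (xi - zeta))) => //.
by apply/funext => xi; rewrite atom_transform// mulrA -rmorphM.
Qed.

Lemma block_atom_eq0 (th : V -> R) m (r : R) (a zeta y : V) : (0 < d)%N ->
  test_fun th -> (0 < m)%N -> 0 < r ->
  (forall xi, `|xi - zeta| < m%:R / r -> th xi = 0) ->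
  block_fun th (atom m r a zeta) y = 0.
Proof.
move=> d0 tth m0 r0 H; rewrite block_atom//.
have -> : (fun xi => (th xi * (r ^+ d * fejerT_rV m (r *: (xi - zeta))))%:C *
     expi (dotr y xi - dotr a (xi - zeta))) = (fun=> 0).
  apply/funext => xi; have [h|h] := ltP `|xi - zeta| (m%:R / r).
    by rewrite H// mul0r mul0r.
  rewrite fejerT_rV_supp// ?mulr0 ?mul0r// normrZ (gtr0_norm r0).
  by move: h; rewrite ler_pdivrMr// mulrC.
by rewrite cintegral0 mulr0.
Qed.

(** With the frequency written as [r^-1 *: u + zeta], the block is, up to a unimodular factor and
    the constant, the integral of [g u * expi (dotr w u)] with [g >= 0] supported in [|u| < m]. The
    condition on [y - a] keeps [|dotr w u| <= 1] there, so the phases do not cancel and the real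
    part is at least [cos 1] times the integral of [g]. The box of radius 1/2, where the transform
    is at least [cT], has volume 1. *)
Lemma block_atom_ge (th : V -> R) m (r c cT : R) (a zeta y : V) :
  test_fun th -> (0 < m)%N -> 0 < r -> 0 <= c -> 0 <= cT -> (0 < d)%N ->
  (forall xi, `|xi - zeta| < m%:R / r -> c <= th xi) ->
  (forall xi : V, `|xi| <= 2^-1 -> cT <= fejerT_rV m xi) ->
  `|y - a| <= r / (d * m)%:R ->
  cmod (fourier_const R d ^+ 2) * (cos 1 * (c * cT)) <= cmod (block_fun th (atom m r a zeta) y).
Proof.
move=> tth m0 r0 c0 cT0 d0 Hth HT ya; rewrite block_atom// cmodM ler_wpM2l ?cmod_ge0//.
have [_ thp _] := tth.
have ir : 0 < r^-1 by rewrite invr_gt0.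
set f := (fun xi => _).
have mT := @measurable_fejerT_rV m m0.
have [K K0 HK] := test_fun_bounded tth.
have [A A0 HA] := test_fun_bounded_supp tth.
have mth : measurable_fun setT th by apply: continuous_measurable_rV; exact: test_fun_continuous.
pose g (u : V) := th (r^-1 *: u + zeta) * fejerT_rV m u.
have mg : measurable_fun setT g.
  by apply: measurable_funM => //; apply: (measurableT_comp mth); exact: measurable_affine_rV.
have g0 u : 0 <= g u by rewrite mulr_ge0 ?fejerT_rV_ge0.
have gsupp u : m%:R <= `|u| -> g u = 0 by move=> h; rewrite /g fejerT_rV_supp ?mulr0.
have Tle (u : V) : fejerT_rV m u <= \prod_(i < d) (\int[lebesgue_measure]_x fejer m x).
  apply: ler_prod => i _; rewrite fejerT_ge0//=.
  apply: le_Rintegral => //; [exact: integrable_fejer_cos|exact: integrable_fejer|].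
  by move=> x _; rewrite -[leRHS]mulr1 ler_wpM2l ?fejer_ge0 ?cos_le1.
set P := \prod_(i < d) _ in Tle.
have gi : lam.-integrable setT (EFin \o g).
  apply: (le_integrable measurableT _ _ (integrableZlR (K * P) (integrable_box_fun d m%:R))).
    exact/measurable_EFinP.
  move=> u _; rewrite lee_fin (ger0_norm (g0 u)); apply: le_trans (ler_norm _).
  rewrite /box_fun; case: ifPn => [_|]; last by rewrite -ltNge => /ltW/gsupp ->; rewrite mulr0.
  rewrite mulr1 /g; apply: ler_pM; rewrite ?fejerT_rV_ge0//.
  by have := HK (r^-1 *: u + zeta); rewrite ger0_norm.
pose w := r^-1 *: (y - a).
pose G (u : V) : R[i] := (g u)%:C * expi (dotr w u).
have Gi : cintegrable G.
  apply: cintegrable_expi; split => //.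
  by apply: (eq_integrable measurableT (cst 0%E)) => //; exact: integrable0.
have EG u : f (r^-1 *: u + zeta) = (r ^+ d)%:C * (expi (dotr y zeta) * G u).
  rewrite /f /G /g addrK scalerA divff ?gt_eqF// scale1r.
  have -> : dotr y (r^-1 *: u + zeta) - dotr a (r^-1 *: u) = dotr y zeta + dotr w u.
    by rewrite /w dotrDr !dotrZr dotrZl dotrBl; ring.
  by rewrite expiD !rmorphM/=; ring.
have fi : cintegrable f.
  have := cintegrable_affine (- (r *: zeta)) r0 (cintegrableZl (r ^+ d)%:C (cintegrableZl (expi (dotr y zeta)) Gi)).
  rewrite (_ : (fun x => _) = f)//; apply/funext => x; rewrite -EG; congr f.
  by rewrite scalerDr scalerN !scalerA mulVf ?gt_eqF// !scale1r subrK.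
rewrite (cintegral_affine zeta ir fi) (_ : (fun x => f _) = (fun u => (r ^+ d)%:C * (expi (dotr y zeta) * G u))); last exact/funext.
rewrite cintegralZl; last exact: cintegrableZl.
rewrite cintegralZl// !cmodM cmod_expi mul1r !cmod_real [leRHS]mulrA -normrM -exprMn mulVf ?gt_eqF//.
rewrite expr1n normr1 mul1r.
apply: le_trans (le_Re_cmod _); apply: le_trans (ler_norm _).
have i1 : lam.-integrable setT (EFin \o (fun u => cos 1 * (c * cT) * box_fun 2^-1 u)).
  by apply: integrableZlR; exact: integrable_box_fun.
apply: (@le_trans _ _ (\int[lam]_u (cos 1 * (c * cT) * box_fun 2^-1 u))).
  rewrite RintegralZl//; last exact: integrable_box_fun.
  have := @box_volE R d 2^-1 (ltW _); rewrite /box_vol => ->; last by rewrite invr_gt0.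
  by rewrite divff// expr1n mulr1.
apply: le_Rintegral => //; first exact: Gi.1.
move=> u _; rewrite /Re_fun /G/= mul0r subr0.
have cosw : `|u| < m%:R -> cos 1 <= cos (dotr w u).
  move=> um; have wu : `|dotr w u| <= 1.
    apply: (le_trans (le_dotr _ _)); rewrite /w normrZ (gtr0_norm ir).
    apply: (@le_trans _ _ (d%:R * (r^-1 * (r / (d * m)%:R) * m%:R))).
      rewrite ler_wpM2l//; apply: ler_pM; rewrite ?mulr_ge0 ?(ltW ir)//; last exact: ltW.
      by rewrite ler_wpM2l// ltW.
    rewrite natrM le_eqVlt; apply/orP; left; apply/eqP.
    have d1 : d%:R != 0 :> R by rewrite pnatr_eq0 -lt0n.
    have m1 : m%:R != 0 :> R by rewrite pnatr_eq0 -lt0n.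
    have r1 : r != 0 by rewrite gt_eqF.
    by move: (d%:R : R) (m%:R : R) d1 m1 => x z x0 z0; field; rewrite x0 z0 r1.
  rewrite -(cos_norm (dotr w u)).
  have p1 : (1 : R) <= pi.
    by have := pi_ge2 R; lra.
  move: (normr_ge0 (dotr w u)) wu; move: `|_| => t t0 t1.
  by rewrite leNgt ltr_cos ?in_itv/= ?ler01 ?p1 ?t0 ?(le_trans t1 p1)// -leNgt.
rewrite /box_fun; case: ifPn => [u2|_]; last first.
  rewrite mulr0; have [um|um] := ltP `|u| m%:R; last by rewrite gsupp// mul0r.
  by rewrite mulr_ge0// (le_trans _ (cosw um))// ltW// cos1_gt0.
have um : `|u| < m%:R.
  apply: (le_lt_trans u2); rewrite (@lt_le_trans _ _ 1)//; first lra.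
  by rewrite ler1n.
rewrite mulr1 mulrC; apply: ler_pM.
- exact: mulr_ge0.
- exact: ltW (cos1_gt0 R).
- apply: ler_pM => //; last exact: HT.
  apply: Hth; rewrite addrK normrZ (gtr0_norm ir) mulrC ltr_pM2r//.
- exact: cosw.
Qed.

End atoms.

Section scaled_kernels.
Context (R : realType) (d : nat).
Local Notation V := 'rV[R]_d.
Local Notation lam := (lebesgue_rV R d).

Lemma closed_normr_le (W : normedModType R) (A : R) : closed [set x : W | `|x| <= A].
Proof.
have -> : [set x : W | `|x| <= A] = (fun x : W => `|x|) @^-1` [set t : R | t <= A] by [].
apply: closed_comp; last exact: closed_le.
by move=> x _; exact: norm_continuous.
Qed.

Lemma closure_normr_sub (W : normedModType R) (P : set W) (A : R) :
  P `<=` [set x | `|x| <= A] -> closure P `<=` [set x | `|x| <= A].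
Proof.
move=> PA; rewrite [X in _ `<=` X]((closure_id _).1 (@closed_normr_le W A)).
exact: closure_subset.
Qed.

Lemma rV_closure_normr_sub (P : set V) (A : R) :
  P `<=` [set x | `|x| <= A] -> closure P `<=` [set x | `|x| <= A].
Proof. exact: (@closure_normr_sub V). Qed.

Lemma compact_supp_le (h : V -> R) (A : R) : (forall x, A < `|x| -> h x = 0) -> compact (supp h).
Proof.
move=> hA; apply: bounded_closed_compact; last exact: closed_closure.
have sub : supp h `<=` [set x | `|x| <= A].
  apply: rV_closure_normr_sub => x /= hx; rewrite leNgt; apply/negP => /hA h0.
  by move: hx; rewrite h0 eqxx.
exists A; split; first exact: num_real.
by move=> M AM x /sub /= xA; rewrite (le_trans xA)// ltW.
Qed.

Lemma test_fun_scale (th : V -> R) (l : R) : 0 < l -> test_fun th ->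
  test_fun (fun x => th (l *: x)).
Proof.
move=> l0 tth; have [sth thp _] := tth; have [A A0 HA] := test_fun_bounded_supp tth.
split => //.
- have := schwartz_scale 0 (lt0r_neq0 l0) sth.
  by rewrite (_ : (fun x => _) = (fun x => (th (l *: x))%:C))//; apply/funext => x; rewrite addr0.
- apply: (@compact_supp_le _ (A / l)) => x xA; apply: HA.
  by rewrite normrZ (gtr0_norm l0) mulrC -ltr_pdivrMr.
Qed.

Lemma ftransform_scale (th : V -> R) (s : R) (z : V) : test_fun th -> 0 < s ->
  ftransform (fun xi => th (s^-1 *: xi)) z = (s ^+ d)%:C * ftransform th (s *: z).
Proof.
move=> tth s0; have tth' := test_fun_scale (l := s^-1) _ tth.
rewrite /ftransform (@cintegral_affine _ _ s 0 _ s0); last first.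
  by apply: cintegrable_expi; apply: cintegrable_test; apply: tth'; rewrite invr_gt0.
congr (_ * cintegral _); apply/funext => u.
by rewrite addr0 scalerA mulVf ?gt_eqF// scale1r dotrZr dotrZl.
Qed.

(** Peetre's inequality [1 + |u + v| <= (1 + |u|) * (1 + |v|)]. The condition [r^-1 <= s] says that
    the kernel is no wider than the packet. *)
Lemma weight_submul M (x y z : V) (r s : R) : 0 < r -> r^-1 <= s ->
  weight M (r^-1 *: (x - z)) * weight M (s *: (y - x)) <= weight M (r^-1 *: (y - z)).
Proof.
move=> r0 rs; have ir : 0 < r^-1 by rewrite invr_gt0.
have s0 : 0 < s by exact: lt_le_trans rs.
rewrite /weight -invfM -exprMn lef_pV2 ?posrE ?exprn_gt0 ?mulr_gt0 ?ltr_pwDl//.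
rewrite lerXn2r ?nnegrE ?mulr_ge0 ?addr_ge0//.
rewrite !normrZ (gtr0_norm ir) (gtr0_norm s0).
have h1 : `|y - z| <= `|x - z| + `|y - x|.
  by have := ler_normD (x - z) (y - x); rewrite addrC addrA subrK.
apply: (@le_trans _ _ (1 + (r^-1 * `|x - z| + s * `|y - x|))).
  rewrite lerD2l; apply: (@le_trans _ _ (r^-1 * (`|x - z| + `|y - x|))).
    by rewrite ler_wpM2l// ltW.
  by rewrite mulrDr lerD2l ler_wpM2r.
rewrite mulrDl mul1r mulrDr mulr1 -!addrA lerD2l addrCA lerD2l lerDl.
by rewrite !mulr_ge0// ltW.
Qed.

(** A convolution with a kernel of width at most [r] preserves the decay of an envelope of width
    [r]. Of the [M + 2 * d] orders of decay of the kernel, [M] are spent on [weight_submul] and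
    [2 * d] on its integral; the factors [s ^+ d] of the dilation then cancel, so [C] is independent
    of [s] and [r]. *)
Lemma block_atom_le (th : V -> R) (m M : nat) : (0 < d)%N -> test_fun th ->
  (0 < m)%N -> (M <= 2 * m)%N ->
  exists2 C : R, 0 <= C & forall (s r : R) (a zeta y : V), 0 < r -> r^-1 <= s ->
    cmod (block_fun (fun xi => th (s^-1 *: xi)) (atom m r a zeta) y) <=
    C * weight M (r^-1 *: (y - a)).
Proof.
move=> d0 tth m0 Mm; have [K K0 HK] := kernel_decay (M + 2 * d) d0 tth.
pose c0 := cmod (fourier_const R d ^+ 2).
exists (c0 * (2 * (8 ^+ (m * d) * K * 2 ^+ d))).
  by rewrite mulr_ge0 ?cmod_ge0// !mulr_ge0// exprn_ge0.
move=> s r a zeta y r0 rs.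
have ir : 0 < r^-1 by rewrite invr_gt0.
have s0 : 0 < s by exact: lt_le_trans rs.
have is_ : 0 < s^-1 by rewrite invr_gt0.
have tths := test_fun_scale is_ tth.
have ca := cintegrable_atom a zeta m0 r0.
rewrite /block_fun cmodM -[leRHS]mulrA -/c0 ler_wpM2l ?cmod_ge0//.
pose Wy := weight M (r^-1 *: (y - a)).
pose k (x : V) : R := 8 ^+ (m * d) * K * s ^+ d * Wy * weight (2 * d) (s *: x - s *: y).
have ki : lam.-integrable setT (EFin \o k).
  apply: integrableZlR.
  exact: (integrable_affine (- (s *: y)) s0 (@integrable_weight R d _ (leqnn (2 * d)))).
have Hk x : cmod (atom m r a zeta x * ftransform (fun xi => th (s^-1 *: xi)) (y - x)) <= k x.
  rewrite cmodM ftransform_scale// cmodM cmod_real /atom cmodM cmod_expi mulr1 cmod_real.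
  rewrite (ger0_norm (fejer_rV_ge0 _ _)) (gtr0_norm (exprn_gt0 d s0)).
  have := fejer_rV_le m (r^-1 *: (x - a)) => h1.
  have := HK (s *: (y - x)) => h2; rewrite weightD in h2.
  have h3 : weight (2 * m) (r^-1 *: (x - a)) <= weight M (r^-1 *: (x - a)) by exact: le_weight.
  have h4 := weight_submul M x y a r0 rs; rewrite -/Wy in h4.
  have h5 : weight (2 * d) (s *: x - s *: y) = weight (2 * d) (s *: (y - x)).
    by rewrite /weight -scalerBr -opprB scalerN normrN.
  rewrite /k h5.
  have E8 : 0 <= 8 ^+ (m * d) :> R by rewrite exprn_ge0.
  have Es : 0 <= s ^+ d by rewrite exprn_ge0// ltW.
  have w1 := weight_ge0 M (s *: (y - x)); have w2 := weight_ge0 (2 * d) (s *: (y - x)).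
  have w3 := weight_ge0 M (r^-1 *: (x - a)).
  apply: (@le_trans _ _ ((8 ^+ (m * d) * weight M (r^-1 *: (x - a))) *
     (s ^+ d * (K * (weight M (s *: (y - x)) * weight (2 * d) (s *: (y - x))))))).
    apply: ler_pM; rewrite ?fejer_rV_ge0 ?mulr_ge0 ?cmod_ge0//.
      by apply: (le_trans h1); rewrite ler_wpM2l.
    by rewrite ler_wpM2l.
  rewrite [leLHS](_ : _ = (8 ^+ (m * d) * K * s ^+ d) *
    (weight M (r^-1 *: (x - a)) * weight M (s *: (y - x))) * weight (2 * d) (s *: (y - x))); last by ring.
  by rewrite ler_wpM2r// ler_wpM2l// !mulr_ge0.
have mk : cmeasurable (fun x => atom m r a zeta x * ftransform (fun xi => th (s^-1 *: xi)) (y - x)).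
  by apply: cintegrable_cmeasurable; exact: cintegrable_ftransform.
apply: (le_trans (cmod_cintegral_le mk ki Hk)); rewrite -mulrA ler_wpM2l//.
have iw := integrable_affine (- (s *: y)) s0 (@integrable_weight R d _ (leqnn (2 * d))).
rewrite /k RintegralZl//.
have I0 : \int[lam]_x weight (2 * d) (s *: x - s *: y) <= s ^- d * 2 ^+ d.
  rewrite -lee_fin /Rintegral fineK; last exact: (integrable_fin_num measurableT iw).
  have := ge0_integral_weight_scaled y is_; rewrite exprVn invrK.
  rewrite (_ : (fun x : V => (weight (2 * d) (s *: (x - y)))%:E) =
    (fun x => (weight (2 * d) (s *: x - s *: y))%:E))//.
  by apply/funext => x; rewrite scalerBr.
have W0 : 0 <= 8 ^+ (m * d) * K * s ^+ d * Wy by rewrite !mulr_ge0 ?exprn_ge0 ?weight_ge0// ltW.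
apply: (le_trans (ler_wpM2l W0 I0)).
rewrite le_eqVlt; apply/orP; left; apply/eqP.
rewrite -/Wy.
have sd : s ^+ d != 0 by rewrite expf_neq0// gt_eqF.
by move: (s ^+ d) (8 ^+ (m * d) : R) (2 ^+ d : R) sd => u v w u0; field.
Qed.

Lemma fun0_near_supp (W : normedModType R) (h : W -> R) : ~ closure [set x | h x != 0] 0 ->
  exists2 e : R, 0 < e & forall x, `|x| < e -> h x = 0.
Proof.
move=> ncl.
have : nbhs (0 : W) (~` closure [set x | h x != 0]).
  apply: open_nbhs_nbhs; split => //.
  by apply: closed_openC; exact: closed_closure.
move=> /nbhs_normP[e /= e0 H]; exists e => // x xe.
apply/eqP/negPn/negP => hx; apply: (H x); first by rewrite /= sub0r normrN.
exact: subset_closure.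
Qed.

Lemma rV_fun0_near_supp (h : V -> R) : ~ supp h 0 ->
  exists2 e : R, 0 < e & forall x, `|x| < e -> h x = 0.
Proof. exact: (@fun0_near_supp V). Qed.

End scaled_kernels.

(** * Families of packets with lacunary frequencies *)

Section test_family.
Context (R : realType) (d : nat) (d0 : (0 < d)%N).
Local Notation V := 'rV[R]_d.
Variables (eta0 eta : V -> R) (heta : admissible_eta eta0 eta).

Lemma test_fun_eta_ k : test_fun (eta_ eta0 eta k).
Proof.
have [t0 t1 _ _ _] := heta; case: k => [|k] //=.
by apply: test_fun_scale => //; rewrite invr_gt0 exprn_gt0.
Qed.

Lemma eta0_gt0 : 0 < eta0 0.
Proof.
have [_ _ h _ _] := heta; apply: h => i; rewrite mxE normr0.
by rewrite divr_ge0.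
Qed.

Lemma lp_blockE (F : V -> R[i]) k y : cintegrable F ->
  lp_block eta0 eta (dist_of F) k y = block_fun (eta_ eta0 eta k) F y.
Proof.
move=> Fi; rewrite /lp_block.
have [t0 _ _ _ _] := heta.
by rewrite (fun_of_distE t0 eta0_gt0 (represents_block (test_fun_eta_ k) Fi)).
Qed.

Lemma dist_of0 : @dist_of R d (fun=> 0) = (fun=> 0).
Proof.
apply/funext => phi; rewrite /dist_of.
under eq_fun do rewrite mul0r; exact: cintegral0.
Qed.

Lemma lp_block0 k y : lp_block eta0 eta (fun=> 0) k y = 0.
Proof.
rewrite -dist_of0 lp_blockE; last exact: cintegrable0.
rewrite /block_fun; under eq_fun do rewrite mul0r.
by rewrite cintegral0 mulr0.
Qed.

(* The frequencies are so far apart that a block index is within distance [c] of at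
   most one of them. *)
Definition test_freq (c J j : nat) : nat := ((2 * c + 1) * (j + J))%N.

(** This is [|N - k| <= c], free of truncated subtraction. *)
Definition freq_near (c N k : nat) : bool := (N <= k + c)%N && (k <= N + c)%N.

(* A point of the dyadic annulus on which [eta_ eta0 eta N] is bounded below. *)
Definition zeta_ (N : nat) : V := 2 ^+ N *: const_mx (3 / 4).

Lemma norm_zeta_ N : `|zeta_ N| = 2 ^+ N * (3 / 4).
Proof.
rewrite /zeta_ normrZ gtr0_norm ?exprn_gt0//; congr (_ * _).
apply/eqP; rewrite eq_le; apply/andP; split.
  by apply: rV_norm_le => [|i]; rewrite ?mxE ?ger0_norm// divr_ge0.
have := le_rV_norm (const_mx (3 / 4) : V) (Ordinal d0); rewrite mxE ger0_norm//.
Qed.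

Lemma nat_le_pow2 N : N%:R <= 2 ^+ N :> R.
Proof. by rewrite -natrX ler_nat ltnW// ltn_expl. Qed.

Lemma exists_test_constants : exists c : nat, forall m (r : R), (0 < m)%N -> 0 < r ->
  exists J0 : nat, forall j k, let N := test_freq c J0 j in
    [/\ ~~ freq_near c N k -> forall xi : V, `|xi - zeta_ N| < m%:R / r -> eta_ eta0 eta k xi = 0,
        freq_near c N k -> (0 < k)%N /\ r^-1 <= 2 ^+ k &
        forall xi : V, `|xi - zeta_ N| < m%:R / r -> eta (const_mx (3 / 4)) / 2 <= eta_ eta0 eta N xi].
Proof.
have [t0 t1 e0 esupp epos] := heta.
have [A0 A00 HA0] := test_fun_bounded_supp t0.
have [A1 A10 HA1] := test_fun_bounded_supp t1.
have [rho rho0 Hrho] := rV_fun0_near_supp esupp.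
have ez : 0 < eta (const_mx (3 / 4)).
  apply: epos; split=> [i|]; first by rewrite mxE ger0_norm; lra.
  by move=> /(_ (Ordinal d0)); rewrite mxE ger0_norm; lra.
have [dl dl0 Hdl] := rV_continuous_pos_ball (test_fun_continuous t1) ez.
(* If [k] is more than [c] below [N], the annulus of the packet lies outside the support of the
   multiplier, of radius [A0] or [2 ^+ k * A1]; if it is more than [c] above, the annulus falls into
   the hole of radius [2 ^+ k * rho] around 0. *)
pose c := (Num.trunc (A0 + A1 + rho^-1)).+1.
have hc : A0 + A1 + rho^-1 < 2 ^+ c.
  by apply: lt_le_trans (nat_le_pow2 c); exact: truncnS_gt.
have irho : 0 < rho^-1 by rewrite invr_gt0.
clearbody c.
exists c => m r m0 r0.
(* Three demands on [2 ^+ N]: the frequency ball of the packet stays in the annulus between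
   [2 ^+ N / 2] and [2 ^+ N]; after rescaling it stays within [dl] of the point where [eta] is
   large; and [r^-1 <= 2 ^+ k] for all [k >= N - c]. *)
pose B := 4 * m%:R / r + m%:R / (r * dl) + 2 ^+ c / r.
have p1 : 0 <= 4 * m%:R / r by rewrite divr_ge0 ?(ltW r0)// mulr_ge0.
have p2 : 0 <= m%:R / (r * dl) by rewrite divr_ge0// mulr_ge0// ltW.
have p3 : 0 <= 2 ^+ c / r by rewrite divr_ge0 ?(ltW r0)// exprn_ge0.
pose J0 := (Num.trunc B).+1.
exists J0 => j k N.
have NJ : (J0 <= N)%N.
  by rewrite /N /test_freq (leq_trans (leq_addl j J0))// leq_pmull// addn1.
(* Forces [k > 0] whenever [k] is near [N], so that the multiplier of index [k] is a dilate of [eta]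
   and not the exceptional [eta0]. *)
have Nc : (2 * c + 1 <= N)%N.
  by rewrite /N /test_freq leq_pmulr// addnS.
have BN : B <= 2 ^+ N.
  apply: le_trans (nat_le_pow2 N); apply: (@le_trans _ _ J0%:R); last by rewrite ler_nat.
  exact/ltW/truncnS_gt.
clear NJ; clearbody N J0.
have mr : m%:R / r <= 2 ^+ N / 4 by move: BN; rewrite /B -mulrA; lra.
have kpos (l : nat) : 0 < 2 ^+ l :> R by rewrite exprn_gt0.
split.
- move=> nn xi xiz.
  have xl : 2 ^+ N / 2 < `|xi|.
    have := ler_normB xi (xi - zeta_ N); rewrite opprB addrC subrK norm_zeta_.
    by have := kpos N; lra.
  have xu : `|xi| < 2 ^+ N.
    have := ler_normD (xi - zeta_ N) (zeta_ N); rewrite subrK norm_zeta_.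
    by have := kpos N; lra.
  move: nn; rewrite negb_and -!ltnNge => /orP[kN|kN]; last first.
    case: k kN => // k kN; apply: Hrho; rewrite normrZ ger0_norm ?invr_ge0 ?(ltW (kpos _))//.
    rewrite mulrC ltr_pdivrMr//; apply: (lt_trans xu).
    have -> : k.+1 = (N + c + (k.+1 - (N + c)))%N by rewrite subnKC// ltnW.
    have h : 1 < rho * 2 ^+ c.
      by rewrite mulrC -ltr_pdivrMr// mul1r; lra.
    rewrite (exprD _ (N + c)) (exprD _ N).
    have := exprn_ege1 (k.+1 - (N + c)) (ler1n R 2 : 1 <= 2%:R).
    move: (2 ^+ (k.+1 - (N + c))) h (kpos N) => e + + e1; move: (2 ^+ N) (2 ^+ c) => u v h u0.
    have -> : rho * (u * v * e) = u * ((rho * v) * e) by ring.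
    have : rho * v <= rho * v * e by nra.
    nra.
  case: k kN => [|k] kN /=.
    apply: HA0; apply: lt_trans xl; rewrite ltr_pdivlMr//.
    apply: (@lt_le_trans _ _ (2 ^+ c * 2)); first by rewrite ltr_pM2r//; lra.
    by rewrite -exprSr ler_weXn2l ?ler1n//; lia.
  apply: HA1; rewrite normrZ ger0_norm ?invr_ge0 ?(ltW (kpos _))//.
  rewrite mulrC ltr_pdivlMr//; apply: lt_trans xl; rewrite ltr_pdivlMr//.
  apply: (@lt_le_trans _ _ (2 ^+ c * 2 ^+ k.+1 * 2)).
    by rewrite !ltr_pM2r//; lra.
  by rewrite -(exprD _ c k.+1) -exprSr; apply: ler_weXn2l; [rewrite ler1n|rewrite (addnC c)].
- move=> /andP[n1 n2]; split; first by move: n1 Nc; clear; lia.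
  have : 2 ^+ c / r <= 2 ^+ (k + c).
    apply: (@le_trans _ _ (2 ^+ N)); first by move: BN; rewrite /B; lra.
    by rewrite ler_weXn2l ?ler1n.
  by rewrite exprD mulrC ler_pM2r.
- move=> xi xiz.
  have [k0 Nk] : exists k0, N = k0.+1 by exists N.-1; move: Nc; clear; lia.
  rewrite Nk /= -Nk; apply/ltW/Hdl.
  have -> : 2 ^- N *: xi - const_mx (3 / 4) = 2 ^- N *: (xi - zeta_ N).
    by rewrite /zeta_ scalerBr scalerA mulVf ?scale1r// gt_eqF.
  rewrite normrZ ger0_norm ?invr_ge0 ?(ltW (kpos _))// mulrC ltr_pdivrMr//.
  apply: (lt_le_trans xiz).
  have : m%:R / (r * dl) <= 2 ^+ N by move: BN; rewrite /B; lra.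
  by rewrite ler_pdivrMr ?mulr_gt0// => h; rewrite ler_pdivrMr// (mulrC dl) -mulrA (mulrC dl).
Qed.

(** The constants precede the number, position, width and amplitude of the packets: the negative
    results let all of these depend on [n]. Only the frequency shift [J0] is chosen afterwards. *)
Lemma test_family (s : R) (M : nat) :
  exists (C c0 c1 : R) (c : nat), [/\ 0 < C, 0 < c0, 0 < c1 &
    forall n (x : 'I_n -> V) (r l : R), 0 < r -> 0 <= l ->
    exists (f : functional R d) (J0 : nat), [/\ tempered f,
      forall k y, 2 `^ (k%:R * s) * cmod (lp_block eta0 eta f k y) <=
        l * C * \sum_(j < n) ((freq_near c (test_freq c J0 j) k)%:R * weight M (r^-1 *: (y - x j))) &
      forall (j : 'I_n) y, `|y - x j| <= c1 * r ->
        l * c0 <= 2 `^ ((test_freq c J0 j)%:R * s) * cmod (lp_block eta0 eta f (test_freq c J0 j) y)]].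
Proof.
have [t0 t1 e0 esupp epos] := heta.
have ez : 0 < eta (const_mx (3 / 4)).
  apply: epos; split=> [i|]; first by rewrite mxE ger0_norm; lra.
  by move=> /(_ (Ordinal d0)); rewrite mxE ger0_norm; lra.
have [c Hc] := exists_test_constants.
pose m := M.+1.
have m0 : (0 < m)%N by [].
have Mm : (M <= 2 * m)%N by rewrite /m; lia.
have [K K0 HK] := block_atom_le d0 t1 m0 Mm.
have [cT cT0 HT] := fejerT_rV_gt0 R d m0.
pose cc := 2 `^ (c%:R * `|s|) : R.
have cc0 : 0 < cc by rewrite powR_gt0.
exists (cc * (K + 1)), (cmod (fourier_const R d ^+ 2) * (cos 1 * (eta (const_mx (3 / 4)) / 2 * cT))),
  (d * m)%:R^-1, c; split.
- by rewrite mulr_gt0// ltr_wpDl.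
- rewrite mulr_gt0//; first by rewrite expr2 cmodM mulr_gt0// fourier_const_gt0.
  by rewrite !mulr_gt0// ?cos1_gt0.
- by rewrite invr_gt0 ltr0n muln_gt0 d0.
move=> n x r l r0 l0.
have [J0 HJ] := Hc m r m0 r0.
pose N j := test_freq c J0 j.
(* The coefficient offsets the weight [2 ^ (k * s)] of the norms, exactly at [k = N j] and up to the
   factor [cc] for [k] near [N j]. *)
pose a (j : 'I_n) := l * 2 `^ (- ((N j)%:R * s)).
have a0 j : 0 <= a j by rewrite mulr_ge0// powR_ge0.
pose F (j : 'I_n) := fun y : V => (a j)%:C * atom m r (x j) (zeta_ (N j)) y.
have iF j : cintegrable (F j) by apply: cintegrableZl; exact: cintegrable_atom.
pose FF := fun y => \sum_(j < n) F j y.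
have iFF : cintegrable FF by exact: cintegrable_sum.
have E k y : lp_block eta0 eta (dist_of FF) k y =
   \sum_(j < n) (a j)%:C * block_fun (eta_ eta0 eta k) (atom m r (x j) (zeta_ (N j))) y.
  rewrite lp_blockE// block_fun_sum//; last exact: test_fun_eta_.
  apply: eq_bigr => j _; rewrite block_funZ//; [exact: test_fun_eta_|exact: cintegrable_atom].
have E0 k y (j : 'I_n) : ~~ freq_near c (N j) k ->
    block_fun (eta_ eta0 eta k) (atom m r (x j) (zeta_ (N j))) y = 0.
  move=> nn; have [h _ _] := HJ j k.
  by apply: block_atom_eq0 => //; [exact: test_fun_eta_|exact: h].
exists (dist_of FF), J0; split.
- exact: tempered_dist_of.
- move=> k y; rewrite E.
  apply: (@le_trans _ _ (2 `^ (k%:R * s) * \sum_(j < n) a j *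
      cmod (block_fun (eta_ eta0 eta k) (atom m r (x j) (zeta_ (N j))) y))).
    rewrite ler_wpM2l ?powR_ge0//; apply: (le_trans (ler_cmod_sum _ _ _)).
    by apply: ler_sum => j _; rewrite cmodM cmod_real ger0_norm.
  rewrite !mulr_sumr; apply: ler_sum => j _; rewrite -/(N j).
  have [nn|nn] := boolP (freq_near c (N j) k); last by rewrite E0// cmod0 mulr0 mul0r !mulr0.
  have [_ /(_ nn)[k0 rk] _] := HJ j k.
  case: k k0 rk nn => // k _ rk nn.
  have := HK (2 ^+ k.+1) r (x j) (zeta_ (N j)) y r0 rk => hb.
  rewrite mul1r /a.
  have e1 : 2 `^ (k.+1%:R * s) * 2 `^ (- ((N j)%:R * s)) <= cc.
    rewrite -powRD; last by rewrite pnatr_eq0 implybT.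
    apply: ler_powR; first by rewrite ler1n.
    rewrite -mulrBl; apply: (le_trans (ler_norm _)); rewrite normrM ler_wpM2r//.
    case/andP: nn => n1 n2; rewrite ler_norml; apply/andP; split.
      by rewrite lerNl opprB lerBlDl -natrD ler_nat.
    by rewrite lerBlDl -natrD ler_nat.
  have w0 := weight_ge0 M (r^-1 *: (y - x j)).
  rewrite (_ : _ * _ = (2 `^ (k.+1%:R * s) * 2 `^ (- ((N j)%:R * s))) *
    (l * cmod (block_fun (eta_ eta0 eta k.+1) (atom m r (x j) (zeta_ (N j))) y))); last by ring.
  rewrite [leRHS](_ : _ = cc * (l * ((K + 1) * weight M (r^-1 *: (y - x j))))); last by ring.
  apply: ler_pM; rewrite ?mulr_ge0 ?powR_ge0 ?cmod_ge0//.
  rewrite ler_wpM2l//; apply: (le_trans hb); rewrite ler_wpM2r// lerDl//.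
- move=> j y ya; rewrite E (bigD1 j)//= big1 ?addr0; last first.
    move=> j' jj'; rewrite E0 ?mulr0//.
    rewrite /freq_near /N /test_freq -/(test_freq c J0 j).
    have : (j' : nat) != j by [].
    rewrite /test_freq; move: (nat_of_ord j') (nat_of_ord j) => u v uv.
    by apply/negP => /andP[h1 h2]; move: uv; apply/negP; rewrite negbK; apply/eqP; nia.
  rewrite cmodM cmod_real (ger0_norm (a0 _)) /a -/(N j).
  rewrite [leRHS](_ : _ = l * (2 `^ ((N j)%:R * s) * 2 `^ (- ((N j)%:R * s))) *
    cmod (block_fun (eta_ eta0 eta (N j)) (atom m r (x j) (zeta_ (N j))) y)); last by ring.
  have -> : 2 `^ ((N j)%:R * s) * 2 `^ (- ((N j)%:R * s)) = 1 :> R.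
    by rewrite -powRD ?subrr ?powRr0// pnatr_eq0 implybT.
  rewrite mulr1 ler_wpM2l//; apply: block_atom_ge => //.
  + exact: test_fun_eta_.
  + by rewrite divr_ge0// ltW.
  + exact: ltW.
  + by have [_ _] := HJ j 0%N.
  + by move: ya; rewrite mulrC.
Qed.

End test_family.

Local Close Scope complex_scope.

(** * Mixed norms *)

Section poweR_extra.
Local Open Scope ereal_scope.
Context (R : realType).
Implicit Types (x y : \bar R) (r t : R).

Lemma le_poweR r x y : (0 <= r)%R -> 0 <= x -> x <= y -> x `^ r <= y `^ r.
Proof.
move=> r0 x0 xy; apply: gt0_ler_poweR => //; rewrite in_itv/= leey andbT//.
exact: le_trans xy.
Qed.

Lemma poweRK r x : (0 < r)%R -> 0 <= x -> (x `^ r) `^ r^-1 = x.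
Proof. by move=> r0 x0; rewrite -poweRrM mulfV ?gt_eqF// poweRe1. Qed.

Lemma poweRVK r x : (0 < r)%R -> 0 <= x -> (x `^ r^-1) `^ r = x.
Proof. by move=> r0 x0; rewrite -poweRrM mulVf ?gt_eqF// poweRe1. Qed.

Lemma le_poweRV r x y : (0 < r)%R -> 0 <= x -> 0 <= y -> (x <= y `^ r^-1) = (x `^ r <= y).
Proof.
move=> r0 x0 y0; apply/idP/idP => h.
  by rewrite -(poweRVK r0 y0); apply: le_poweR => //; exact: ltW.
by rewrite -(poweRK r0 x0); apply: le_poweR; rewrite ?poweR_ge0// ltW// invr_gt0.
Qed.

Lemma poweRV_le r x y : (0 < r)%R -> 0 <= x -> 0 <= y -> (x `^ r^-1 <= y) = (x <= y `^ r).
Proof.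
move=> r0 x0 y0; have := @le_poweRV r^-1 x y; rewrite invrK => -> //.
by rewrite invr_gt0.
Qed.

Lemma nneseries_term_le (a : nat -> \bar R) j :
  (forall i, 0 <= a i) -> a j <= \sum_(0 <= i <oo) a i.
Proof.
move=> a0; rewrite (nneseriesD1 (n := j))//.
by rewrite leeDl// nneseries_ge0.
Qed.

Lemma nneseries_le_ub (a : nat -> \bar R) y : (forall i, 0 <= a i) ->
  (forall n, \sum_(0 <= i < n) a i <= y) -> \sum_(0 <= i <oo) a i <= y.
Proof.
move=> a0 h; apply: lime_le; first exact: is_cvg_nneseries.
by apply: nearW => n.
Qed.

(** With [S] the sum, [b j ^ t <= S ^ (t - 1) * b j]; summing over [j] gives the claim. *)
Lemma nneseries_poweR_le (t : R) (b : nat -> \bar R) : (1 <= t)%R ->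
  (forall j, 0 <= b j) ->
  \sum_(0 <= j <oo) (b j `^ t) <= (\sum_(0 <= j <oo) b j) `^ t.
Proof.
move=> t1 b0; have t0 : (0 < t)%R by exact: lt_le_trans t1.
have S0 : 0 <= \sum_(0 <= j <oo) b j by exact: nneseries_ge0.
have [->|Sf] := eqVneq (\sum_(0 <= j <oo) b j) +oo.
  by rewrite poweRyr ?gt_eqF// leey.
have Sfin : \sum_(0 <= j <oo) b j \is a fin_num by rewrite ge0_fin_numE// ltey.
set S := \sum_(0 <= j <oo) b j in Sfin S0 *.
have bS j : b j <= S by exact: nneseries_term_le.
have pE x : x \is a fin_num -> 0 <= x -> x `^ t = x `^ (t - 1) * x.
  case: x => // x _; rewrite lee_fin => x0.
  by rewrite !poweR_EFin -EFinM mulrC mulr_powRB1.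
rewrite (pE S)//.
have -> : S `^ (t - 1) = (fine S `^ (t - 1))%:E by rewrite -poweR_EFin fineK.
rewrite -nneseriesZl//; apply: lee_nneseries => j _; first by rewrite poweR_ge0.
rewrite pE//; last first.
  by rewrite ge0_fin_numE//; apply: (le_lt_trans (bS j)); rewrite -ge0_fin_numE.
rewrite -poweR_EFin fineK//.
by apply: lee_wpmul2r => //; apply: le_poweR => //; rewrite subr_ge0.
Qed.

End poweR_extra.

Section lq.
Local Open Scope ereal_scope.
Context (R : realType).
Implicit Types (q r : \bar R) (a b : nat -> \bar R).

Definition lq q a : \bar R :=
  if q is r%:E then (\sum_(0 <= j <oo) a j `^ r) `^ r^-1%R else ereal_sup (range a).

Lemma weighted_lqE s q a : 0 < q -> (forall j, 0 <= a j) ->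
  weighted_lq s q a = lq q (fun j => (2 `^ (j%:R * s))%:E * a j).
Proof.
case: q => [r| |]// r0 a0; rewrite /weighted_lq /lq; congr (_ `^ _).
apply: eq_eseriesr => j _; rewrite poweRM ?lee_fin ?powR_ge0//.
by rewrite poweR_EFin -powRrM.
Qed.

Lemma le_lq q a b : 0 < q -> (forall j, 0 <= a j) -> (forall j, a j <= b j) ->
  lq q a <= lq q b.
Proof.
move=> q0 a0 ab; case: q q0 => [r| |]// r0 /=; last first.
  apply: ge_ereal_sup => _ [j _ <-]; apply: (le_trans (ab j)).
  by apply: ereal_sup_ubound; exists j.
rewrite lte_fin in r0.
apply: le_poweR; first by rewrite invr_ge0 ltW.
  by apply: nneseries_ge0 => j _ _; rewrite poweR_ge0.
apply: lee_nneseries => j _; first by rewrite poweR_ge0.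
by apply: le_poweR => //; exact: ltW.
Qed.

Lemma lq_ge q a j : 0 < q -> (forall j, 0 <= a j) -> a j <= lq q a.
Proof.
move=> q0 a0; case: q q0 => [r| |]// r0 /=; last by apply: ereal_sup_ubound; exists j.
rewrite lte_fin in r0.
rewrite le_poweRV//; last by apply: nneseries_ge0 => i _ _; rewrite poweR_ge0.
by apply: nneseries_term_le => i; rewrite poweR_ge0.
Qed.

Lemma lq_ge0 q a : 0 < q -> (forall j, 0 <= a j) -> 0 <= lq q a.
Proof. by move=> q0 a0; apply: le_trans (lq_ge 0%N q0 a0). Qed.

Lemma lq_antimono q r a : 0 < q -> q <= r -> (forall j, 0 <= a j) -> lq r a <= lq q a.
Proof.
move=> q0 qr a0; case: r qr => [r| |]; last by case: q q0.
- case: q q0 => [q| |]//; rewrite lte_fin lee_fin => q0 qr.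
  have r0 : (0 < r)%R by exact: lt_le_trans qr.
  have h s : 0 <= \sum_(0 <= j <oo) a j `^ s.
    by apply: nneseries_ge0 => i _ _; rewrite poweR_ge0.
  rewrite /lq poweRV_le// ?poweR_ge0//.
  have t1 : (1 <= r / q)%R by rewrite ler_pdivlMr// mul1r.
  have := nneseries_poweR_le t1 (fun j => poweR_ge0 (a j) q).
  rewrite -poweRrM (mulrC q^-1%R); apply: le_trans.
  rewrite le_eqVlt; apply/orP; left; apply/eqP; apply: eq_eseriesr => j _.
  by rewrite -poweRrM mulrC divfK// gt_eqF.
by move=> _; apply: ge_ereal_sup => _ [j _ <-]; exact: lq_ge.
Qed.

Lemma lqZ q a (c : R) : 0 < q -> (0 <= c)%R -> (forall j, 0 <= a j) ->
  lq q (fun j => c%:E * a j) = c%:E * lq q a.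
Proof.
move=> q0 c0 a0; case: q q0 => [q| |]//; rewrite ?lte_fin => q0 /=; last first.
  rewrite -ereal_supZl//; last by apply/set0P; exists (a 0%N); exists 0%N.
  by rewrite image_comp.
under eq_eseriesr do rewrite poweRM ?lee_fin// poweR_EFin.
rewrite nneseriesZl//; last by move=> j _; rewrite poweR_ge0.
rewrite poweRM ?lee_fin ?powR_ge0//; last by apply: nneseries_ge0 => i _ _; rewrite poweR_ge0.
by rewrite -poweR_EFin poweRK// lee_fin.
Qed.

Lemma lq0 q : 0 < q -> lq q (fun=> 0) = 0.
Proof.
move=> q0; have := @lqZ q (fun=> 0) 0%R q0 (lexx _) (fun=> lexx _).
by rewrite (_ : (fun=> _) = (fun=> 0)) ?mul0e//; apply/funext => j; rewrite mule0.
Qed.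

Lemma measurable_lq d (T : measurableType d) q (h : nat -> T -> \bar R) :
  0 < q -> (forall j, measurable_fun setT (h j)) -> (forall j x, 0 <= h j x) ->
  measurable_fun setT (fun x => lq q (h ^~ x)).
Proof.
move=> q0 mh h0; case: q q0 => [q| |]// q0; rewrite /lq.
  apply: (measurableT_comp (measurable_poweR _)).
  apply: (@ge0_emeasurable_sum _ _ _ setT (fun j x => h j x `^ q) xpredT).
    by move=> k x _ _; rewrite poweR_ge0.
  by move=> k _; exact: (measurableT_comp (measurable_poweR _)).
rewrite (_ : (fun _ => _) = (fun x => ereal_sup [set h j x | j in [set j | (0 <= j)%N]])); last first.
  by apply/funext => x; congr ereal_sup; apply/seteqP; split => y [j]; exists j.
exact: (measurable_fun_esups mh 0%N).
Qed.

End lq.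

Section mixed_norms.
Local Open Scope ereal_scope.
Context d (T : measurableType d) (R : realType) (mu : {measure set T -> \bar R}).
Implicit Types (h : nat -> T -> R) (p q : R).

Definition Lp p (f : T -> \bar R) : \bar R := (\int[mu]_x (f x `^ p)) `^ p^-1%R.

Lemma Lp_ge0 p f : 0 <= Lp p f.
Proof. exact: poweR_ge0. Qed.

Lemma measurable_EFin_poweR p (f : T -> R) : measurable_fun setT f ->
  measurable_fun setT (fun x => (f x)%:E `^ p).
Proof.
move=> mf; apply: (measurableT_comp (measurable_poweR _)).
by apply/measurable_EFinP.
Qed.

Lemma LpK p f : (0 < p)%R -> Lp p f `^ p = \int[mu]_x (f x `^ p).
Proof.
by move=> p0; rewrite poweRVK//; apply: integral_ge0 => x _; rewrite poweR_ge0.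
Qed.

Lemma le_Lp p (f g : T -> \bar R) : (0 < p)%R -> measurable_fun setT f -> measurable_fun setT g ->
  (forall x, 0 <= f x) -> (forall x, f x <= g x) -> Lp p f <= Lp p g.
Proof.
move=> p0 mf mg f0 fg; apply: le_poweR; first by rewrite invr_ge0 ltW.
  by apply: integral_ge0 => x _; rewrite poweR_ge0.
apply: ge0_le_integral => //.
- by move=> x _; rewrite poweR_ge0.
- exact: (measurableT_comp (measurable_poweR _)).
- exact: (measurableT_comp (measurable_poweR _)).
- by move=> x _; apply: le_poweR => //; exact: ltW.
Qed.

Lemma lq_Lp_diag p h : (0 < p)%R -> (forall j, measurable_fun setT (h j)) ->
  lq p%:E (fun j => Lp p (fun x => (h j x)%:E)) = Lp p (fun x => lq p%:E (fun j => (h j x)%:E)).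
Proof.
move=> p0 mh; rewrite /lq /Lp; congr (_ `^ _).
under eq_eseriesr do rewrite LpK//.
rewrite -integral_nneseries//; last 2 first.
- by move=> j; exact: measurable_EFin_poweR.
- by move=> j x _; rewrite poweR_ge0.
apply: eq_integral => x _; rewrite poweRVK//.
by apply: nneseries_ge0 => j _ _; rewrite poweR_ge0.
Qed.

Lemma Lp_sum_le n p (g : nat -> T -> R) : (1 <= p)%R ->
  (forall j, measurable_fun setT (g j)) -> (forall j x, 0 <= g j x)%R ->
  Lp p (fun x => (\sum_(0 <= j < n) g j x)%R%:E) <= \sum_(0 <= j < n) Lp p (fun x => (g j x)%:E).
Proof.
move=> p1 mg g0.
have NE (f : T -> R) : (forall x, 0 <= f x)%R -> Lp p (EFin \o f) = 'N[mu]_p%:E[EFin \o f].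
  move=> f0; rewrite unlock /Lp.
  have -> : (fun x => (EFin \o f) x `^ p) = (fun x => `|(EFin \o f) x| `^ p).
    by apply/funext => x; rewrite /= ger0_norm.
  by [].
elim: n => [|n ih].
  rewrite big_nil /Lp; under eq_integral do rewrite big_nil poweR0r ?gt_eqF ?(lt_le_trans ltr01)//.
  by rewrite integral0 poweR0r// invr_eq0 gt_eqF// (lt_le_trans ltr01).
rewrite big_nat_recr//=; apply: le_trans (leeD2r _ ih).
have ms m : measurable_fun setT (fun x => \sum_(0 <= j < m) g j x)%R.
  by apply: measurable_sum.
have s0 m x : (0 <= \sum_(0 <= j < m) g j x)%R by apply: sumr_ge0.
rewrite (NE (fun x => \sum_(0 <= j < n) g j x)%R)// (NE (g n))// (NE (fun x => \sum_(0 <= j < n.+1) g j x)%R)//.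
have -> : EFin \o (fun x => \sum_(0 <= j < n.+1) g j x)%R =
   EFin \o ((fun x => \sum_(0 <= j < n) g j x)%R \+ g n)%R.
  by apply/funext => x /=; rewrite big_nat_recr.
exact: minkowski_EFin.
Qed.

Lemma Lp_nneseries_le p (g : nat -> T -> R) : (1 <= p)%R ->
  (forall j, measurable_fun setT (g j)) -> (forall j x, 0 <= g j x)%R ->
  Lp p (fun x => \sum_(0 <= j <oo) (g j x)%:E) <= \sum_(0 <= j <oo) Lp p (fun x => (g j x)%:E).
Proof.
move=> p1 mg g0; have p0 : (0 < p)%R by exact: lt_le_trans p1.
have S0 : 0 <= \sum_(0 <= j <oo) Lp p (fun x => (g j x)%:E).
  by apply: nneseries_ge0 => j _ _; exact: Lp_ge0.
rewrite poweRV_le//; last by apply: integral_ge0 => x _; rewrite poweR_ge0.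
pose s n x := (\sum_(0 <= j < n) g j x)%R.
have s0 n x : (0 <= s n x)%R by apply: sumr_ge0.
have sm x : {homo s ^~ x : m n / (m <= n)%N >-> (m <= n)%R}.
  by move=> m n mn; rewrite /s (big_cat_nat (leq0n m) mn)//= lerDl sumr_ge0.
have ms n : measurable_fun setT (s n) by apply: measurable_sum.
pose G n x := (s n x)%:E `^ p.
have Gm x m n : (m <= n)%N -> G m x <= G n x.
  by move=> mn; apply: le_poweR; rewrite ?lee_fin ?sm// ltW.
have mG n : measurable_fun setT (G n) by exact: measurable_EFin_poweR.
apply: (@le_trans _ _ (\int[mu]_x limn (G ^~ x))).
  apply: ge0_le_integral => //.
  - by move=> x _; rewrite poweR_ge0.
  - apply: (measurableT_comp (measurable_poweR _)).
    apply: (@ge0_emeasurable_sum _ _ _ setT (fun j x => (g j x)%:E) xpredT).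
      by move=> k x _ _; rewrite lee_fin.
    by move=> k _; apply/measurable_EFinP.
  - apply: (@emeasurable_fun_cvg _ _ _ _ G) => //.
    by move=> x _; apply: ereal_nondecreasing_is_cvgn => m n; exact: Gm.
  - move=> x _; have cG : cvgn (G ^~ x).
      by apply: ereal_nondecreasing_is_cvgn => m n; exact: Gm.
    have L0 : 0 <= limn (G ^~ x) by apply: lime_ge => //; apply: nearW => n; rewrite poweR_ge0.
    rewrite -le_poweRV//; last by apply: nneseries_ge0 => j _ _; rewrite lee_fin.
    apply: nneseries_le_ub => [j|n]; first by rewrite lee_fin.
    rewrite le_poweRV//; last by apply: sume_ge0 => j _; rewrite lee_fin.
    apply: (@le_trans _ _ (G n x)); first by rewrite /G /s sumEFin.
    apply: lime_ge => //; near=> m; apply: Gm; near: m; exact: nbhs_infty_ge.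
rewrite monotone_convergence//; last 2 first.
- by move=> n x _; rewrite poweR_ge0.
- by move=> x _ m n; exact: Gm.
apply: lime_le.
  apply: ereal_nondecreasing_is_cvgn => m n mn; apply: ge0_le_integral => //.
  - by move=> x _; rewrite poweR_ge0.
  - by move=> x _; exact: Gm.
apply: nearW => n; rewrite -LpK//; apply: le_poweR; rewrite ?Lp_ge0//; first exact: ltW.
apply: (le_trans (Lp_sum_le n p1 mg g0)).
rewrite (nneseries_split 0 n)// ?add0n ?leeDl//.
  by apply: nneseries_ge0 => j _ _; exact: Lp_ge0.
by move=> k _; exact: Lp_ge0.
Unshelve. all: by end_near. Qed.

(** Hoelder's inequality for the counting measure, applied to the sequences cut off at [n]. *)
Lemma discrete_hoelder n (u v : nat -> R) p q : (0 < p)%R -> (0 < q)%R ->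
  (p^-1 + q^-1 = 1)%R -> (forall j, 0 <= u j)%R -> (forall j, 0 <= v j)%R ->
  (\sum_(0 <= j < n) u j * v j <=
    (\sum_(0 <= j < n) u j `^ p) `^ p^-1 * (\sum_(0 <= j < n) v j `^ q) `^ q^-1)%R.
Proof.
move=> p0 q0 pq u0 v0.
pose t (w : nat -> R) j := if (j < n)%N then w j else 0%R.
have t0 w j : (forall j, 0 <= w j)%R -> (0 <= t w j)%R by rewrite /t; case: ifP.
have mt w : measurable_fun [set: nat] (t w) by [].
have := @hoelder _ _ R (@counting nat R) (t u) (t v) p q (mt u) (mt v) p0 q0 pq.
have E w r : (0 < r)%R -> (forall j, 0 <= w j)%R ->
   'N[(@counting nat R)]_r%:E[EFin \o t w] = ((\sum_(0 <= j < n) w j `^ r) `^ r^-1)%R%:E.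
  move=> r0 w0; rewrite Lnorm_counting// -poweR_EFin; congr (_ `^ _).
  rewrite (nneseries_split 0 n)//; last by move=> k _; rewrite poweR_ge0.
  rewrite add0n [X in _ + X]eseries0 ?adde0; last first.
    move=> j nj _; rewrite (_ : (EFin \o t w) j = 0) ?abse0 ?poweR0r ?gt_eqF//.
    by rewrite /= /t ltnNge nj.
  rewrite -sumEFin; apply: eq_big_nat => j /andP[_ jn].
  by rewrite /= /t jn ger0_norm// poweR_EFin.
rewrite !E//.
have -> : EFin \o (t u \* t v)%R = EFin \o t (fun j => u j * v j)%R.
  by apply/funext => j; rewrite /= /t; case: ifP => // _; rewrite mulr0.
rewrite E ?ltr01//; last by move=> j; rewrite mulr_ge0.
rewrite -EFinM lee_fin invr1 powRr1; last by apply: sumr_ge0 => j _; rewrite powR_ge0.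
congr (_ <= _)%R; apply: eq_bigr => j _; rewrite powRr1// mulr_ge0//.
Qed.

(* Minkowski's integral inequality, by duality: with [A_j = \int g_j], integrate
   Hoelder's inequality for [\sum_j A_j^(a-1) g_j]. *)
Lemma nneseries_integral_poweR_le (a : R) (g : nat -> T -> R) : (1 < a)%R ->
  (forall j, measurable_fun setT (g j)) -> (forall j x, 0 <= g j x)%R ->
  (\sum_(0 <= j <oo) (\int[mu]_x (g j x)%:E) `^ a) `^ a^-1 <=
  \int[mu]_x ((\sum_(0 <= j <oo) (g j x)%:E `^ a) `^ a^-1).
Proof.
move=> a1 mg g0; have a0 : (0 < a)%R by exact: lt_trans a1.
set I := (X in _ <= X).
have I0 : 0 <= I by apply: integral_ge0 => x _; rewrite poweR_ge0.
pose A j := \int[mu]_x (g j x)%:E.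
have A0 j : 0 <= A j by apply: integral_ge0 => x _; rewrite lee_fin.
have [->|If] := eqVneq I +oo; first by rewrite leey.
have mG : measurable_fun setT (fun x => (\sum_(0 <= j <oo) (g j x)%:E `^ a) `^ a^-1).
  apply: (measurableT_comp (measurable_poweR _)).
  apply: (@ge0_emeasurable_sum _ _ _ setT (fun j x => (g j x)%:E `^ a) xpredT).
    by move=> k x _ _; rewrite poweR_ge0.
  by move=> k _; exact: measurable_EFin_poweR.
have mgE j : measurable_fun setT (fun x => (g j x)%:E) by apply/measurable_EFinP.
have AI j : A j <= I.
  apply: ge0_le_integral => //.
  - by move=> x _; rewrite lee_fin.
  - move=> x _; rewrite le_poweRV ?lee_fin//.
      by apply: (@nneseries_term_le _ (fun j => (g j x)%:E `^ a)) => i; rewrite poweR_ge0.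
    by apply: nneseries_ge0 => i _ _; rewrite poweR_ge0.
have Ifin : I \is a fin_num by rewrite ge0_fin_numE// ltey.
have Afin j : A j \is a fin_num.
  by rewrite ge0_fin_numE//; apply: (le_lt_trans (AI j)); rewrite -ge0_fin_numE.
have sum0 : 0 <= \sum_(0 <= j <oo) A j `^ a.
  by apply: nneseries_ge0 => i _ _; rewrite poweR_ge0.
rewrite poweRV_le//; apply: nneseries_le_ub => [j|n]; first by rewrite poweR_ge0.
pose al j := fine (A j).
have al0 j : (0 <= al j)%R by rewrite fine_ge0.
pose S := (\sum_(0 <= j < n) al j `^ a)%R.
have S0 : (0 <= S)%R by apply: sumr_ge0 => j _; rewrite powR_ge0.
have -> : \sum_(0 <= j < n) A j `^ a = S%:E.
  by rewrite /S -sumEFin; apply: eq_bigr => j _; rewrite -poweR_EFin fineK.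
have [->|Sn] := eqVneq S 0%R; first by rewrite poweR_ge0.
have Sp : (0 < S)%R by rewrite lt_neqAle eq_sym Sn.
pose a' := (a / (a - 1))%R.
have am : (0 < a - 1)%R by rewrite subr_gt0.
have a'0 : (0 < a')%R by rewrite divr_gt0.
have aa' : (a'^-1 + a^-1 = 1)%R by rewrite /a'; field; rewrite gt_eqF//= gt_eqF.
have ea : ((a - 1) * a' = a)%R by rewrite /a'; field; rewrite gt_eqF.
(* Since the series is truncated, [S] is finite and positive and this factor can be divided out,
   which leaves [S ^ (1/a) <= I]. *)
have key : S%:E <= (S `^ a'^-1)%R%:E * I.
  have mu_ j : measurable_fun setT (fun x => (al j `^ (a - 1) * g j x)%R%:E).
    by apply/measurable_EFinP; exact: measurable_funM.
  have mS : measurable_fun setT (fun x => (\sum_(0 <= j < n) al j `^ (a - 1) * g j x)%R%:E).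
    by apply/measurable_EFinP; apply: measurable_sum => j; exact: measurable_funM.
  have -> : S%:E = \int[mu]_x (\sum_(0 <= j < n) al j `^ (a - 1) * g j x)%R%:E.
    under eq_integral do rewrite -sumEFin.
    rewrite ge0_integral_sum//; last by move=> j x _; rewrite lee_fin mulr_ge0 ?powR_ge0.
    rewrite /S -sumEFin; apply: eq_bigr => j _.
    under eq_integral do rewrite EFinM.
    rewrite ge0_integralZl_EFin ?powR_ge0//; last by move=> x _; rewrite lee_fin.
    have -> : \int[mu]_x (g j x)%:E = (al j)%:E by rewrite /al fineK.
    by rewrite -EFinM mulrC mulr_powRB1.
  rewrite -ge0_integralZl_EFin ?powR_ge0//; last by move=> x _; rewrite poweR_ge0.
  apply: ge0_le_integral => //.
  - by move=> x _; rewrite lee_fin; apply: sumr_ge0 => j _; rewrite mulr_ge0 ?powR_ge0.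
  - exact: measurable_funeM.
  - move=> x _.
    have := discrete_hoelder n a'0 a0 aa' (fun j => powR_ge0 (al j) (a - 1)) (g0 ^~ x).
    rewrite -lee_fin => /le_trans; apply.
    under eq_bigr do rewrite -powRrM ea.
    rewrite EFinM; apply: lee_wpmul2l; first by rewrite lee_fin powR_ge0.
    rewrite -poweR_EFin; apply: le_poweR; first by rewrite invr_ge0 ltW.
      by rewrite lee_fin; apply: sumr_ge0 => j _; rewrite powR_ge0.
    rewrite -sumEFin (nneseries_split 0 n)//; last by move=> j _; rewrite poweR_ge0.
    by rewrite add0n leeDl// nneseries_ge0// => j _ _; rewrite poweR_ge0.
rewrite -(fineK Ifin) -EFinM lee_fin in key.
have i0 : (0 <= fine I)%R by rewrite fine_ge0.
rewrite -(fineK Ifin) poweR_EFin lee_fin.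
have Se : (S = S `^ a'^-1 * S `^ a^-1)%R.
  by rewrite -powRD ?aa' ?powRr1// Sn implybT.
rewrite {1}Se ler_pM2l ?powR_gt0// in key.
rewrite -[leLHS](powRr1 S0) -[X in (S `^ X)%R](mulVf (lt0r_neq0 a0)) powRrM.
by apply: ge0_ler_powR; rewrite ?nnegrE ?powR_ge0// ltW.
Qed.

(** For [q <= p] the two norms agree at the exponent [p], and [l_q] dominates [l_p]. For finite
    [q > p] it is Minkowski's integral inequality with exponent [q / p > 1] for the functions
    [h j ^ p], so that [p < 1] is no obstacle. *)
Lemma lq_Lp_le p (q : \bar R) h : (0 < p)%R -> 0 < q ->
  (forall j, measurable_fun setT (h j)) -> (forall j x, 0 <= h j x)%R ->
  lq (Order.max p%:E q) (fun j => Lp p (fun x => (h j x)%:E)) <=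
  Lp p (fun x => lq q (fun j => (h j x)%:E)).
Proof.
move=> p0 q0 mh h0.
have h0E j x : 0 <= (h j x)%:E by rewrite lee_fin.
have mhE j : measurable_fun setT (fun x => (h j x)%:E) by apply/measurable_EFinP.
have mlq r : 0 < r -> measurable_fun setT (fun x => lq r (fun j => (h j x)%:E)).
  by move=> r0; exact: (measurable_lq (h := fun j x => (h j x)%:E)).
have [qp|pq] := leP q p%:E.
  rewrite lq_Lp_diag//; apply: le_Lp => //; [exact: mlq|exact: mlq| |].
  - by move=> x; apply: lq_ge0.
  - by move=> x; exact: lq_antimono.
case: q q0 pq mlq => [q| |]// q0 pq mlq; last first.
  apply: ge_ereal_sup => _ [j _ <-]; apply: le_Lp => //; first exact: mlq.
  by move=> x; exact: (@lq_ge _ +oo _ j).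
rewrite !lte_fin in q0 pq.
have a1 : (1 < q / p)%R by rewrite ltr_pdivlMr// mul1r.
have mg j : measurable_fun setT (fun x => (h j x `^ p)%R).
  exact: (measurableT_comp (measurable_powR p) (mh j)).
have := nneseries_integral_poweR_le a1 mg (fun j x => powR_ge0 (h j x) p).
rewrite invf_div => key.
rewrite /lq [leRHS]/Lp le_poweRV//; last 2 first.
- exact: poweR_ge0.
- by apply: integral_ge0 => x _; rewrite poweR_ge0.
rewrite -poweRrM (mulrC q^-1%R).
have -> : \sum_(0 <= j <oo) Lp p (fun x => (h j x)%:E) `^ q =
    \sum_(0 <= j <oo) (\int[mu]_x (h j x `^ p)%:E) `^ (q / p).
  by apply: eq_eseriesr => j _; rewrite /Lp -poweRrM mulrC.
apply: (le_trans key); rewrite le_eqVlt; apply/orP; left; apply/eqP.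
apply: eq_integral => x _; rewrite -poweRrM (mulrC q^-1%R); congr (_ `^ _).
apply: eq_eseriesr => j _; rewrite -poweR_EFin -poweRrM (mulrC q) mulVKf// gt_eqF//.
Qed.

(** The dual case distinction: for [q < p] it is the triangle inequality in [L_(p/q)] for the
    functions [h j ^ q], where [p / q > 1]. *)
Lemma Lp_lq_le p (q : \bar R) h : (0 < p)%R -> 0 < q ->
  (forall j, measurable_fun setT (h j)) -> (forall j x, 0 <= h j x)%R ->
  Lp p (fun x => lq q (fun j => (h j x)%:E)) <=
  lq (Order.min p%:E q) (fun j => Lp p (fun x => (h j x)%:E)).
Proof.
move=> p0 q0 mh h0.
have h0E j x : 0 <= (h j x)%:E by rewrite lee_fin.
have mlq r : 0 < r -> measurable_fun setT (fun x => lq r (fun j => (h j x)%:E)).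
  move=> r0; apply: (measurable_lq (h := fun j x => (h j x)%:E)) => //.
  by move=> j; apply/measurable_EFinP.
have [pq|qp] := leP p%:E q.
  rewrite lq_Lp_diag//; apply: le_Lp => //; [exact: mlq|exact: mlq| |].
  - by move=> x; apply: lq_ge0.
  - by move=> x; exact: lq_antimono.
case: q q0 qp mlq => [q| |]// q0 qp mlq.
rewrite !lte_fin in q0 qp.
have a1 : (1 <= p / q)%R by rewrite ler_pdivlMr// mul1r ltW.
have mg j : measurable_fun setT (fun x => (h j x `^ q)%R).
  exact: (measurableT_comp (measurable_powR q) (mh j)).
have := Lp_nneseries_le a1 mg (fun j x => powR_ge0 (h j x) q).
rewrite /Lp invf_div => key.
rewrite /lq le_poweRV//; last 2 first.
- exact: poweR_ge0.
- by apply: nneseries_ge0 => j _ _; rewrite poweR_ge0.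
rewrite -poweRrM (mulrC p^-1%R).
have -> : \sum_(0 <= j <oo) (\int[mu]_x (h j x)%:E `^ p) `^ p^-1 `^ q =
    \sum_(0 <= j <oo) (\int[mu]_x (h j x `^ q)%:E `^ (p / q)) `^ (q / p).
  apply: eq_eseriesr => j _; rewrite -poweRrM mulrC.
  have -> : \int[mu]_x (h j x)%:E `^ p = \int[mu]_x (h j x `^ q)%:E `^ (p / q).
    by apply: eq_integral => x _; rewrite -poweR_EFin -poweRrM [(q * _)%R]mulrC divfK// gt_eqF.
  by [].
apply: le_trans key; rewrite le_eqVlt; apply/orP; left; apply/eqP; congr (_ `^ _).
apply: eq_integral => x _; rewrite -poweRrM mulrC; congr (_ `^ _).
Qed.

End mixed_norms.

(** * Dyadic cubes and Morrey norms *)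

Section dyadic.
Context (R : realType) (d : nat).
Local Notation V := 'rV[R]_d.
Local Notation lam := (lebesgue_rV R d).
Local Notation cube j k := (@dyadic_cube R d j k).

Lemma side_gt0 j : 0 < side R j.
Proof. by rewrite exprz_gt0. Qed.

Lemma dyadic_cubeE j (k : 'rV[int]_d) :
  cube j k = [set x : V | forall i, side R j * (k ord0 i)%:~R <= x ord0 i
    < side R j * ((k ord0 i)%:~R + 1)].
Proof.
have s0 := side_gt0 j.
apply/seteqP; split => x /=.
  move=> [y y01 <-] i; have /andP[y0 y1] := y01 i; rewrite !mxE.
  by rewrite ler_pM2l// ltr_pM2l// lerDr y0 addrC ltrD2l.
move=> h; exists ((side R j)^-1 *: x - map_mx intr k).
  move=> i; have /andP[h1 h2] := h i; rewrite !mxE subr_ge0 ltrBlDl.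
  rewrite mulrC ler_pdivlMr// ltr_pdivrMr//.
  by rewrite ![_ * side R j]mulrC h1 h2.
by rewrite subrK scalerA mulfV ?scale1r// gt_eqF.
Qed.

Lemma measurable_dyadic_cube j (k : 'rV[int]_d) : measurable (cube j k).
Proof.
rewrite dyadic_cubeE.
rewrite (_ : [set _ | _] = \big[setI/setT]_(i < d)
  (@rV_coord R d i @^-1` `[side R j * (k ord0 i)%:~R, side R j * ((k ord0 i)%:~R + 1)[%classic)).
  apply: bigsetI_measurable => i _; rewrite -[X in measurable X]setTI.
  exact: measurable_rV_coord.
rewrite -bigcap_seq; apply/seteqP; split => x /=.
  by move=> h i _; rewrite /= in_itv /=; apply: h.
by move=> h i; have := h i (mem_index_enum _); rewrite /= in_itv.
Qed.

Lemma lebesgue_dyadic_cube j (k : 'rV[int]_d) :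
  lam (cube j k) = (side R j ^+ d)%:E.
Proof.
have s0 := side_gt0 j; have mP := measurable_dyadic_cube j k.
rewrite -[cube j k]setIT -integral_indic//.
rewrite (@ge0_integral_affine _ _ (side R j) (side R j *: map_mx intr k))//; last first.
  by apply/measurable_EFinP; exact: measurable_indic.
rewrite -[RHS]mule1; congr (_ * _)%E.
pose g : R -> R := \1_(`[0, 1[%classic : set R).
have mg : measurable_fun setT g by exact: measurable_indic.
have := @ge0_integral_prod_rV R d g 1 mg (fun x => ler0n R (x \in _)).
rewrite expr1n => <-; last first.
  rewrite [LHS]integral_indic// setIT; apply: etrans (lebesgue_measure_itv _) _.
  by rewrite /= lte_fin ltr01 sube0.
apply: eq_integral => x _; congr EFin; rewrite indicE.
have [xP|xP] := boolP (_ \in _).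
  rewrite big1// => i _; rewrite /g indicE; move: xP; rewrite dyadic_cubeE inE /= => /(_ i).
  rewrite !mxE -mulrDr ler_pM2l// ltr_pM2l// lerDr addrC ltrD2l => h.
  by rewrite mem_set//= in_itv.
apply/esym/eqP; rewrite prodf_seq_eq0; apply/hasP.
move: xP; rewrite notin_setE dyadic_cubeE /= => /existsNP[i h].
exists i; rewrite ?mem_index_enum//=; rewrite /g indicE.
rewrite (_ : _ \in _ = false)//; apply/negbTE; rewrite notin_setE /= in_itv/= => h2.
by apply: h; rewrite !mxE -mulrDr ler_pM2l// ltr_pM2l// lerDr addrC ltrD2l.
Qed.

Lemma volume_dyadic_cube j (k : 'rV[int]_d) : volume (cube j k) = side R j ^+ d.
Proof. by rewrite /volume lebesgue_dyadic_cube. Qed.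

Lemma exists_dyadic_cube j (x : V) : exists k : 'rV[int]_d, cube j k x.
Proof.
exists (\row_i Num.floor (x ord0 i / side R j)).
have s0 := side_gt0 j.
rewrite dyadic_cubeE => i /=; rewrite !mxE mulrC -ler_pdivlMr// floor_le.
rewrite mulrC -ltr_pdivrMr//.
by have /andP[_] := floor_itv (x ord0 i / side R j); rewrite intrD.
Qed.

Lemma dyadic_cube_dist j (k : 'rV[int]_d) (x y : V) : cube j k x -> cube j k y ->
  `|x - y| <= side R j.
Proof.
have s0 := side_gt0 j.
rewrite dyadic_cubeE /= => hx hy; apply: rV_norm_le => [|i]; first exact: ltW.
rewrite !mxE ler_norml; have := hx i; have := hy i.
rewrite !mulrDr !mulr1; move: (side R j * _) => u; lra.
Qed.

Lemma exists_side (t : R) : 0 < t -> exists j, t / 2 < side R j /\ side R j <= t.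
Proof.
move=> t0; pose m := Num.floor (ln t / ln 2).
have l2 : 0 < ln 2 :> R by rewrite ln_gt0// ltr1n.
exists (- m); rewrite /side opprK -powR_intmul//.
have /andP[m1 m2] := floor_itv (ln t / ln 2).
have p0 : 0 < 2 `^ m%:~R :> R by rewrite powR_gt0.
split; last first.
  by rewrite -ler_ln ?posrE// ln_powR -ler_pdivlMr.
rewrite ltr_pdivrMr// -ltr_ln ?posrE ?mulr_gt0// lnM ?posrE// ln_powR.
by move: m2; rewrite ltr_pdivrMr// intrD mulrDl mul1r.
Qed.

End dyadic.

Section morrey.
Local Open Scope ereal_scope.
Context (R : realType) (d : nat).
Local Notation V := 'rV[R]_d.
Local Notation lam := (lebesgue_rV R d).
Local Notation cube j k := (@dyadic_cube R d j k).
Variables (p : R) (phi : R -> R).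
Hypotheses (p0 : (0 < p)%R) (hphi : class_G d p phi).

(** With the factor [|P|^(-1/p)] absorbed, this is what multiplies the plain [L_p] norm over a cube
    of side [t]. It is nonincreasing, while [phi t = t ^ (d/p) * rphi t] is nondecreasing. *)
Definition rphi (t : R) : R := (t `^ (- (d%:R / p)) * phi t)%R.

Lemma rphi_gt0 t : (0 < t)%R -> (0 < rphi t)%R.
Proof. by move=> t0; have [h _ _] := hphi; rewrite mulr_gt0 ?powR_gt0 ?h. Qed.

Lemma rphi_noninc t u : (0 < t)%R -> (t <= u)%R -> (rphi u <= rphi t)%R.
Proof. by have [_ _ h] := hphi; exact: h. Qed.

Definition cubeLp j k (F : V -> \bar R) : \bar R :=
  (\int[lam]_(x in cube j k) (F x `^ p)) `^ p^-1%R.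

Lemma cubeLp_ge0 j k F : 0 <= cubeLp j k F.
Proof. exact: poweR_ge0. Qed.

Lemma morrey_normE F : morrey_norm phi p F =
  ereal_sup [set (rphi (side R j))%:E * cubeLp j k F | j in [set: int] & k in [set: 'rV[int]_d]].
Proof.
rewrite /morrey_norm; congr ereal_sup; apply/funext => z; apply/propext.
suff E j k : (phi (side R j))%:E * ((volume (cube j k))^-1%:E *
        \int[lam]_(y in cube j k) (F y `^ p)) `^ p^-1%R = (rphi (side R j))%:E * cubeLp j k F.
  by split => -[j _ [k _ <-]]; exists j => //; exists k.
have s0 := side_gt0 R j.
rewrite volume_dyadic_cube poweRM; last 2 first.
- by rewrite lee_fin invr_ge0 exprn_ge0// ltW.
- by apply: integral_ge0 => x _; rewrite poweR_ge0.
rewrite muleA; congr (_ * _); rewrite poweR_EFin -EFinM; congr EFin.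
rewrite mulrC; congr (_ * _)%R; rewrite -powR_mulrn ?(ltW s0)// -powRN -powRrM.
by rewrite mulNr.
Qed.

Lemma morrey_norm_ub F j k : (rphi (side R j))%:E * cubeLp j k F <= morrey_norm phi p F.
Proof. by rewrite morrey_normE; apply: ereal_sup_ubound; exists j => //; exists k. Qed.

Lemma morrey_norm_le F M :
  (forall j k, (rphi (side R j))%:E * cubeLp j k F <= M) -> morrey_norm phi p F <= M.
Proof. by move=> h; rewrite morrey_normE; apply: ge_ereal_sup => _ [j _ [k _ <-]]. Qed.

Lemma morrey_norm_ge0 (F : V -> \bar R) : 0 <= morrey_norm phi p F.
Proof.
apply: le_trans (morrey_norm_ub F 0 0).
by rewrite mule_ge0 ?cubeLp_ge0// lee_fin ltW// rphi_gt0// side_gt0.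
Qed.

Lemma le_cubeLp j k F G : measurable_fun setT F -> measurable_fun setT G ->
  (forall x, 0 <= F x) -> (forall x, F x <= G x) -> cubeLp j k F <= cubeLp j k G.
Proof.
move=> mF mG F0 FG; apply: le_poweR; first by rewrite invr_ge0 ltW.
  by apply: integral_ge0 => x _; rewrite poweR_ge0.
apply: ge0_le_integral => //.
- exact: measurable_dyadic_cube.
- by move=> x _; rewrite poweR_ge0.
- by apply: measurable_funTS; exact: (measurableT_comp (measurable_poweR _)).
- by apply: measurable_funTS; exact: (measurableT_comp (measurable_poweR _)).
- by move=> x _; apply: le_poweR => //; exact: ltW.
Qed.

Lemma cubeLpZ j k (c : R) F : (0 <= c)%R -> measurable_fun setT F -> (forall x, 0 <= F x) ->
  cubeLp j k (fun x => c%:E * F x) = c%:E * cubeLp j k F.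
Proof.
move=> c0 mF F0; rewrite /cubeLp.
under eq_integral do rewrite poweRM ?lee_fin// poweR_EFin.
rewrite ge0_integralZl_EFin ?powR_ge0//; last 3 first.
- exact: measurable_dyadic_cube.
- by move=> x _; rewrite poweR_ge0.
- by apply: measurable_funTS; exact: (measurableT_comp (measurable_poweR _)).
rewrite poweRM ?lee_fin ?powR_ge0//; last by apply: integral_ge0 => x _; rewrite poweR_ge0.
by rewrite -poweR_EFin poweRK// lee_fin.
Qed.

Lemma le_morrey_norm (F G : V -> \bar R) : measurable_fun setT F -> measurable_fun setT G ->
  (forall x, 0 <= F x) -> (forall x, F x <= G x) -> morrey_norm phi p F <= morrey_norm phi p G.
Proof.
move=> mF mG F0 FG; apply: morrey_norm_le => j k.
apply: le_trans (morrey_norm_ub G j k); apply: lee_wpmul2l; last exact: le_cubeLp.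
by rewrite lee_fin ltW// rphi_gt0// side_gt0.
Qed.

Lemma morrey_normZ (c : R) (F : V -> \bar R) : (0 <= c)%R -> measurable_fun setT F -> (forall x, 0 <= F x) ->
  morrey_norm phi p (fun x => c%:E * F x) = c%:E * morrey_norm phi p F.
Proof.
move=> c0 mF F0; rewrite !morrey_normE -ereal_supZl//; last first.
  by apply/set0P; exists ((rphi (side R 0))%:E * cubeLp 0 0 F); exists 0%R => //; exists 0%R.
congr ereal_sup; apply/seteqP; split => z /=.
  move=> [j _ [k _ <-]]; exists ((rphi (side R j))%:E * cubeLp j k F).
    by exists j => //; exists k.
  by rewrite cubeLpZ// muleCA.
move=> [_ [j _ [k _ <-]] <-]; exists j => //; exists k => //.
by rewrite cubeLpZ// muleCA.
Qed.

(** Multiplying by the indicator of the cube makes the mixed norm inequalities on the whole space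
    available on each cube. *)
Lemma cubeLp_setT j k F : (forall x, 0 <= F x) ->
  cubeLp j k F = Lp lam p (fun x => F x * (\1_(cube j k) x)%:E).
Proof.
move=> F0; rewrite /cubeLp /Lp [in LHS]integral_mkcond.
have -> // : (fun x => F x `^ p) \_ (cube j k) = (fun x => (F x * (\1_(cube j k) x)%:E) `^ p).
apply/funext => x; rewrite patchE indicE; case: ifP => _; rewrite ?mule1// mule0 poweR0r// gt_eqF//.
Qed.

Lemma lq_indic (q : \bar R) (a : nat -> R) (b : bool) : 0 < q -> (forall j, 0 <= a j)%R ->
  lq q (fun j => (a j)%:E) * (b%:R)%:E = lq q (fun j => (a j * b%:R)%R%:E).
Proof.
move=> q0 a0; rewrite muleC -lqZ//.
by rewrite (_ : (fun j => _) = (fun j => (a j * b%:R)%R%:E))//; apply/funext => j; rewrite -EFinM mulrC.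
Qed.

Lemma cubeLp_lq_le j k (q : \bar R) (h : nat -> V -> R) : 0 < q ->
  (forall i, measurable_fun setT (h i)) -> (forall i x, 0 <= h i x)%R ->
  cubeLp j k (fun x => lq q (fun i => (h i x)%:E)) <=
  lq (Order.min p%:E q) (fun i => cubeLp j k (fun x => (h i x)%:E)).
Proof.
move=> q0 mh h0; have mP := @measurable_dyadic_cube R d j k.
rewrite cubeLp_setT; last by move=> x; apply: lq_ge0 => // i; rewrite lee_fin.
under eq_fun do rewrite lq_indic//.
have m1 i : measurable_fun setT (fun x => h i x * \1_(cube j k) x)%R.
  by apply: measurable_funM => //; exact: measurable_indic.
apply: le_trans (Lp_lq_le lam p0 q0 m1 _) _; first by move=> i x; rewrite mulr_ge0.
apply: le_lq.
- by rewrite lt_min q0 lte_fin p0.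
- by move=> i; exact: Lp_ge0.
- by move=> i; rewrite cubeLp_setT// => x; rewrite lee_fin.
Qed.

Lemma morrey_norm_lq_le (q : \bar R) (h : nat -> V -> R) : 0 < q ->
  (forall i, measurable_fun setT (h i)) -> (forall i x, 0 <= h i x)%R ->
  morrey_norm phi p (fun x => lq q (fun i => (h i x)%:E)) <=
  lq (Order.min p%:E q) (fun i => morrey_norm phi p (fun x => (h i x)%:E)).
Proof.
move=> q0 mh h0; have m0 : 0 < Order.min p%:E q by rewrite lt_min q0 lte_fin p0.
have r0 j : (0 <= rphi (side R j))%R by rewrite ltW// rphi_gt0// side_gt0.
apply: morrey_norm_le => j k; apply: (@le_trans _ _ ((rphi (side R j))%:E *
    lq (Order.min p%:E q) (fun i => cubeLp j k (fun x => (h i x)%:E)))).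
  by apply: lee_wpmul2l; [rewrite lee_fin|exact: cubeLp_lq_le].
rewrite -lqZ//; last by move=> i; exact: cubeLp_ge0.
apply: le_lq => // i; last exact: morrey_norm_ub.
by rewrite mule_ge0 ?cubeLp_ge0// lee_fin.
Qed.

Lemma cubeLp_le_Lp j k F : measurable_fun setT F -> cubeLp j k F <= Lp lam p F.
Proof.
move=> mF; apply: le_poweR; first by rewrite invr_ge0 ltW.
  by apply: integral_ge0 => x _; rewrite poweR_ge0.
apply: ge0_subset_integral => //.
- exact: measurable_dyadic_cube.
- exact: (measurableT_comp (measurable_poweR _)).
- by move=> x _; rewrite poweR_ge0.
Qed.

Lemma morrey_norm_le_Lp (C : R) F : measurable_fun setT F ->
  (forall t, 0 < t -> rphi t <= C)%R -> morrey_norm phi p F <= C%:E * Lp lam p F.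
Proof.
move=> mF hC; apply: morrey_norm_le => j k; apply: lee_pmul.
- by rewrite lee_fin ltW// rphi_gt0// side_gt0.
- exact: cubeLp_ge0.
- by rewrite lee_fin hC// side_gt0.
- exact: cubeLp_le_Lp.
Qed.

(* The cubes of side [2^n] with these indices are the parts of [-2^n, 2^n)^d in the
   [2^d] orthants. *)
Definition orthant_index (b : {ffun 'I_d -> bool}) : 'rV[int]_d := \row_i (if b i then 0 else -1)%R.

Lemma cover_orthants n (x : V) : (forall i, - 2 ^+ n <= x ord0 i < 2 ^+ n)%R ->
  exists b, cube (- n%:Z)%R (orthant_index b) x.
Proof.
move=> h; exists [ffun i => (0 <= x ord0 i)%R]; rewrite dyadic_cubeE => i /=.
rewrite !mxE ffunE /side opprK -exprnP; have := h i.
by case: (leP 0%R (x ord0 i)) => x0; rewrite ?mulr0 ?add0r ?mulr1 ?mulrN1 ?addNr ?mulr0; lra.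
Qed.

(** A dyadic cube never crosses a coordinate hyperplane, so the exhausting sets [B n] need [2 ^+ d]
    cubes each; on each of them the [L_p] norm is at most the Morrey norm divided by [c]. *)
Lemma Lp_le_morrey_norm (c : R) (F : V -> \bar R) : (0 < c)%R -> measurable_fun setT F ->
  (forall x, 0 <= F x) -> (forall t, 0 < t -> c <= rphi t)%R ->
  Lp lam p F <= ((2 ^+ d) `^ p^-1 / c)%R%:E * morrey_norm phi p F.
Proof.
move=> c0 mF F0 hc; set M := morrey_norm phi p F.
have M0 : 0 <= M by exact: morrey_norm_ge0.
have mFp : measurable_fun setT (fun x => F x `^ p).
  exact: (measurableT_comp (measurable_poweR _)).
have ic0 : 0 <= (c^-1)%:E by rewrite lee_fin invr_ge0 ltW.
have hcube j k : cubeLp j k F <= (c^-1)%:E * M.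
  have := morrey_norm_ub F j k; rewrite -/M => h.
  rewrite -[leLHS]mul1e -(mulVf (lt0r_neq0 c0)) EFinM -muleA; apply: lee_wpmul2l => //.
  apply: le_trans h; apply: lee_wpmul2r; first exact: cubeLp_ge0.
  by rewrite lee_fin hc// side_gt0.
pose B n : set V := [set x | forall i, (- 2 ^+ n <= x ord0 i < 2 ^+ n)%R].
have mB n : measurable (B n).
  rewrite (_ : B n = \big[setI/setT]_(i < d)
    (@rV_coord R d i @^-1` `[- 2 ^+ n, 2 ^+ n[%classic)%R).
    apply: bigsetI_measurable => i _; rewrite -[X in measurable X]setTI.
    exact: measurable_rV_coord.
  rewrite -bigcap_seq; apply/seteqP; split => x /=.
    by move=> h i _; rewrite /= in_itv /=; apply: h.
  by move=> h i; have := h i (mem_index_enum _); rewrite /= in_itv.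
have ndB : nondecreasing_seq B.
  move=> m n mn; rewrite subsetEset => x /= h i; have /andP[h1 h2] := h i.
  have e : (2 ^+ m <= 2 ^+ n :> R)%R by rewrite ler_weXn2l// ler1n.
  by rewrite (lt_le_trans h2 e) andbT (le_trans _ h1)// lerN2.
have UB : \bigcup_n B n = setT.
  apply/seteqP; split => // x _; exists (Num.trunc `|x|).+1 => // i.
  have h : (`|x| < 2 ^+ (Num.trunc `|x|).+1)%R.
    apply: (lt_le_trans (truncnS_gt _)).
    by rewrite -natrX ler_nat ltnW// ltn_expl.
  have := le_lt_trans (le_rV_norm x i) h; rewrite ltr_norml => /andP[h1 h2].
  by rewrite h2 (ltW h1).
have bound n : \int[lam]_(x in B n) (F x `^ p) <= (2 ^+ d)%:E * ((c^-1)%:E * M) `^ p.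
  apply: (@le_trans _ _ (\int[lam]_x (\sum_(b : {ffun 'I_d -> bool})
      ((fun x => F x `^ p) \_ (cube (- n%:Z)%R (orthant_index b))) x))).
    rewrite integral_mkcond; apply: ge0_le_integral => //.
    - by move=> x _; rewrite erestrict_ge0// => y _; rewrite poweR_ge0.
    - by apply/(measurable_restrictT _ (mB n)); exact: measurable_funTS.
    - apply: (@emeasurable_sum _ _ _ setT _ _
        (fun b : {ffun 'I_d -> bool} => (fun x => F x `^ p) \_ (cube (- n%:Z)%R (orthant_index b)))) => b.
      apply/(measurable_restrictT _ (@measurable_dyadic_cube R d _ _)).
      exact: measurable_funTS.
    - move=> x _; rewrite patchE; case: ifPn => [|_].
        rewrite inE => /cover_orthants[b xb].
        rewrite (bigD1 b)//= patchE mem_set// leeDl// sume_ge0// => b' _.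
        by rewrite erestrict_ge0// => y _; rewrite poweR_ge0.
      by apply: sume_ge0 => b _; rewrite erestrict_ge0// => y _; rewrite poweR_ge0.
  rewrite ge0_integral_sum//; last 2 first.
  - move=> b; apply/(measurable_restrictT _ (@measurable_dyadic_cube R d _ _)).
    exact: measurable_funTS.
  - by move=> b x _; rewrite erestrict_ge0// => y _; rewrite poweR_ge0.
  apply: (@le_trans _ _ (\sum_(b : {ffun 'I_d -> bool}) ((c^-1)%:E * M) `^ p)).
    apply: lee_sum => b _; rewrite -integral_mkcond.
    rewrite -poweRV_le//; first exact: hcube.
    - by apply: integral_ge0 => x _; rewrite poweR_ge0.
    - exact: mule_ge0.
  rewrite (eq_bigr (fun=> 1%:E * ((c^-1)%:E * M) `^ p)); last by move=> b _; rewrite mul1e.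
  rewrite -ge0_sume_distrl// sumEFin sumr_const card_ffun card_bool card_ord.
  by rewrite natrX.
have cv : (\int[lam]_(x in B n) (F x `^ p)) @[n --> \oo] --> \int[lam]_(x in \bigcup_n B n) (F x `^ p).
  apply: ge0_nondecreasing_set_cvg_integral => //.
  - by move=> n; exact: measurable_funTS.
  - by move=> n x _; rewrite poweR_ge0.
rewrite UB in cv.
rewrite /Lp poweRV_le//; last 2 first.
- by apply: integral_ge0 => x _; rewrite poweR_ge0.
- by rewrite mule_ge0// lee_fin divr_ge0 ?powR_ge0// ltW.
rewrite EFinM -muleA poweRM ?mule_ge0 ?lee_fin ?powR_ge0//.
rewrite [_%:E `^ p]poweR_EFin -powRrM mulVf ?gt_eqF// powRr1 ?exprn_ge0//.
rewrite -(cvg_lim _ cv)//; apply: lime_le; first by apply/cvg_ex; eexists; exact: cv.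
exact: nearW.
Qed.

End morrey.

(** * The limit condition as a two-sided bound *)

Section limit_condition.
Context (R : realType) (d : nat) (p : R) (phi : R -> R).
Hypothesis hphi : class_G d p phi.
Local Notation g := (rphi d p phi).

Lemma rphi_cvg0 : (g t)%:E @[t --> 0^'+] --> ereal_sup [set (g t)%:E | t in [set t : R | 0 < t]].
Proof.
have H : {in Interval (BRight (0 : R)) (BInfty _ false) &, nonincreasing_fun (EFin \o g)}.
  move=> x y; rewrite !in_itv/= !andbT => x0 y0 xy.
  by rewrite lee_fin rphi_noninc.
have := @nonincreasing_at_right_cvge R (EFin \o g) 0 (BInfty _ false) isT H.
rewrite (_ : [set` _] = [set t : R | 0 < t])//.
by apply/seteqP; split => x /=; rewrite in_itv/= andbT.
Qed.

Lemma rphi_cvgy : (g t)%:E @[t --> +oo] --> ereal_inf [set (g t)%:E | t in [set t : R | 0 < t]].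
Proof.
(* Monotonicity of [g] is known on positive arguments only; [g1] is monotone on the whole line and
   agrees with [g] near infinity. *)
pose g1 t := (g (Num.max t 1))%:E.
have m0 (t : R) : 0 < Num.max t 1 by rewrite lt_max ltr01 orbT.
have h : g1 @ +oo --> ereal_inf (range g1).
  apply: nonincreasing_cvge => x y xy; rewrite lee_fin; apply: rphi_noninc => //.
  by rewrite ge_max !le_max xy lexx !orbT.
have -> : ereal_inf [set (g t)%:E | t in [set t : R | 0 < t]] = ereal_inf (range g1).
  apply/eqP; rewrite eq_le; apply/andP; split.
    apply: le_ereal_inf_tmp => _ [t _ <-]; apply: ereal_inf_lbound.
    by exists (Num.max t 1) => //=; exact: m0.
  apply: le_ereal_inf_tmp => _ [t /= t0 <-]; apply: ge_ereal_inf; exists (g1 t); first by exists t.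
  by rewrite lee_fin rphi_noninc// le_max lexx.
apply: cvg_trans h; apply: near_eq_cvg; near=> t; rewrite /g1 max_l//.
Unshelve. all: by end_near. Qed.

Lemma limit_conditionP : limit_condition d p phi <->
  exists c C : R, [/\ 0 < c, 0 < C & forall t, 0 < t -> c <= g t <= C].
Proof.
rewrite /limit_condition.
have -> : lim ((t `^ (- (d%:R / p)) * phi t)%:E @[t --> 0^'+]) =
  ereal_sup [set (g t)%:E | t in [set t : R | 0 < t]] by apply: cvg_lim => //; exact: rphi_cvg0.
have -> : lim ((t `^ (- (d%:R / p)) * phi t)%:E @[t --> +oo%R]) =
  ereal_inf [set (g t)%:E | t in [set t : R | 0 < t]] by apply: cvg_lim => //; exact: rphi_cvgy.
have g0 t : 0 < t -> 0 < g t by exact: rphi_gt0.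
split => [[h1 h2]|[c [C [c0 C0 h]]]]; last first.
  split.
    apply: le_lt_trans (ltry C); apply: ge_ereal_sup => _ [t /= t0 <-].
    by rewrite lee_fin; have /andP[] := h t t0.
  apply: (@lt_le_trans _ _ c%:E); first by rewrite lte_fin.
  apply: le_ereal_inf_tmp => _ [t /= t0 <-].
  by rewrite lee_fin; have /andP[] := h t t0.
have ub (t : R) : (0 < t)%R -> ((g t)%:E <= ereal_sup [set (g t)%:E | t in [set t : R | (0 < t)%R]])%E.
  by move=> t0; apply: ereal_sup_ubound; exists t.
have lb (t : R) : (0 < t)%R -> (ereal_inf [set (g t)%:E | t in [set t : R | (0 < t)%R]] <= (g t)%:E)%E.
  by move=> t0; apply: ereal_inf_lbound; exists t.
move: h1 h2 ub lb; move: (ereal_sup _) (ereal_inf _) => S I S1 I0 ub lb.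
have Ifin : I \is a fin_num.
  rewrite ge0_fin_numE ?(ltW I0)//; apply: le_lt_trans (lb 1 ltr01) (ltry _).
have Sfin : S \is a fin_num.
  by rewrite ge0_fin_numE// (le_trans _ (ub 1 ltr01))// lee_fin ltW// g0.
rewrite -(fineK Ifin) lte_fin in I0.
exists (fine I), (fine S); split => //.
  by rewrite -lte_fin fineK// (lt_le_trans _ (ub 1 ltr01))// lte_fin g0.
by move=> t t0; rewrite -!lee_fin !fineK// ub// lb.
Qed.

End limit_condition.

(** * Sums of separated wave packets *)

Section near_sums.
Context (R : realType).

Lemma freq_near_uniq c J0 i j k : freq_near c (test_freq c J0 i) k ->
  freq_near c (test_freq c J0 j) k -> i = j.
Proof.
rewrite /freq_near /test_freq => /andP[h1 h2] /andP[h3 h4].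
have [//|ij|ij] := ltngtP i j; nia.
Qed.

Lemma near_count c N m : (\sum_(0 <= k < m) freq_near c N k <= 2 * c + 1)%N.
Proof.
(* The induction over [m] needs the length of the part of [[N - c, N + c]] below [m]; truncated
   subtraction is right here, as indices start at 0. *)
suff : (\sum_(0 <= k < m) freq_near c N k <= minn m (N + c + 1) - (N - c))%N by lia.
elim: m => [|m ih]; first by rewrite big_nil.
rewrite big_nat_recr//=; move: ih; set S := (\sum_(0 <= k < m) _)%N.
rewrite /freq_near; case: (leqP N (m + c)) => h1; case: (leqP m (N + c)) => h2 /=; lia.
Qed.

(** At most one term is nonzero, so powers commute with the sum without any convexity, also for
    [u < 1]. *)
Lemma sum_near_pow c J0 n k (a : 'I_n -> R) (u : R) : 0 < u -> (forall j, 0 <= a j) ->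
  (\sum_(j < n) (freq_near c (test_freq c J0 j) k)%:R * a j) `^ u =
  \sum_(j < n) (freq_near c (test_freq c J0 j) k)%:R * a j `^ u.
Proof.
move=> u0 a0.
have [[j0 h0]|h] := pselect (exists j0 : 'I_n, freq_near c (test_freq c J0 j0) k).
  have z (b : 'I_n -> R) : \sum_(j < n) (freq_near c (test_freq c J0 j) k)%:R * b j = b j0.
    rewrite (bigD1 j0)//= h0 mul1r big1 ?addr0// => j jj0.
    have [h|] := boolP (freq_near _ _ _); last by rewrite mul0r.
    by case/eqP: jj0; apply/val_inj; exact: freq_near_uniq h h0.
  by rewrite !z.
have z (b : 'I_n -> R) : \sum_(j < n) (freq_near c (test_freq c J0 j) k)%:R * b j = 0.
  rewrite big1// => j _; have [h'|] := boolP (freq_near _ _ _); last by rewrite mul0r.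
  by exfalso; apply: h; exists j.
by rewrite !z powR0// gt_eqF.
Qed.

Lemma sum_near_le c J0 n k (a : 'I_n -> R) (A : R) : 0 <= A -> (forall j, 0 <= a j <= A) ->
  \sum_(j < n) (freq_near c (test_freq c J0 j) k)%:R * a j <= A.
Proof.
move=> A0 aA.
have [[j0 h0]|h] := pselect (exists j0 : 'I_n, freq_near c (test_freq c J0 j0) k).
  rewrite (bigD1 j0)//= h0 mul1r big1 ?addr0//; first by have /andP[] := aA j0.
  move=> j jj0; have [h|] := boolP (freq_near _ _ _); last by rewrite mul0r.
  by case/eqP: jj0; apply/val_inj; exact: freq_near_uniq h h0.
rewrite big1// => j _; have [h'|] := boolP (freq_near _ _ _); last by rewrite mul0r.
by exfalso; apply: h; exists j.
Qed.

(** After exchanging the sums, each packet is counted by at most [2 * c + 1] blocks. *)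
Lemma nneseries_near_le c J0 n (a : 'I_n -> R) (u : R) : 0 < u -> (forall j, 0 <= a j) ->
  (\sum_(0 <= k <oo) ((\sum_(j < n) (freq_near c (test_freq c J0 j) k)%:R * a j) `^ u)%:E <=
  ((2 * c + 1)%:R * \sum_(j < n) a j `^ u)%:E)%E.
Proof.
move=> u0 a0; apply: nneseries_le_ub => [k|m]; first by rewrite lee_fin powR_ge0.
rewrite sumEFin lee_fin.
under eq_bigr do rewrite sum_near_pow//.
rewrite exchange_big/= mulr_sumr; apply: ler_sum => j _.
rewrite -mulr_suml ler_wpM2r ?powR_ge0//.
rewrite -natr_sum ler_nat; exact: near_count.
Qed.

(** The test frequencies increase strictly with [j], so the left side is a partial sum over distinct
    indices. *)
Lemma sum_test_freq_le c J0 n (a : nat -> \bar R) : (forall k, (0 <= a k)%E) ->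
  (\sum_(0 <= j < n) a (test_freq c J0 j) <= \sum_(0 <= k <oo) a k)%E.
Proof.
move=> a0; apply: (@le_trans _ _ (\sum_(0 <= k < test_freq c J0 n) a k)%E); last first.
  by rewrite (nneseries_split 0 (test_freq c J0 n))// ?add0n ?leeDl//; apply: nneseries_ge0.
elim: n => [|n ih]; first by rewrite big_nil; apply: sume_ge0.
have lt : (test_freq c J0 n < test_freq c J0 n.+1)%N by rewrite /test_freq; nia.
rewrite big_nat_recr//= (big_cat_nat (leq0n _) (ltnW lt))/=; apply: leeD => //.
by rewrite big_ltn// leeDl// sume_ge0.
Qed.

Lemma exists_powR_ge (e A : R) : 0 < e -> exists2 n, (0 < n)%N & A <= n%:R `^ e.
Proof.
move=> e0; pose B := (Num.max A 0) `^ e^-1; exists (Num.trunc B).+1 => //.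
apply: (@le_trans _ _ (B `^ e)).
  by rewrite /B -powRrM mulVf ?gt_eqF// powRr1 ?le_max ?lexx// orbT.
apply: ge0_ler_powR; rewrite ?nnegrE ?powR_ge0 ?(ltW e0)//.
exact/ltW/truncnS_gt.
Qed.

End near_sums.

Section spread.
Context (R : realType) (d : nat) (d0 : (0 < d)%N).
Local Notation V := 'rV[R]_d.
Local Notation lam := (lebesgue_rV R d).
Local Notation cube j k := (@dyadic_cube R d j k).
Variables (n : nat) (n0 : (0 < n)%N) (r D : R) (r0 : 0 < r) (rD : n%:R * r <= D).

Definition spread (j : 'I_n) : V := (j%:R * D) *: const_mx 1.

Let D0 : 0 < D.
Proof. by apply: lt_le_trans rD; rewrite mulr_gt0// ltr0n. Qed.

Lemma spread_dist i j : i != j -> D <= `|spread i - spread j|.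
Proof.
move=> ij; rewrite /spread -scalerBl -mulrBl normrZ normrM (ger0_norm (ltW D0)).
have h1 : 1 <= `|const_mx 1 : V|.
  by have := le_rV_norm (const_mx 1 : V) (Ordinal d0); rewrite mxE normr1.
have h2 : 1 <= `|i%:R - j%:R| :> R.
  rewrite -[i%:R]/((i%:Z)%:~R) -[j%:R]/((j%:Z)%:~R) -intrB -intr_norm -[leLHS]/((1%:Z)%:~R) ler_int.
  by have : (i : nat) != j by []; lia.
rewrite -[leLHS]mul1r -mulrA; apply: ler_pM => //; rewrite ?(ltW D0)//.
by rewrite -[leLHS]mulr1 ler_pM2l.
Qed.

Local Notation w j y := (weight (2 * d) (r^-1 *: (y - spread j))).

Definition bump_sum (y : V) : R := \sum_(j < n) w j y.

Lemma weight_far j (y : V) : D / 4 <= `|y - spread j| -> w j y <= (4 * r / D) ^+ (2 * d).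
Proof.
move=> h; rewrite /weight -exprVn lerXn2r ?nnegrE ?invr_ge0 ?addr_ge0//.
  by rewrite divr_ge0 ?(ltW D0)// mulr_ge0// ltW.
rewrite normrZ ger0_norm ?invr_ge0 ?(ltW r0)//.
have h1 : D / (4 * r) <= 1 + r^-1 * `|y - spread j|.
  apply: (@le_trans _ _ (r^-1 * (D / 4))); first by rewrite invfM; lra.
  by rewrite ler_wpDl// ler_pM2l ?invr_gt0.
have h2 : 0 < D / (4 * r) by rewrite divr_gt0// mulr_gt0.
have -> : 4 * r / D = (D / (4 * r))^-1 by rewrite invf_div.
by rewrite lef_pV2 ?posrE// (lt_le_trans h2).
Qed.

(** The centres are at least [D] apart, so a set of diameter at most [D / 4] comes within [D / 4] of
    at most one of them; [weight_far] bounds each of the others. If none is close, any [j0] will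
    do. *)
Lemma bump_sum_local (P : set V) : (forall y z, P y -> P z -> `|y - z| <= D / 4) ->
  exists j0, forall y, P y -> bump_sum y <= w j0 y + n%:R * (4 * r / D) ^+ (2 * d).
Proof.
move=> hP.
have e0 : 0 <= (4 * r / D) ^+ (2 * d).
  by rewrite exprn_ge0// divr_ge0 ?(ltW D0)// mulr_ge0// ltW.
have H j0 : (forall j, j != j0 -> forall y, P y -> D / 4 <= `|y - spread j|) ->
    forall y, P y -> bump_sum y <= w j0 y + n%:R * (4 * r / D) ^+ (2 * d).
  move=> h y Py; rewrite /bump_sum (bigD1 j0)//= lerD2l.
  apply: (@le_trans _ _ (\sum_(j < n | j != j0) (4 * r / D) ^+ (2 * d))).
    by apply: ler_sum => j jj0; apply: weight_far; exact: h.
  rewrite sumr_const -[leLHS]mulr_natl; apply: ler_wpM2r => //; rewrite ler_nat.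
  by rewrite (leq_trans (max_card _))// card_ord.
have [[j0 [z Pz hz]]|hn] := pselect (exists j0, exists2 z, P z & `|z - spread j0| < D / 4).
  exists j0; apply: H => j jj0 y Py; rewrite leNgt; apply/negP => hy.
  have h1 := spread_dist jj0; have h2 := hP y z Py Pz.
  have : `|spread j - spread j0| <= `|y - spread j| + `|y - z| + `|z - spread j0|.
    have -> : spread j - spread j0 = (y - z) - (y - spread j) + (z - spread j0).
      by apply/rowP => i; rewrite !mxE; ring.
    apply: (le_trans (ler_normD _ _)); rewrite lerD2r.
    by rewrite (addrC `|y - spread j|); exact: ler_normB.
  by have := D0; lra.
exists (Ordinal n0); apply: H => j _ y Py; rewrite leNgt; apply/negP => hy.
by apply: hn; exists j, y.
Qed.

Lemma bump_sum_ge0 y : 0 <= bump_sum y.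
Proof. by apply: sumr_ge0 => j _; exact: weight_ge0. Qed.

(** Half of the decay, through [n * (r / D) ^ d <= n * r / D <= 1], absorbs the number of packets.
    The other half, [(r / D) ^ d], pays for the integration over a cube of side at most [D]. *)
Let far_le : n%:R * (4 * r / D) ^+ (2 * d) <= 4 ^+ (2 * d) * (r / D) ^+ d.
Proof.
have nr0 : 0 < n%:R :> R by rewrite ltr0n.
have rD0 : 0 <= r / D by rewrite divr_ge0 ?(ltW D0) ?(ltW r0).
have h : n%:R * (r / D) <= 1 by rewrite mulrA ler_pdivrMr// mul1r.
have rD1 : r / D <= 1.
  by apply: le_trans h; rewrite ler_peMl// ler1n.
have h2 : n%:R * (r / D) ^+ d <= 1.
  apply: le_trans h; rewrite ler_pM2l//; case: (d) d0 => // k _.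
  by rewrite exprS ler_piMr// exprn_ile1.
rewrite -mulrA exprMn mulrCA ler_wpM2l ?exprn_ge0// mul2n -addnn exprD mulrA.
by rewrite ler_piMl ?exprn_ge0.
Qed.

Lemma bump_sum_le y : bump_sum y <= 1 + 4 ^+ (2 * d).
Proof.
have dP (z z' : V) : [set y] z -> [set y] z' -> `|z - z'| <= D / 4.
  by move=> -> ->; rewrite subrr normr0 divr_ge0// ltW.
have [j0 /(_ y erefl) h] := bump_sum_local dP.
apply: (le_trans h); apply: lerD; first exact: weight_le1.
apply: (le_trans far_le); rewrite -[leRHS]mulr1 ler_wpM2l ?exprn_ge0// exprn_ile1//.
  by rewrite divr_ge0 ?(ltW D0) ?(ltW r0).
rewrite ler_pdivrMr// mul1r; apply: le_trans rD; rewrite ler_peMl ?ler1n//.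
exact: ltW.
Qed.

Lemma measurable_scaled_weight M (a : V) :
  measurable_fun setT (fun y : V => weight M (r^-1 *: (y - a))).
Proof.
apply: (measurableT_comp (@measurable_weight R d M)).
under eq_fun do rewrite scalerBr -scalerN.
exact: measurable_affine_rV.
Qed.

Lemma measurable_bump_sum : measurable_fun setT bump_sum.
Proof. by apply: measurable_sum => j; exact: measurable_scaled_weight. Qed.

Local Open Scope ereal_scope.

Lemma integral_bump_sum_le :
  \int[lam]_y (bump_sum y)%:E <= (n%:R * (2 ^+ d * r ^+ d))%R%:E.
Proof.
under eq_integral do rewrite -sumEFin.
rewrite ge0_integral_sum//; last 2 first.
- by move=> j; apply/measurable_EFinP; exact: measurable_scaled_weight.
- by move=> j y _; rewrite lee_fin weight_ge0.
apply: (@le_trans _ _ (\sum_(j < n) (2 ^+ d * r ^+ d)%:E)).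
  by apply: lee_sum => j _; rewrite mulrC; exact: ge0_integral_weight_scaled.
by rewrite sumEFin sumr_const card_ord mulr_natl.
Qed.

Lemma integral_bump_sum_small j k :
  \int[lam]_(y in cube j k) (bump_sum y)%:E <= ((1 + 4 ^+ (2 * d)) * side R j ^+ d)%R%:E.
Proof.
have mP := @measurable_dyadic_cube R d j k.
apply: (@le_trans _ _ (\int[lam]_(y in cube j k) (1 + 4 ^+ (2 * d))%R%:E)).
  apply: ge0_le_integral => //.
  - by move=> y _; rewrite lee_fin bump_sum_ge0.
  - by apply: measurable_funTS; apply/measurable_EFinP; exact: measurable_bump_sum.
  - by move=> y _; rewrite lee_fin bump_sum_le.
apply: (@le_trans _ _ ((1 + 4 ^+ (2 * d))%R%:E * lam (cube j k))).
  by rewrite integral_cst.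
by rewrite lebesgue_dyadic_cube.
Qed.

(** Such a cube meets essentially one bump, of mass at most [2 ^+ d * r ^+ d]; the tails of the
    others, integrated over the cube, add at most [4 ^+ (2 * d) * r ^+ d]. *)
Lemma integral_bump_sum_medium j k : (side R j <= D / 4)%R ->
  \int[lam]_(y in cube j k) (bump_sum y)%:E <= ((2 ^+ d + 4 ^+ (2 * d)) * r ^+ d)%R%:E.
Proof.
move=> jD; have mP := @measurable_dyadic_cube R d j k; have s0 := side_gt0 R j.
have dP (y z : V) : cube j k y -> cube j k z -> (`|y - z| <= D / 4)%R.
  by move=> yP zP; apply: le_trans jD; exact: dyadic_cube_dist yP zP.
have [j0 hj0] := bump_sum_local dP.
set e := (n%:R * (4 * r / D) ^+ (2 * d))%R in hj0.
have e0 : (0 <= e)%R.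
  by rewrite mulr_ge0// exprn_ge0// divr_ge0 ?(ltW D0)// mulr_ge0// ltW.
apply: (@le_trans _ _ (\int[lam]_(y in cube j k) ((w j0 y)%:E + e%:E))).
  apply: ge0_le_integral => //.
  - by move=> y _; rewrite lee_fin bump_sum_ge0.
  - by apply: measurable_funTS; apply/measurable_EFinP; exact: measurable_bump_sum.
  - apply: measurable_funTS; apply: emeasurable_funD => //.
    by apply/measurable_EFinP; exact: measurable_scaled_weight.
rewrite ge0_integralD//; last 2 first.
- by move=> y _; rewrite lee_fin weight_ge0.
- by apply: measurable_funTS; apply/measurable_EFinP; exact: measurable_scaled_weight.
rewrite mulrDl EFinD; apply: leeD.
  apply: (@le_trans _ _ (\int[lam]_y (w j0 y)%:E)).
    apply: ge0_subset_integral => //.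
    - by apply/measurable_EFinP; exact: measurable_scaled_weight.
    - by move=> y _; rewrite lee_fin weight_ge0.
  by rewrite mulrC; exact: ge0_integral_weight_scaled.
apply: (@le_trans _ _ (e%:E * lam (cube j k))); first by rewrite integral_cst.
rewrite lebesgue_dyadic_cube -EFinM lee_fin.
apply: (@le_trans _ _ (4 ^+ (2 * d) * (r / D) ^+ d * D ^+ d)%R).
  apply: ler_pM => //; first by rewrite exprn_ge0// ltW.
  rewrite lerXn2r ?nnegrE ?(ltW s0) ?(ltW D0)//; apply: (le_trans jD).
  by rewrite ler_pdivrMr// ler_peMr ?(ltW D0)// ler1n.
by rewrite -mulrA -exprMn divfK// gt_eqF.
Qed.

End spread.

(** * Embeddings *)

Section embeddings.
Local Open Scope ereal_scope.
Context (R : realType) (d : nat).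
Implicit Types normX normY : functional R d -> \bar R.
Local Notation zerof := ((fun=> 0%R) : functional R d).

(** The inequality is assumed for all functionals, hence applies directly to the differences in the
    definition of continuity. *)
Lemma embeds_of_le normX normY (C : R) : (0 < C)%R ->
  (forall f, normY f <= C%:E * normX f) -> embeds normX normY.
Proof.
move=> C0 h; split=> [f [tf Xf]|f Xf eps eps0].
  split => //; apply: (le_lt_trans (h f)).
  by apply: lte_mul_pinfty => //; rewrite lee_fin ltW.
exists (eps / C)%R => [|g _ gf]; first by rewrite divr_gt0.
apply: (le_lt_trans (h _)); rewrite -lte_pdivlMl//.
by move: gf; rewrite EFinM muleC.
Qed.

Lemma tempered0 : tempered zerof.
Proof.
split=> [a phi psi _ _|phi _ eps eps0]; first by rewrite mulr0 addr0.
exists 0%N, 1%R; split => // psi _ _; by rewrite subr0 cmod0.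
Qed.

Lemma embeds_at0 normX normY : normX zerof = 0 -> embeds normX normY ->
  exists2 dl : R, (0 < dl)%R & forall f, tempered f -> normX f < dl%:E -> normY f < 1.
Proof.
move=> X0 [sub cont].
have s0 : Defs.space normX zerof by split; [exact: tempered0|rewrite X0 ltry].
have [dl dl0 h] := cont _ s0 1%R ltr01.
have E (f : functional R d) : (f \- zerof)%R = f by apply/funext => x; rewrite /= subr0.
exists dl => // f tf fd; have := h f; rewrite E; apply => //.
by split => //; apply: (lt_trans fd); exact: ltry.
Qed.

(** The common scheme of the counterexamples: for [n] packets the source norm grows at most like
    [n ^ e], the target norm at least like [n ^ e']. *)
Lemma not_embeds normX normY (A B e e' : R) : normX zerof = 0 ->
  (0 < A)%R -> (0 < B)%R -> (e < e')%R ->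
  (forall n (l : R), (0 < n)%N -> (0 <= l)%R -> exists f, [/\ tempered f,
     normX f <= (l * (A * n%:R `^ e))%R%:E & (l * (B * n%:R `^ e'))%R%:E <= normY f]) ->
  ~ embeds normX normY.
Proof.
move=> X0 A0 B0 ee' h /(embeds_at0 X0)[dl dl0 hd].
have [n n0 hn] := @exists_powR_ge R (e' - e) (2 * A / (dl * B)) ltac:(by rewrite subr_gt0).
have nr : (0 < n%:R :> R)%R by rewrite ltr0n.
have pe : (0 < n%:R `^ e :> R)%R by rewrite powR_gt0.
(* This amplitude brings the source norm to at most [dl / 2]. The number [n] was taken so large that
   the target norm is then at least 1, against the bound [< 1] from continuity. *)
pose l := (dl / 2 / (A * n%:R `^ e))%R.
have An : (0 < A * n%:R `^ e)%R by exact: mulr_gt0.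
have l0 : (0 <= l)%R by rewrite !divr_ge0// ltW.
have [f [tf Xf Yf]] := h n l n0 l0.
have /hd : normX f < dl%:E.
  apply: (le_lt_trans Xf); rewrite lte_fin /l divfK ?gt_eqF//.
  by rewrite ltr_pdivrMr// ltr_pMr// ltr1n.
move=> /(_ tf)/(le_lt_trans Yf); rewrite lte_fin; apply/negP; rewrite -leNgt.
have -> : (l * (B * n%:R `^ e') = dl * B / (2 * A) * (n%:R `^ e' / n%:R `^ e))%R.
  by rewrite /l; field; rewrite !gt_eqF.
rewrite -powRB ?gt_eqF ?implybT// -ler_pdivrMl ?divr_gt0 ?mulr_gt0//.
by rewrite invf_div mulr1.
Qed.

End embeddings.

Section norms.
Local Open Scope ereal_scope.
Context (R : realType) (d : nat) (d0 : (0 < d)%N).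
Local Notation V := 'rV[R]_d.
Local Notation lam := (lebesgue_rV R d).
Local Notation cube j k := (@dyadic_cube R d j k).
Variables (eta0 eta : V -> R) (heta : admissible_eta eta0 eta).
Variables (p s : R) (phi : R -> R) (p0 : (0 < p)%R) (hphi : class_G d p phi).

Definition wblock f (k : nat) (x : V) : R :=
  (2 `^ (k%:R * s) * cmod (lp_block eta0 eta f k x))%R.

Lemma wblock_ge0 f k x : (0 <= wblock f k x)%R.
Proof. by rewrite mulr_ge0 ?powR_ge0 ?cmod_ge0. Qed.

Lemma measurable_wblock f k : measurable_fun setT (wblock f k).
Proof. by apply: measurable_funM => //; exact: measurable_lp_block. Qed.

Lemma measurable_lq_wblock q f : 0 < q ->
  measurable_fun setT (fun x => lq q (fun k => (wblock f k x)%:E)).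
Proof.
move=> q0; apply: (measurable_lq (h := fun k x => (wblock f k x)%:E)) => //.
- by move=> k; apply/measurable_EFinP; exact: measurable_wblock.
- by move=> k x; rewrite lee_fin wblock_ge0.
Qed.

Lemma E_normE q f : 0 < q -> E_norm eta0 eta s phi p q f =
  morrey_norm phi p (fun x => lq q (fun k => (wblock f k x)%:E)).
Proof.
move=> q0; rewrite /E_norm; congr morrey_norm; apply/funext => x.
by rewrite weighted_lqE// => k; rewrite lee_fin cmod_ge0.
Qed.

Lemma N_normE q f : 0 < q -> N_norm eta0 eta s phi p q f =
  lq q (fun k => morrey_norm phi p (fun x => (wblock f k x)%:E)).
Proof.
move=> q0; rewrite /N_norm weighted_lqE//; last by move=> k; exact: morrey_norm_ge0.
congr (lq q _); apply/funext => k; rewrite -morrey_normZ ?powR_ge0//.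
- by apply/measurable_EFinP; exact: measurable_lp_block.
- by move=> x; rewrite lee_fin cmod_ge0.
Qed.

Lemma wblock0 k x : wblock (fun=> 0)%R k x = 0%R.
Proof. by rewrite /wblock lp_block0// cmod0 mulr0. Qed.

Lemma E_norm0 q : 0 < q -> E_norm eta0 eta s phi p q (fun=> 0)%R = 0.
Proof.
move=> q0; rewrite E_normE//.
under eq_fun do under eq_fun do rewrite wblock0.
under eq_fun do rewrite lq0//.
have mc : measurable_fun setT (fun _ : V => 0 : \bar R) by exact: measurable_cst.
have := @morrey_normZ R d p phi p0 0%R _ (lexx _) mc (fun=> lexx _).
by under eq_fun do rewrite mule0; rewrite mul0e.
Qed.

Lemma E_le_N_min q f : 0 < q ->
  E_norm eta0 eta s phi p q f <= N_norm eta0 eta s phi p (Order.min p%:E q) f.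
Proof.
move=> q0; rewrite E_normE// N_normE; last by rewrite lt_min q0 lte_fin p0.
by apply: morrey_norm_lq_le => //; [exact: measurable_wblock|exact: wblock_ge0].
Qed.

Lemma N_y_le_E q f : 0 < q -> N_norm eta0 eta s phi p +oo f <= E_norm eta0 eta s phi p q f.
Proof.
move=> q0; rewrite E_normE// N_normE//; apply: ge_ereal_sup => _ [k _ <-].
apply: le_morrey_norm => //.
- by apply/measurable_EFinP; exact: measurable_wblock.
- exact: measurable_lq_wblock.
- by move=> x; rewrite lee_fin wblock_ge0.
- move=> x; apply: (@lq_ge _ q (fun k => (wblock f k x)%:E) k) => // i.
  by rewrite lee_fin wblock_ge0.
Qed.

Lemma N_le_E q q0 : 0 < q -> Order.max p%:E q <= q0 -> limit_condition d p phi ->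
  exists2 C : R, (0 < C)%R &
    forall f, N_norm eta0 eta s phi p q0 f <= C%:E * E_norm eta0 eta s phi p q f.
Proof.
move=> qpos hq0 /(limit_conditionP hphi)[c [C [c0 C0 hC]]].
have m0 : 0 < Order.max p%:E q by rewrite lt_max qpos orbT.
have q00 : 0 < q0 by exact: lt_le_trans hq0.
pose K : R := ((2 ^+ d) `^ p^-1 / c)%R.
have K0 : (0 < K)%R by rewrite divr_gt0 ?powR_gt0 ?exprn_gt0.
exists (C * K)%R => [|f]; first exact: mulr_gt0.
have mw k : measurable_fun setT (fun x => (wblock f k x)%:E).
  by apply/measurable_EFinP; exact: measurable_wblock.
have w0 k x : 0 <= (wblock f k x)%:E by rewrite lee_fin wblock_ge0.
rewrite E_normE// N_normE//.
apply: (@le_trans _ _ (lq q0 (fun k => C%:E * Lp lam p (fun x => (wblock f k x)%:E)))).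
  apply: le_lq => // k; first exact: morrey_norm_ge0.
  by apply: morrey_norm_le_Lp => // t t0; have /andP[] := hC t t0.
rewrite lqZ ?(ltW C0)//; last by move=> k; exact: Lp_ge0.
rewrite EFinM -muleA; apply: lee_wpmul2l; first by rewrite lee_fin ltW.
apply: (@le_trans _ _ (Lp lam p (fun x => lq q (fun k => (wblock f k x)%:E)))); last first.
  apply: Lp_le_morrey_norm => //; first exact: measurable_lq_wblock.
    by move=> x; exact: lq_ge0.
  by move=> t t0; have /andP[] := hC t t0.
apply: le_trans (lq_Lp_le lam p0 qpos (measurable_wblock f) (wblock_ge0 f)).
by apply: lq_antimono => // k; exact: Lp_ge0.
Qed.

(** One cube is enough: the dyadic one containing [a] with side between [rho / 2] and [rho]. Its
    factor [rphi] is at least [rphi r] by monotonicity. *)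
Lemma morrey_norm_ge (h : V -> R) (a : V) (rho r B : R) : (0 < rho)%R -> (rho <= r)%R ->
  (0 <= B)%R -> measurable_fun setT h -> (forall y, 0 <= h y)%R ->
  (forall y, `|y - a| <= rho -> B <= h y)%R ->
  (B * ((rho / 2) `^ (d%:R / p) * rphi d p phi r))%R%:E <= morrey_norm phi p (fun y => (h y)%:E).
Proof.
move=> rho0 rr B0 mh h0 hB.
have [j [j1 j2]] := exists_side rho0; have [k ak] := exists_dyadic_cube j a.
have s0 := side_gt0 R j.
apply: le_trans (morrey_norm_ub _ _ _ j k).
have E : (B * side R j `^ (d%:R / p))%R%:E <= cubeLp p j k (fun y => (h y)%:E).
  rewrite /cubeLp le_poweRV//; last 2 first.
  - by rewrite lee_fin mulr_ge0 ?powR_ge0.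
  - by apply: integral_ge0 => y _; rewrite poweR_ge0.
  have mP := @measurable_dyadic_cube R d j k.
  apply: (@le_trans _ _ (\int[lam]_(y in cube j k) (B `^ p)%:E)).
    apply: (@le_trans _ _ ((B `^ p)%:E * lam (cube j k))); last by rewrite integral_cst.
    rewrite lebesgue_dyadic_cube -EFinM poweR_EFin lee_fin powRM ?powR_ge0//.
    by rewrite -powRrM divfK ?gt_eqF// powR_mulrn// ltW.
  apply: ge0_le_integral => //.
  - by move=> y _; rewrite lee_fin powR_ge0.
  - by apply: measurable_funTS; exact: measurable_EFin_poweR.
  - move=> y Py; rewrite -poweR_EFin; apply: le_poweR; rewrite ?lee_fin ?(ltW p0)//.
    by apply: hB; apply: le_trans (dyadic_cube_dist Py ak) j2.
apply: (@le_trans _ _ ((rphi d p phi (side R j))%:E * (B * side R j `^ (d%:R / p))%R%:E)); last first.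
  by apply: lee_wpmul2l => //; rewrite lee_fin ltW// rphi_gt0.
rewrite -EFinM lee_fin [leRHS]mulrCA ler_wpM2l// [leRHS]mulrC.
apply: ler_pM; rewrite ?powR_ge0//.
- by rewrite ltW// rphi_gt0// (lt_le_trans rho0).
- by apply: ge0_ler_powR; rewrite ?nnegrE ?divr_ge0 ?(ltW p0) ?(ltW s0) ?(ltW rho0)// ltW.
- by apply: rphi_noninc => //; exact: le_trans j2 rr.
Qed.

Section test_bounds.
Variables (n M c J0 : nat) (x : 'I_n -> V) (r l C c0 c1 : R) (f : functional R d).
Hypotheses (r0 : (0 < r)%R) (l0 : (0 <= l)%R) (C0 : (0 < C)%R) (c00 : (0 < c0)%R)
  (c10 : (0 < c1)%R) (c11 : (c1 <= 1)%R).
Hypothesis upper : forall k y, (wblock f k y <= l * C *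
  \sum_(j < n) ((freq_near c (test_freq c J0 j) k)%:R * weight M (r^-1 *: (y - x j))))%R.
Hypothesis lower : forall (j : 'I_n) y, (`|y - x j| <= c1 * r)%R ->
  (l * c0 <= wblock f (test_freq c J0 j) y)%R.

(** Only the blocks [test_freq c J0 j] are kept, one for each packet; their [n] Morrey norms have
    the same lower bound [B]. *)
Lemma N_norm_test_ge (q0 : R) : (0 < q0)%R ->
  (l * (c0 * (c1 / 2) `^ (d%:R / p) * (r `^ (d%:R / p) * rphi d p phi r) * n%:R `^ q0^-1))%R%:E <=
  N_norm eta0 eta s phi p q0%:E f.
Proof.
move=> q00; rewrite N_normE//.
set B := (l * (c0 * (c1 / 2) `^ (d%:R / p) * (r `^ (d%:R / p) * rphi d p phi r)))%R.
have rp : (0 < rphi d p phi r)%R by exact: rphi_gt0.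
have B0 : (0 <= B)%R.
  apply: mulr_ge0 => //; apply: mulr_ge0; first by rewrite mulr_ge0 ?powR_ge0// ltW.
  by apply: mulr_ge0; [exact: powR_ge0|exact: ltW].
have hB j : (j < n)%N -> B%:E <= morrey_norm phi p (fun y => (wblock f (test_freq c J0 j) y)%:E).
  move=> jn; have := @morrey_norm_ge (wblock f (test_freq c J0 j)) (x (Ordinal jn)) (c1 * r) r (l * c0).
  move=> /(_ _ _ _ (measurable_wblock _ _) (wblock_ge0 _ _) (lower (j := Ordinal jn))) h.
  apply: le_trans (h _ _ _).
  - have -> : (c1 * r / 2 = c1 / 2 * r)%R by rewrite mulrAC.
    rewrite lee_fin /B [in leRHS]powRM ?divr_ge0 ?(ltW c10) ?(ltW r0)//.
    by rewrite le_eqVlt; apply/orP; left; apply/eqP; ring.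
  - exact: mulr_gt0.
  - by rewrite ler_piMl// ltW.
  - by rewrite mulr_ge0// ltW.
rewrite /lq le_poweRV//; last 2 first.
- by rewrite lee_fin mulrA mulr_ge0 ?powR_ge0.
- by apply: nneseries_ge0 => k _ _; rewrite poweR_ge0.
apply: le_trans (@sum_test_freq_le R c J0 n
  (fun k => morrey_norm phi p (fun x => (wblock f k x)%:E) `^ q0) (fun k => poweR_ge0 _ _)).
apply: (@le_trans _ _ (\sum_(0 <= j < n) (B `^ q0)%:E)); last first.
  rewrite big_nat [leRHS]big_nat; apply: lee_sum => j /andP[_ jn].
  by rewrite -poweR_EFin; apply: le_poweR; rewrite ?hB// ltW.
rewrite sumEFin sumr_const_nat subn0 lee_fin.
rewrite mulrA -/B powRM ?powR_ge0// -powRrM mulVf ?gt_eqF// powRr1// mulr_natr//.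
Qed.

Section spread_bounds.
Variables (q : \bar R) (q' : R).
Hypotheses (q'0 : (0 < q')%R) (q'q : q'%:E <= q) (q'p : (q' <= p)%R)
  (Mq' : ((2 * d)%:R <= M%:R * q')%R).
Variable D : R.
Hypotheses (n0 : (0 < n)%N) (rD : (n%:R * r <= D)%R) (xE : x = @spread R d n D).

Let T (y : V) : R := \sum_(j < n) weight (2 * d) (r^-1 *: (y - x j)).

Definition bump_const : R :=
  ((2 * c + 1)%:R `^ (p / q') * (1 + 4 ^+ (2 * d)) `^ (p / q' - 1))%R.

Lemma weight_powR_le (u : R) (z : V) : ((2 * d)%:R <= M%:R * u)%R ->
  (weight M z `^ u <= weight (2 * d) z)%R.
Proof.
move=> hu; rewrite /weight -!powR_mulrn// -!powRN -powRrM mulNr.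
by apply: ler_powR; rewrite ?lerDl// lerN2.
Qed.

(** Passing to a finite exponent [u <= q] also covers infinite [q]; each packet is then counted in
    at most [2 * c + 1] blocks. *)
Lemma lq_test_le (u : R) y : (0 < u)%R -> u%:E <= q ->
  lq q (fun k => (wblock f k y)%:E) <= (l * C * ((2 * c + 1)%:R *
    \sum_(j < n) weight M (r^-1 *: (y - x j)) `^ u) `^ u^-1)%R%:E.
Proof.
move=> u0 uq; have w0 k : 0 <= (wblock f k y)%:E by rewrite lee_fin wblock_ge0.
apply: le_trans (lq_antimono _ uq w0) _ => //.
have lC0 : (0 <= l * C)%R by rewrite mulr_ge0// ltW.
rewrite /lq poweRV_le//; last 2 first.
- by apply: nneseries_ge0 => k _ _; rewrite poweR_ge0.
- by rewrite lee_fin mulr_ge0 ?powR_ge0.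
rewrite poweR_EFin powRM ?powR_ge0// -powRrM mulVf ?gt_eqF// powRr1; last first.
  by rewrite mulr_ge0// sumr_ge0// => j _; rewrite powR_ge0.
rewrite EFinM.
apply: le_trans (lee_wpmul2l _ (nneseries_near_le c J0 u0
  (fun j => weight_ge0 M (r^-1 *: (y - x j))))); last by rewrite lee_fin powR_ge0.
rewrite -nneseriesZl; last by move=> k _; rewrite lee_fin powR_ge0.
apply: lee_nneseries => k _; first by rewrite poweR_ge0.
rewrite poweR_EFin -EFinM lee_fin -powRM ?sumr_ge0//; last first.
  by move=> j _; rewrite mulr_ge0 ?weight_ge0.
apply: ge0_ler_powR; rewrite ?nnegrE ?wblock_ge0 ?(ltW u0)//.
by rewrite mulr_ge0// sumr_ge0// => j _; rewrite mulr_ge0 ?weight_ge0.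
Qed.

Let T0 y : (0 <= T y)%R.
Proof. by apply: sumr_ge0 => j _; exact: weight_ge0. Qed.

Let T_le y : (T y <= 1 + 4 ^+ (2 * d))%R.
Proof. by have := bump_sum_le d0 n0 r0 rD y; rewrite /T xE. Qed.

(** [M * q' >= 2 * d] turns the powers of the envelope into the integrable weight. Since [q' <= p],
    the exponent of [T y] is [p / q' >= 1], and boundedness of [T] reduces it to 1, so that only
    integrals of [T] remain to be estimated. *)
Lemma lq_test_powR_le y : lq q (fun k => (wblock f k y)%:E) `^ p <=
  ((l * C) `^ p * bump_const * T y)%R%:E.
Proof.
have lC0 : (0 <= l * C)%R by rewrite mulr_ge0// ltW.
have q0 : 0 < q by apply: lt_le_trans q'q; rewrite lte_fin.
have h1 : lq q (fun k => (wblock f k y)%:E) <=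
    (l * C * ((2 * c + 1)%:R * T y) `^ q'^-1)%R%:E.
  apply: le_trans (lq_test_le y q'0 q'q) _; rewrite lee_fin ler_wpM2l//.
  apply: ge0_ler_powR; rewrite ?nnegrE ?invr_ge0 ?(ltW q'0) ?mulr_ge0//.
    by apply: sumr_ge0 => j _; rewrite powR_ge0.
  by rewrite ler_wpM2l//; apply: ler_sum => j _; exact: weight_powR_le.
apply: le_trans (le_poweR (ltW p0) _ h1) _.
  by apply: lq_ge0 => // k; rewrite lee_fin wblock_ge0.
rewrite poweR_EFin lee_fin powRM ?powR_ge0// -mulrA ler_wpM2l ?powR_ge0//.
rewrite -powRrM (mulrC (q'^-1)%R) powRM// /bump_const -mulrA ler_wpM2l ?powR_ge0//.
have pq1 : (0 <= p / q' - 1)%R by rewrite subr_ge0 ler_pdivlMr// mul1r.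
have pq0 : (0 < p / q')%R by rewrite divr_gt0.
rewrite -(mulr_powRB1 (T0 y) pq0) mulrC; apply: ler_wpM2r => //.
by apply: ge0_ler_powR; rewrite ?nnegrE// addr_ge0// exprn_ge0.
Qed.

Lemma bump_const_ge0 : (0 <= bump_const)%R.
Proof. by rewrite mulr_ge0 ?powR_ge0. Qed.

Lemma cubeLp_test_le j k (I : R) : (0 <= I)%R ->
  \int[lam]_(y in cube j k) (T y)%:E <= I%:E ->
  cubeLp p j k (fun y => lq q (fun k => (wblock f k y)%:E)) <=
  (l * C * (bump_const * I) `^ p^-1)%R%:E.
Proof.
move=> I0 hI; have mP := @measurable_dyadic_cube R d j k.
have q0 : 0 < q by apply: lt_le_trans q'q; rewrite lte_fin.
have lC0 : (0 <= l * C)%R by rewrite mulr_ge0// ltW.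
have mT : measurable_fun (cube j k) (fun y => (T y)%:E).
  apply: measurable_funTS; apply/measurable_EFinP; apply: measurable_sum => i.
  exact: measurable_scaled_weight.
rewrite /cubeLp poweRV_le//; last 2 first.
- by apply: integral_ge0 => y _; rewrite poweR_ge0.
- by rewrite lee_fin mulr_ge0 ?powR_ge0.
rewrite poweR_EFin powRM ?powR_ge0// -powRrM mulVf ?gt_eqF// powRr1; last first.
  by rewrite mulr_ge0 ?bump_const_ge0.
apply: (@le_trans _ _ (\int[lam]_(y in cube j k)
    (((l * C) `^ p * bump_const)%R%:E * (T y)%:E))).
  apply: ge0_le_integral => //.
  - by move=> y _; rewrite poweR_ge0.
  - apply: measurable_funTS; apply: (measurableT_comp (measurable_poweR _)).
    exact: measurable_lq_wblock.
  - exact: measurable_funeM.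
  - by move=> y _; rewrite -EFinM lq_test_powR_le.
rewrite ge0_integralZl_EFin ?mulr_ge0 ?powR_ge0 ?bump_const_ge0//; last first.
  by move=> y _; rewrite lee_fin.
rewrite mulrA [leRHS]EFinM; apply: lee_wpmul2l => //.
by rewrite lee_fin mulr_ge0 ?powR_ge0 ?bump_const_ge0.
Qed.

Definition bump_const2 : R := (bump_const * (1 + 2 ^+ d + 4 ^+ (2 * d)))%R.

Let K : R := (1 + 2 ^+ d + 4 ^+ (2 * d))%R.

Let K1 : (1 + 4 ^+ (2 * d) <= K)%R.
Proof. by rewrite /K lerD2r lerDl exprn_ge0. Qed.

Let K2 : (2 ^+ d + 4 ^+ (2 * d) <= K)%R.
Proof. by rewrite /K lerD2r lerDr. Qed.

Let K3 : (2 ^+ d <= K)%R.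
Proof. by apply: le_trans K2; rewrite lerDl exprn_ge0. Qed.

Let K0 : (0 <= K)%R.
Proof. by apply: le_trans K3; rewrite exprn_ge0. Qed.

(* [N t^d] is the volume occupied by [N] packets of width [t]. *)
Lemma cubeLp_test_le2 j k (N t : R) : (0 <= N)%R -> (0 <= t)%R ->
  \int[lam]_(y in cube j k) (T y)%:E <= (K * (N * t ^+ d))%R%:E ->
  cubeLp p j k (fun y => lq q (fun k => (wblock f k y)%:E)) <=
  (l * (C * bump_const2 `^ p^-1) * N `^ p^-1 * t `^ (d%:R / p))%R%:E.
Proof.
move=> N0 t0 h; have td : (0 <= t ^+ d)%R by exact: exprn_ge0.
have h0 : (0 <= K * (N * t ^+ d))%R by apply: mulr_ge0 => //; exact: mulr_ge0.
apply: le_trans (cubeLp_test_le h0 h) _.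
rewrite lee_fin mulrA -/bump_const2.
rewrite powRM ?mulr_ge0 ?bump_const_ge0// powRM//.
by rewrite -(powR_mulrn d t0) -powRrM !mulrA.
Qed.

Lemma E_norm_spread_le (C' : R) : (forall t, 0 < t -> rphi d p phi t <= C')%R -> r = 1%R ->
  E_norm eta0 eta s phi p q f <=
  (l * (C' * (C * bump_const2 `^ p^-1) * n%:R `^ p^-1))%R%:E.
Proof.
move=> hC' r1; have q0 : 0 < q by apply: lt_le_trans q'q; rewrite lte_fin.
have lC0 : (0 <= l * C)%R by rewrite mulr_ge0// ltW.
rewrite E_normE//; apply: morrey_norm_le => j k.
have h : \int[lam]_(y in cube j k) (T y)%:E <= (K * (n%:R * 1 ^+ d))%R%:E.
  have := @integral_bump_sum_le R d n r D r0; rewrite r1 expr1n !mulr1 => h.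
  apply: (@le_trans _ _ (\int[lam]_y (T y)%:E)).
    apply: ge0_subset_integral => //; first exact: measurable_dyadic_cube.
    - apply/measurable_EFinP; apply: measurable_sum => i; exact: measurable_scaled_weight.
    - by move=> y _; rewrite lee_fin.
  rewrite /T xE r1; apply: le_trans h _; rewrite lee_fin mulrC.
  by apply: ler_wpM2r => //; exact: K3.
have h2 := cubeLp_test_le2 (ler0n _ _) ler01 h.
rewrite powR1 mulr1 in h2.
apply: (@le_trans _ _ (C'%:E * (l * (C * bump_const2 `^ p^-1) * n%:R `^ p^-1)%R%:E)).
  apply: lee_pmul => //.
  - by rewrite lee_fin ltW// rphi_gt0// side_gt0.
  - exact: cubeLp_ge0.
  - by rewrite lee_fin; apply: hC'; exact: side_gt0.
by rewrite -EFinM lee_fin le_eqVlt; apply/orP; left; apply/eqP; ring.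
Qed.

(** No cube gives more than a constant times [phi r = r ^ (d/p) * rphi r]. Up to side [r] this is
    monotonicity of [phi]. Between [r] and [D / 4] a cube sees one packet and [rphi] is
    nonincreasing. Beyond [D / 4] it may see all [n] packets, and the hypothesis makes [rphi] small
    enough to offset [n ^ (1/p)]. *)
Lemma E_norm_spread_le2 : (n%:R `^ p^-1 * rphi d p phi (D / 4) <= rphi d p phi r)%R ->
  E_norm eta0 eta s phi p q f <=
  (l * (C * bump_const2 `^ p^-1) * (r `^ (d%:R / p) * rphi d p phi r))%R%:E.
Proof.
move=> hD; have q0 : 0 < q by apply: lt_le_trans q'q; rewrite lte_fin.
have lC0 : (0 <= l * (C * bump_const2 `^ p^-1))%R.
  by rewrite !mulr_ge0 ?powR_ge0// ltW.
have D0 : (0 < D)%R by apply: lt_le_trans rD; rewrite mulr_gt0// ltr0n.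
rewrite E_normE//; apply: morrey_norm_le => j k.
have s0 := side_gt0 R j; have rj : (0 < rphi d p phi (side R j))%R by exact: rphi_gt0.
suff [N [t [N0 t0 hI hN]]] : exists N t : R, [/\ (0 <= N)%R, (0 <= t)%R,
    \int[lam]_(y in cube j k) (T y)%:E <= (K * (N * t ^+ d))%R%:E &
    (rphi d p phi (side R j) * N `^ p^-1 * t `^ (d%:R / p) <= r `^ (d%:R / p) * rphi d p phi r)%R].
  apply: (@le_trans _ _ ((rphi d p phi (side R j))%:E *
      (l * (C * bump_const2 `^ p^-1) * N `^ p^-1 * t `^ (d%:R / p))%R%:E)).
    apply: lee_wpmul2l; first by rewrite lee_fin ltW.
    exact: cubeLp_test_le2.
  rewrite -EFinM lee_fin [leLHS](_ : _ = (l * (C * bump_const2 `^ p^-1) *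
    (rphi d p phi (side R j) * N `^ p^-1 * t `^ (d%:R / p)))%R); last by ring.
  exact: ler_wpM2l.
have [jr|rj'] := leP (side R j) r.
  exists 1%R, (side R j); split => //; first exact: ltW.
    rewrite mul1r /T xE; apply: le_trans (integral_bump_sum_small d0 n0 r0 rD j k) _.
    rewrite lee_fin ler_wpM2r ?exprn_ge0 ?(ltW s0)//.
  have [_ hm _] := hphi; have := hm _ _ s0 jr.
  have E u : (0 < u)%R -> phi u = (u `^ (d%:R / p) * rphi d p phi u)%R.
    by move=> u0; rewrite /rphi powRN mulVKf// gt_eqF// powR_gt0.
  by rewrite powR1 mulr1 mulrC !E.
have [jD|jD] := leP (side R j) (D / 4)%R.
  exists 1%R, r; split => //; first exact: ltW.
    rewrite mul1r /T xE; apply: le_trans (integral_bump_sum_medium d0 n0 r0 rD k jD) _.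
    rewrite lee_fin ler_wpM2r ?exprn_ge0 ?(ltW r0)//.
  rewrite powR1 mulr1 mulrC ler_wpM2l ?powR_ge0//; apply: rphi_noninc => //.
  exact: ltW.
exists n%:R, r; split => //; first exact: ltW.
  apply: (@le_trans _ _ (\int[lam]_y (T y)%:E)).
    apply: ge0_subset_integral => //; first exact: measurable_dyadic_cube.
    - apply/measurable_EFinP; apply: measurable_sum => i; exact: measurable_scaled_weight.
    - by move=> y _; rewrite lee_fin.
  rewrite /T xE; apply: le_trans (@integral_bump_sum_le R d n r D r0) _.
  rewrite lee_fin mulrCA ler_wpM2r//; first by rewrite mulr_ge0// exprn_ge0// ltW.
rewrite mulrC ler_wpM2l ?powR_ge0//; apply: le_trans hD; rewrite mulrC.
rewrite ler_wpM2l ?powR_ge0//; apply: rphi_noninc => //; last exact: ltW.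
by rewrite divr_gt0.
Qed.

End spread_bounds.

Section concentrated_bounds.
Variable q : \bar R.
Hypotheses (qpos : 0 < q) (Mp : ((2 * d)%:R <= M%:R * p)%R) (r1 : r = 1%R) (xE : x = (fun=> 0%R)).

(* [1/q], with [1/+oo = 0] *)

Definition inve : R := if q is u%:E then u^-1%R else 0%R.

(** All packets have the same envelope, so the norm counts pairs of a packet and a block near it;
    for infinite [q] the supremum sees a single pair. *)
Lemma lq_concentrated_le y : lq q (fun k => (wblock f k y)%:E) <=
  (l * C * ((2 * c + 1)%:R * n%:R) `^ inve * weight M y)%R%:E.
Proof.
have lC0 : (0 <= l * C)%R by rewrite mulr_ge0// ltW.
have E j : (r^-1 *: (y - x j))%R = y by rewrite xE r1 invr1 scale1r subr0.
have w0 := weight_ge0 M y.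
rewrite /inve; have := @lq_test_le q; case: q qpos => [u| |]// u0 h.
  apply: le_trans (h u y u0 (lexx _)) _; rewrite lee_fin.
  rewrite lte_fin in u0.
  under eq_bigr do rewrite E.
  rewrite sumr_const card_ord -[(_ *+ n)%R]mulr_natl [X in (X `^ _)%R]mulrA powRM ?powR_ge0 ?mulr_ge0//.
  by rewrite -powRrM mulfV ?gt_eqF// powRr1// mulrA.
apply: ge_ereal_sup => _ [k _ <-]; rewrite lee_fin powRr0 mulr1.
apply: le_trans (upper k y) _; rewrite ler_wpM2l//; apply: sum_near_le => // j.
by rewrite E w0 lexx.
Qed.

Lemma E_norm_concentrated_le (C' : R) : (forall t, 0 < t -> rphi d p phi t <= C')%R ->
  E_norm eta0 eta s phi p q f <=
  (l * (C' * C * (2 * c + 1)%:R `^ inve * (2 ^+ d) `^ p^-1 * n%:R `^ inve))%R%:E.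
Proof.
move=> hC'; have lC0 : (0 <= l * C)%R by rewrite mulr_ge0// ltW.
have C'0 : (0 <= C')%R by apply: le_trans (hC' 1%R ltr01); rewrite ltW// rphi_gt0.
have mw : measurable_fun setT (fun y : V => weight M y) by exact: measurable_weight.
set A := (l * C * ((2 * c + 1)%:R * n%:R) `^ inve)%R.
have A0 : (0 <= A)%R by rewrite mulr_ge0 ?powR_ge0.
have mA : measurable_fun setT (fun y : V => (A * weight M y)%R%:E).
  by apply/measurable_EFinP; exact: measurable_funM.
have mlq := measurable_lq_wblock f qpos.
rewrite E_normE//; apply: le_trans (morrey_norm_le_Lp p0 hphi mlq hC') _.
apply: (@le_trans _ _ (C'%:E * Lp lam p (fun y => (A * weight M y)%R%:E))).
  apply: lee_wpmul2l; first by rewrite lee_fin.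
  apply: le_Lp => //; last exact: lq_concentrated_le.
  by move=> y; apply: lq_ge0 => // k; rewrite lee_fin wblock_ge0.
apply: (@le_trans _ _ (C'%:E * (A * (2 ^+ d) `^ p^-1)%R%:E)).
  apply: lee_wpmul2l; first by rewrite lee_fin.
  rewrite /Lp poweRV_le//; last 2 first.
  - by apply: integral_ge0 => y _; rewrite poweR_ge0.
  - by rewrite lee_fin mulr_ge0 ?powR_ge0.
  rewrite poweR_EFin powRM ?powR_ge0// -powRrM mulVf ?gt_eqF// powRr1 ?exprn_ge0//.
  apply: (@le_trans _ _ (\int[lam]_y ((A `^ p)%:E * (weight (2 * d) y)%:E))).
    apply: ge0_le_integral => //.
    - by move=> y _; rewrite poweR_ge0.
    - by apply: (measurableT_comp (measurable_poweR _)).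
    - apply: measurable_funeM; apply/measurable_EFinP; exact: measurable_weight.
    - move=> y _; rewrite poweR_EFin -EFinM lee_fin powRM ?weight_ge0//.
      by rewrite ler_wpM2l ?powR_ge0// weight_powR_le.
  rewrite ge0_integralZl_EFin ?powR_ge0//; last 2 first.
  - by move=> y _; rewrite lee_fin weight_ge0.
  - by apply/measurable_EFinP; exact: measurable_weight.
  rewrite EFinM; apply: lee_wpmul2l; first by rewrite lee_fin powR_ge0.
  exact: integral_weight_le.
rewrite -EFinM lee_fin /A powRM// le_eqVlt; apply/orP; left; apply/eqP; ring.
Qed.

End concentrated_bounds.

End test_bounds.

End norms.

(** * Failure of the embeddings *)

Section necessity.
Local Open Scope ereal_scope.
Context (R : realType) (d : nat) (d0 : (0 < d)%N).
Variables (eta0 eta : 'rV[R]_d -> R) (heta : admissible_eta eta0 eta).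
Variables (p s : R) (q : \bar R) (q0 : R) (phi : R -> R).
Hypotheses (p0 : (0 < p)%R) (qpos : 0 < q) (q00 : (0 < q0)%R) (hphi : class_G d p phi).

Lemma bump_const2_gt0 c (q' : R) : (0 < bump_const2 d p c q')%R.
Proof.
have e (k : nat) (u : R) : (0 < u)%R -> (0 < u ^+ k)%R by exact: exprn_gt0.
rewrite /bump_const2 /bump_const; apply: mulr_gt0; first apply: mulr_gt0.
- by rewrite powR_gt0// ltr0n addn1.
- by rewrite powR_gt0// addr_gt0// e.
- by rewrite !addr_gt0// e.
Qed.

Lemma exists_trunc_exp (e : R) : (0 < e)%R -> exists M : nat, ((2 * d)%:R <= M%:R * e)%R.
Proof.
move=> e0; exists (Num.trunc ((2 * d)%:R / e)).+1.
by rewrite -ler_pdivrMr// ltW// truncnS_gt.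
Qed.

Lemma test_family_le1 (M : nat) :
  exists (C c0 c1 : R) (c : nat), [/\ (0 < C)%R, (0 < c0)%R, (0 < c1)%R, (c1 <= 1)%R &
    forall n (x : 'I_n -> 'rV[R]_d) (r l : R), (0 < r)%R -> (0 <= l)%R ->
    exists (f : functional R d) (J0 : nat), [/\ tempered f,
      forall k y, (wblock eta0 eta s f k y <= l * C *
        \sum_(j < n) ((freq_near c (test_freq c J0 j) k)%:R * weight M (r^-1 *: (y - x j))))%R &
      forall (j : 'I_n) y, (`|y - x j| <= c1 * r)%R ->
        (l * c0 <= wblock eta0 eta s f (test_freq c J0 j) y)%R]].
Proof.
have [C [c0 [c1 [c [C0 c00 c10 H]]]]] := test_family d0 heta s M.
exists C, c0, (Num.min c1 1%R), c; split => //.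
- by rewrite lt_min c10 ltr01.
- by rewrite ge_min lexx orbT.
move=> n x r l r0 l0; have [f [J0 [tf up low]]] := H n x r l r0 l0.
exists f, J0; split => // j y hy; apply: low; apply: le_trans hy _.
by rewrite ler_pM2r// ge_min lexx.
Qed.

Let E0 : E_norm eta0 eta s phi p q (fun=> 0%R) = 0.
Proof. exact: E_norm0. Qed.

Lemma not_embeds_lt_q : limit_condition d p phi -> q0%:E < q ->
  ~ embeds (E_norm eta0 eta s phi p q) (N_norm eta0 eta s phi p q0%:E).
Proof.
move=> /(limit_conditionP hphi)[c' [C' [c'0 C'0 hC]]] q0q.
have [M hM] := exists_trunc_exp p0.
have [C [c0 [c1 [c [C0 c00 c10 c11 H]]]]] := test_family_le1 M.
have rp : (0 < rphi d p phi 1)%R by exact: rphi_gt0.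
apply: (not_embeds (A := (C' * C * (2 * c + 1)%:R `^ inve q * (2 ^+ d) `^ p^-1)%R)
  (B := (c0 * (c1 / 2) `^ (d%:R / p) * (1 `^ (d%:R / p) * rphi d p phi 1))%R)
  (e := inve q) (e' := q0^-1%R) E0).
- by rewrite !mulr_gt0 ?powR_gt0 ?exprn_gt0// ltr0n addn1.
- apply: mulr_gt0; apply: mulr_gt0 => //; rewrite powR_gt0// divr_gt0//.
- rewrite /inve; case: (q) qpos q0q => [u| |]// u0; last by rewrite invr_gt0.
  by rewrite lte_fin ltf_pV2// posrE.
move=> n l n0 l0; have [f [J0 [tf up low]]] := H n (fun=> 0%R) 1%R l ltr01 l0.
exists f; split => //; last first.
  exact: (N_norm_test_ge p0 hphi ltr01 l0 c00 c10 c11 low q00).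
apply: (E_norm_concentrated_le p0 hphi l0 C0 up qpos hM) => // t t0.
by have /andP[] := hC t t0.
Qed.

Let exists_q' : exists q' : R, [/\ (0 < q')%R, q'%:E <= q & (q' <= p)%R].
Proof.
case: (q) qpos => [u| |]// u0; last by exists p; rewrite leey.
exists (Num.min u p); rewrite lt_min p0 lee_fin !ge_min !lexx orbT; split => //.
by rewrite andbT.
Qed.

Lemma not_embeds_lt_p : limit_condition d p phi -> (q0 < p)%R ->
  ~ embeds (E_norm eta0 eta s phi p q) (N_norm eta0 eta s phi p q0%:E).
Proof.
move=> /(limit_conditionP hphi)[c' [C' [c'0 C'0 hC]]] q0p.
have [q' [q'0 q'q q'p]] := exists_q'.
have [M hM] := exists_trunc_exp q'0.
have [C [c0 [c1 [c [C0 c00 c10 c11 H]]]]] := test_family_le1 M.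
have rp : (0 < rphi d p phi 1)%R by exact: rphi_gt0.
apply: (not_embeds (A := (C' * (C * bump_const2 d p c q' `^ p^-1))%R)
  (B := (c0 * (c1 / 2) `^ (d%:R / p) * (1 `^ (d%:R / p) * rphi d p phi 1))%R)
  (e := p^-1%R) (e' := q0^-1%R) E0).
- rewrite !mulr_gt0// powR_gt0//; exact: bump_const2_gt0.
- apply: mulr_gt0; apply: mulr_gt0 => //; rewrite powR_gt0// divr_gt0//.
- by rewrite ltf_pV2// posrE.
move=> n l n0 l0.
(* Width 1 and distance [n] just meet the separation condition [n * r <= D]. *)
have [f [J0 [tf up low]]] := H n (@spread R d n n%:R) 1%R l ltr01 l0.
exists f; split => //; last first.
  exact: (N_norm_test_ge p0 hphi ltr01 l0 c00 c10 c11 low q00).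
have nD : (n%:R * 1 <= n%:R :> R)%R by rewrite mulr1.
apply: (E_norm_spread_le d0 p0 hphi ltr01 l0 C0 up q'0 q'q q'p hM n0 nD) => //.
by move=> t t0; have /andP[] := hC t t0.
Qed.

(** Otherwise [rphi t <= K * rphi u] for all positive [t] and [u], and comparison with [rphi 1] on
    either side bounds [rphi] above and below. *)
Lemma rphi_gap n : (0 < n)%N -> ~ limit_condition d p phi ->
  exists r D : R, [/\ (0 < r)%R, (n%:R * r <= D)%R &
    (n%:R `^ p^-1 * rphi d p phi (D / 4) <= rphi d p phi r)%R].
Proof.
move=> n0 hn; apply: contrapT => hno; apply: hn; apply/limit_conditionP => //.
have nr : (0 < n%:R :> R)%R by rewrite ltr0n.
set K := (n%:R `^ p^-1 : R)%R.
have K0 : (0 < K)%R by rewrite powR_gt0.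
have g0 t : (0 < t)%R -> (0 < rphi d p phi t)%R by exact: rphi_gt0.
have key (t u : R) : (0 < t)%R -> (0 < u)%R -> (rphi d p phi t <= K * rphi d p phi u)%R.
  move=> t0 u0; rewrite leNgt; apply/negP => h; apply: hno.
  (* The first entry makes [D / 4 >= u], hence [rphi (D / 4) <= rphi u]; the second is the
     separation condition. *)
  exists t, (Num.max (4 * u) (n%:R * t))%R; split => //.
    by rewrite le_max lexx orbT.
  apply: ltW; apply: le_lt_trans h; rewrite ler_pM2l//; apply: rphi_noninc => //.
  by rewrite ler_pdivlMr// mulrC le_max lexx.
exists (rphi d p phi 1 / K)%R, (K * rphi d p phi 1)%R; split.
- by rewrite divr_gt0 ?g0.
- by rewrite mulr_gt0 ?g0.
move=> t t0; rewrite key// andbT ler_pdivrMr// mulrC; exact: key.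
Qed.

(** The width depends on [n] in an uncontrolled way, so the amplitude is divided by [g = phi r], the
    common scale of both norms. The source norm is then bounded in [n], which is the case
    [e = 0]. *)
Lemma not_embeds_unbounded : ~ limit_condition d p phi ->
  ~ embeds (E_norm eta0 eta s phi p q) (N_norm eta0 eta s phi p q0%:E).
Proof.
move=> hn; have [q' [q'0 q'q q'p]] := exists_q'.
have [M hM] := exists_trunc_exp q'0.
have [C [c0 [c1 [c [C0 c00 c10 c11 H]]]]] := test_family_le1 M.
apply: (not_embeds (A := (C * bump_const2 d p c q' `^ p^-1)%R)
  (B := (c0 * (c1 / 2) `^ (d%:R / p))%R) (e := 0%R) (e' := q0^-1%R) E0).
- rewrite mulr_gt0// powR_gt0//; exact: bump_const2_gt0.
- by rewrite mulr_gt0// powR_gt0// divr_gt0.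
- by rewrite invr_gt0.
move=> n l n0 l0.
have [r [D [r0 rD hD]]] := rphi_gap n0 hn.
set g := (r `^ (d%:R / p) * rphi d p phi r)%R.
have g0 : (0 < g)%R by apply: mulr_gt0; [exact: powR_gt0|exact: rphi_gt0].
have l'0 : (0 <= l / g)%R by rewrite divr_ge0// ltW.
have [f [J0 [tf up low]]] := H n (@spread R d n D) r (l / g)%R r0 l'0.
exists f; split => //.
  apply: le_trans (E_norm_spread_le2 d0 p0 hphi r0 l'0 C0 up q'0 q'q q'p hM n0 rD erefl hD) _.
  rewrite lee_fin -/g powRr0 mulr1 le_eqVlt; apply/orP; left; apply/eqP; field.
  by rewrite gt_eqF.
apply: le_trans (N_norm_test_ge p0 hphi r0 l'0 c00 c10 c11 low q00).
rewrite lee_fin -/g le_eqVlt; apply/orP; left; apply/eqP; field.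
by rewrite gt_eqF.
Qed.

End necessity.

Theorem theorem3p3 (R : realType) (d : nat) (hd : (0 < d)%N)
  (eta0 eta : 'rV[R]_d -> R) (heta : admissible_eta eta0 eta)
  (p s : R) (q q0 : \bar R) (phi : R -> R)
  (hp : 0 < p) (hq : (0 < q)%E) (hq0 : (0 < q0)%E)
  (hphi : class_G d p phi)
  (hphi' : (q < +oo)%E -> exists C eps : R, [/\ 0 < C, 0 < eps &
     forall r t : R, 0 < r -> r <= t ->
       t `^ eps / phi t <= C * r `^ eps / phi r]) :
  [/\ embeds (N_norm eta0 eta s phi p (Order.min p%:E q))
             (E_norm eta0 eta s phi p q),
      limit_condition d p phi ->
        (embeds (E_norm eta0 eta s phi p q) (N_norm eta0 eta s phi p q0) <->
         (Order.max p%:E q <= q0)%E) &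
      ~ limit_condition d p phi ->
        (embeds (E_norm eta0 eta s phi p q) (N_norm eta0 eta s phi p q0) <->
         q0 = +oo%E)].
Proof.
split.
- by apply: (embeds_of_le ltr01) => f; rewrite mul1e; exact: E_le_N_min.
- move=> hl; split => [emb|hmax]; last first.
    by have [C C0 h] := N_le_E eta0 eta s hp hphi hq hmax hl; exact: embeds_of_le C0 h.
  case: q0 hq0 emb => [u| |]// u0 emb; last by rewrite leey.
  rewrite ge_max lee_fin !leNgt; apply/andP; split; apply/negP => h.
    exact: (not_embeds_lt_p hd heta hp hq u0 hphi hl h emb).
  exact: (not_embeds_lt_q hd heta hp hq u0 hphi hl h emb).
- move=> hl; split => [emb|->]; last first.
    by apply: (embeds_of_le ltr01) => f; rewrite mul1e; exact: N_y_le_E.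
  case: q0 hq0 emb => [u| |]// u0 emb.
  by case: (not_embeds_unbounded hd heta hp hq u0 hphi hl emb).
Qed.
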